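(* Let $(\gamma,v_1,v_2):I\to H^3\times\Delta_5$ be a hyperbolic framed curve with $a^2+b^2\neq0$ and $\sigma_F>0$ on $I$, and let $p_0=(t_0,\theta_0)$ be a singular point of $F^d_{\mathcal{E}^h}$. Then $p_0$ is a non-degenerate singular point of the first kind, and, writing $\varepsilon^h=\frac{AN\sqrt{A^2-M^2}\,(MA'-M'A)'-(AN\sqrt{A^2-M^2})'\,(MA'-M'A)}{(AN)^2(A^2-M^2)-(M'A-MA')^2}-\frac{MN}{\sqrt{A^2-M^2}}$, (1) $p_0$ is a cuspidal edge iff $\varepsilon^h(t_0)\neq0$; (2) $p_0$ is a cuspidal cross cap iff $\varepsilon^h(t_0)=0$ and $(\varepsilon^h)'(t_0)\neq0$.
   Context: $\mathbb{R}^4_1$ denotes $\mathbb{R}^4$ with $\langle x,y\rangle=-x_0y_0+x_1y_1+x_2y_2+x_3y_3$; $H^3=\{x:\langle x,x\rangle=-1\}$, $S^3_1=\{x:\langle x,x\rangle=1\}$. For $x^1,x^2,x^3\in\mathbb{R}^4_1$, $x^1\wedge x^2\wedge x^3$ is the vector given by the formal determinant with first row $(-e_0,e_1,e_2,e_3)$ and the components of $x^1,x^2,x^3$ as remaining rows. Let $\Delta_5=\{(v_1,v_2)\in S^3_1\times S^3_1:\langle v_1,v_2\rangle=0\}$. A hyperbolic framed curve is a smooth map $(\gamma,v_1,v_2):I\to H^3\times\Delta_5$ with $\langle\gamma,v_i\rangle=\langle\gamma',v_i\rangle=0$. Put $\mu=\gamma\wedge v_1\wedge v_2$; then $\gamma'=m\mu$,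 $v_1'=nv_2+a\mu$, $v_2'=-nv_1+b\mu$, $\mu'=m\gamma-av_1-bv_2$ with $m=\langle\gamma',\mu\rangle$, $n=\langle v_1',v_2\rangle$, $a=\langle v_1',\mu\rangle$, $b=\langle v_2',\mu\rangle$. Put $f=ab'-a'b+n(a^2+b^2)$. With $a^2+b^2\neq0$, the Frenet type frame is $n_1=(av_1+bv_2)/\sqrt{a^2+b^2}$, $n_2=(-bv_1+av_2)/\sqrt{a^2+b^2}$, giving $\gamma'=M\mu$, $n_1'=Nn_2+A\mu$, $n_2'=-Nn_1$, $\mu'=M\gamma-An_1$ with $M=m$, $N=f/(a^2+b^2)$, $A=\sqrt{a^2+b^2}$; $\sigma_F=A^2N^2(A^2-M^2)-(MA'-M'A)^2$ (note $\sigma_F>0$ forces $A^2>M^2$). The hyperbolic evolute is $\mathcal{E}^h_\gamma=\frac{1}{\sqrt{\sigma_F}}(A^2N\gamma-MAN\,n_1+(MA'-M'A)\,n_2):I\to H^3$. Its $\Delta_1$-dual surface is $F^d_{\mathcal{E}^h}:I\times[0,2\pi)\to S^3_1$, $F^d_{\mathcal{E}^h}(t,\theta)=\cos\theta\,\mu(t)+\sin\theta\,\frac{-M\gamma+An_1}{\sqrt{A^2-M^2}}(t)$; it satisfies $\langle F^d_{\mathcal{E}^h},\mathcal{E}^h_\gamma\rangle=0$ and $\langle dF^d_{\mathcal{E}^h},\mathcal{E}^h_\gamma\rangle=0$, and $\lambda=\det(F^d_{\mathcal{E}^h},(F^d_{\mathcal{E}^h})_t,(F^d_{\mathcal{E}^h})_\theta,\mathcal{E}^h_\gamma)=-\sin\theta\frac{\sqrt{\sigma_F}}{A^2-M^2}$,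 so its singular set is $\{\sin\theta=0\}$. A singular point $p$ is non-degenerate if $d\lambda(p)\neq0$; it is of the first kind if moreover a nonzero vector field $\eta$ spanning $\ker dF$ along the singular curve is transversal to the singular curve at $p$. Cuspidal edge: germ $\mathcal{A}$-equivalent to $(u,v)\mapsto(u,v^2,v^3)$; cuspidal cross cap: $(u,v)\mapsto(u,v^2,uv^3)$, at $0$. *)

(* Defs.v *)
From HB Require Import structures.
From mathcomp Require Import all_boot all_order all_algebra.
From mathcomp Require Import all_classical all_reals all_analysis.
Set Implicit Arguments. Unset Strict Implicit. Unset Printing Implicit Defensive.
Import Order.TTheory GRing.Theory Num.Theory.
Import numFieldNormedType.Exports.
Local Open Scope classical_set_scope.
Local Open Scope ring_scope.

Section Defs.
Variable R : realType.

Definition o1 : 'I_4 := @Ordinal 4 1 isT.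
Definition o2 : 'I_4 := @Ordinal 4 2 isT.
Definition o3 : 'I_4 := @Ordinal 4 3 isT.
Definition t_ : 'I_2 := @Ordinal 2 0 isT.
Definition th_ : 'I_2 := @Ordinal 2 1 isT.

Definition lor (x y : 'rV[R]_4) : R :=
  - x 0 0 * y 0 0 + x 0 o1 * y 0 o1 + x 0 o2 * y 0 o2 + x 0 o3 * y 0 o3.

Definition rows4 (x y z w : 'rV[R]_4) : 'M[R]_4 :=
  \matrix_(i < 4, j < 4) (nth 0 [:: x; y; z; w] i) 0 j.

(* x ^ y ^ z : formal determinant with first row (-e0, e1, e2, e3),
   expanded along the first row *)
Definition wedge (x y z : 'rV[R]_4) : 'rV[R]_4 :=
  \row_(j < 4) ((if j == 0 then -1 else 1) * cofactor (rows4 0 x y z) 0 j).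

Fixpoint Dl n m (vs : seq 'rV[R]_n) (f : 'rV[R]_n -> 'rV[R]_m) : 'rV[R]_n -> 'rV[R]_m :=
  match vs with
  | [::] => f
  | v :: vs' => fun x => derive (Dl vs' f) x v
  end.

Definition smooth_on n m (U : set 'rV[R]_n) (f : 'rV[R]_n -> 'rV[R]_m) : Prop :=
  forall (vs : seq 'rV[R]_n) x, U x -> differentiable (Dl vs f) x.

Definition smooth_curve (I : set R) (c : R -> 'rV[R]_4) : Prop :=
  forall k t, I t -> derivable (iter k (@derive1 R _) c) t 1.

Definition diffeo_germ n (phi : 'rV[R]_n -> 'rV[R]_n) (x y : 'rV[R]_n) : Prop :=
  exists (U V : set 'rV[R]_n) (psi : 'rV[R]_n -> 'rV[R]_n),
    [/\ open U /\ open V, U x /\ phi x = y,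
        smooth_on U phi /\ smooth_on V psi,
        (forall z, U z -> V (phi z) /\ psi (phi z) = z) &
        (forall z, V z -> U (psi z) /\ phi (psi z) = z)].

Definition A_equiv (f : 'rV[R]_2 -> 'rV[R]_4) (p : 'rV[R]_2)
    (g : 'rV[R]_2 -> 'rV[R]_4) (q : 'rV[R]_2) : Prop :=
  exists (phi : 'rV[R]_2 -> 'rV[R]_2) (Phi : 'rV[R]_4 -> 'rV[R]_4),
    [/\ diffeo_germ phi q p, diffeo_germ Phi (f p) (g q) &
        \forall z \near q, Phi (f (phi z)) = g z].

(* standard germs (composed with the inclusion R^3 = R^3 x {0} in R^4) *)
Definition cusp_edge (z : 'rV[R]_2) : 'rV[R]_4 :=
  \row_(j < 4) nth 0 [:: z 0 t_; z 0 th_ ^+ 2; z 0 th_ ^+ 3; 0] j.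
Definition cusp_crosscap (z : 'rV[R]_2) : 'rV[R]_4 :=
  \row_(j < 4) nth 0 [:: z 0 t_; z 0 th_ ^+ 2; z 0 t_ * z 0 th_ ^+ 3; 0] j.

Definition cuspidal_edge (f : 'rV[R]_2 -> 'rV[R]_4) p := A_equiv f p cusp_edge 0.
Definition cuspidal_crosscap (f : 'rV[R]_2 -> 'rV[R]_4) p :=
  A_equiv f p cusp_crosscap 0.

(* singular points, non-degeneracy (w.r.t. an identifier of singularities lam),
   first kind *)
Definition singular_point (f : 'rV[R]_2 -> 'rV[R]_4) p : Prop :=
  exists v : 'rV[R]_2, v != 0 /\ derive f p v = 0.
Definition nondegenerate (lam : 'rV[R]_2 -> R) p : Prop :=
  differentiable lam p /\ exists v : 'rV[R]_2, derive lam p v != 0.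
Definition first_kind (f : 'rV[R]_2 -> 'rV[R]_4) (lam : 'rV[R]_2 -> R) p : Prop :=
  singular_point f p /\ nondegenerate lam p /\
  forall eta : 'rV[R]_2, eta != 0 -> derive f p eta = 0 -> derive lam p eta != 0.

Definition e_t : 'rV[R]_2 := delta_mx 0 t_.
Definition e_th : 'rV[R]_2 := delta_mx 0 th_.

Definition hyp_framed_curve (I : set R) (g v1 v2 : R -> 'rV[R]_4) : Prop :=
  [/\ smooth_curve I g, smooth_curve I v1, smooth_curve I v2 &
   forall t, I t ->
     [/\ lor (g t) (g t) = -1, lor (v1 t) (v1 t) = 1, lor (v2 t) (v2 t) = 1,
         lor (v1 t) (v2 t) = 0 &
         [/\ lor (g t) (v1 t) = 0, lor (g t) (v2 t) = 0,
             lor (derive1 g t) (v1 t) = 0 & lor (derive1 g t) (v2 t) = 0]]].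

Section Curve.
Variables g v1 v2 : R -> 'rV[R]_4.

Definition mu t := wedge (g t) (v1 t) (v2 t).
Definition m_ t := lor (derive1 g t) (mu t).
Definition n_ t := lor (derive1 v1 t) (v2 t).
Definition a_ t := lor (derive1 v1 t) (mu t).
Definition b_ t := lor (derive1 v2 t) (mu t).
Definition f_ t := a_ t * derive1 b_ t - derive1 a_ t * b_ t + n_ t * (a_ t ^+ 2 + b_ t ^+ 2).
Definition MM t := m_ t.
Definition NN t := f_ t / (a_ t ^+ 2 + b_ t ^+ 2).
Definition AA t := Num.sqrt (a_ t ^+ 2 + b_ t ^+ 2).
Definition n1 t := (AA t)^-1 *: (a_ t *: v1 t + b_ t *: v2 t).
Definition n2 t := (AA t)^-1 *: (- b_ t *: v1 t + a_ t *: v2 t).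
Definition KK t := MM t * derive1 AA t - derive1 MM t * AA t.
Definition sigmaF t :=
  AA t ^+ 2 * NN t ^+ 2 * (AA t ^+ 2 - MM t ^+ 2) - KK t ^+ 2.
Definition evol t :=
  (Num.sqrt (sigmaF t))^-1 *:
    (AA t ^+ 2 * NN t *: g t - MM t * AA t * NN t *: n1 t + KK t *: n2 t).
Definition nu t :=
  (Num.sqrt (AA t ^+ 2 - MM t ^+ 2))^-1 *: (- MM t *: g t + AA t *: n1 t).
(* Delta_1-dual surface of the evolute, p = (t, theta) *)
Definition Fd (p : 'rV[R]_2) : 'rV[R]_4 :=
  cos (p 0 th_) *: mu (p 0 t_) + sin (p 0 th_) *: nu (p 0 t_).
Definition lamF (p : 'rV[R]_2) : R :=
  \det (rows4 (Fd p) (derive Fd p e_t) (derive Fd p e_th) (evol (p 0 t_))).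
Definition PP t := AA t * NN t * Num.sqrt (AA t ^+ 2 - MM t ^+ 2).
Definition epsh t :=
  (PP t * derive1 KK t - derive1 PP t * KK t) /
    ((AA t * NN t) ^+ 2 * (AA t ^+ 2 - MM t ^+ 2) - (derive1 MM t * AA t - MM t * derive1 AA t) ^+ 2)
  - MM t * NN t / Num.sqrt (AA t ^+ 2 - MM t ^+ 2).
End Curve.
End Defs.

(* Main.v *)
Require Import Defs.
From HB Require Import structures.
From mathcomp Require Import all_boot all_order all_algebra.
From mathcomp Require Import all_classical all_reals all_analysis.
From mathcomp Require Import ring lra.
Import Order.TTheory GRing.Theory Num.Theory.
Import numFieldNormedType.Exports.
Local Open Scope classical_set_scope.
Local Open Scope ring_scope.

Set Implicit Arguments.
Unset Strict Implicit.
Unset Printing Implicit Defensive.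

(** Put [nu = (- M g + A n1) / D] and [D = sqrt (A^2 - M^2)], let [E] be the evolute and let [w] be the
    unit vector orthogonal to [mu], [nu] and [E].  Then [mu' = - D nu], [nu' = D mu + s w],
    [w' = - s nu + e E] and [E' = e w] with [D, s > 0] and [e] the invariant eps^h, and the dual surface
    is [F = cos theta mu + sin theta nu].  The kernel direction at [sin theta = 0] satisfies
    [d theta = D dt], and it is never tangent to the singular curve.

    Sufficiency.  Near a singular point choose coordinates [(X, V)] in which the first two components of
    [F] are [X] and [K0 X + V^2], up to sign.  By the theorem of Whitney on even functions (deduced from
    Borel's lemma), the remaining components are [k (X, V^2) + V^3 B (X, V^2)].  On the unit hyperquadric
    the odd part of [F] is, up to a unit, its odd part along [E], whose coefficient along the singular
    curve is [e] up to a nonzero factor.  If this coefficient is nonzero, or has a simple zero, dividing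
    by it or taking it as coordinate gives the two normal forms.

    Necessity.  If [F] is equivalent to [(u, v^2, c u v^3)] with [c u = 1] or [c u = u], comparing the
    terms of order three in [v] of [lor F (E (t u))] along the singular curve gives
    [c u * W u = K u * e (t u)] with [K] and [W] continuous and nonzero at [0].  At [u = 0] this decides
    whether [e] vanishes, and at first order in [u] whether its zero is simple. *)

(** Equivalence is between germs into R^4, with the model placed in the first three coordinates, and
    no recognition criterion is assumed, so both directions handle the diffeomorphisms themselves.
    For sufficiency the fourth target coordinate is [lor v v - 1]. It vanishes on the hyperquadric
    and leaves three components. Every later change in the target subtracts or divides by a function
    of X and V^2, and these are target coordinates; this is why the even and odd parts in V have to
    be smooth functions of V^2. For necessity the obstacle is that a diffeomorphism of R^4 need not
    respect the hyperquadric. The equation [lor F F = 1] takes over: compared order by order on the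
    curves u = const, together with the kernel direction, it shows that at the origin the first
    three partial derivatives of the inverse diffeomorphism are orthogonal to mu. The first two are
    also orthogonal to E, and invertibility then forces the third to see E. Leading terms are
    compared through factorisations with a continuous cofactor, so no Taylor formula of the frame is
    needed. *)

Section Diff.
Variables (R : realType) (V W : normedModType R).

Lemma differentiable_eps (f : V -> W) x : differentiable f x ->
  forall e, 0 < e -> \forall h \near (0 : V), `|f (h + x) - f x - 'd f x h| <= e * `|h|.
Proof.
move=> /diff_locallyP [_ /eqaddoP Hf] e e0.
have := Hf _ e0; apply: filterS => h /=.
by rewrite !fctE /= opprD addrA.
Qed.

(** Uniqueness of the first-order expansion makes the candidate [df] the differential, so a single
    estimate yields both differentiability and the value of ['d f x]. *)
Lemma is_diff_eps (f : V -> W) x (df : {linear V -> W}) : continuous df ->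
  (forall e, 0 < e -> \forall h \near (0 : V), `|f (h + x) - f x - df h| <= e * `|h|) ->
  is_diff x f df.
Proof.
move=> dfc H.
have E : f \o shift x = cst (f x) + df +o_ 0 id.
  apply/eqaddoP => e e0; have := H _ e0; apply: filterS => h /=.
  by rewrite !fctE /= opprD addrA.
have D := diff_unique dfc E.
by apply: DiffDef => //; apply/diff_locallyP; rewrite D.
Qed.

Lemma near_eq_differentiable (f g : V -> W) x :
  {near x, f =1 g} -> differentiable f x -> differentiable g x.
Proof.
move=> fg df.
suff : is_diff x g ('d f x) by move=> [].
apply: is_diff_eps; first exact: diff_continuous.
move=> e e0; have := differentiable_eps df e0.
have fgx : f x = g x by exact: nbhs_singleton fg.
have : \forall h \near (0 : V), f (h + x) = g (h + x).
  have := fg; rewrite (near_shift 0) /=; apply: filterS => h /=.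
  by rewrite subr0.
apply: filterS2 => h -> .
by rewrite fgx.
Qed.

End Diff.

(** * Smooth maps on open subsets of R^n *)

Section Smooth.
Variable R : realType.

Lemma differentiable_rV (V : normedModType R) m (f : V -> 'rV[R]_m) x :
  differentiable f x <-> forall j, differentiable (fun y => f y 0 j : R) x.
Proof.
split=> [df j|df].
  exact: (@differentiable_comp _ _ _ _ f (fun N : 'rV[R]_m => N 0 j : R) x df
            (differentiable_coord _ _ _)).
have -> : f = \sum_j (fun y => f y 0 j *: delta_mx 0 j).
  by apply/funext => y; rewrite fct_sumE -row_sum_delta.
apply: differentiable_sum => j; exact: differentiableZl.
Qed.

Lemma derive_rV (V : normedModType R) m (f : V -> 'rV[R]_m) x v j :
  differentiable f x -> ('D_v f x) 0 j = 'D_v (fun y => f y 0 j) x.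
Proof. by move=> df; rewrite derive_mx ?mxE//; exact: diff_derivable. Qed.

Section Ck.
Variables (n : nat) (W : normedModType R).
Implicit Types (U : set 'rV[R]_n) (f g : 'rV[R]_n -> W).

(** All iterated directional derivatives of order below [k] are differentiable on [U]. The innermost
    derivative is peeled off first, so that an induction on [k] can generalise over [f]. *)
Fixpoint Ck k U f : Prop :=
  if k is k'.+1 then
    (forall x, U x -> differentiable f x) /\
    (forall v, Ck k' U (fun x => 'D_v f x))
  else True.

Definition smooth U f := forall k, Ck k U f.

Lemma near_open U (P : 'rV[R]_n -> Prop) x : open U -> U x ->
  (forall y, U y -> P y) -> \forall y \near x, P y.
Proof. by move=> oU Ux H; have := open_nbhs_nbhs (conj oU Ux); apply: filterS. Qed.

(** Openness of [U] turns equality on [U] into equality near each point, which is what derivatives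
    see. Every derivative formula valid only on [U] is fed into the inductions through this
    lemma. *)
Lemma Ck_ext k U f g : open U -> (forall x, U x -> f x = g x) ->
  Ck k U f -> Ck k U g.
Proof.
move=> oU; elim: k f g => // k IH f g fg [df Df]; split.
  move=> x Ux; apply: near_eq_differentiable (df x Ux).
  exact: near_open fg.
move=> v; apply: IH (Df v) => x Ux; apply: near_eq_derive.
exact: near_open fg.
Qed.

Lemma smooth_ext U f g : open U -> (forall x, U x -> f x = g x) ->
  smooth U f -> smooth U g.
Proof. by move=> oU fg sf k; exact: Ck_ext (sf k). Qed.

Lemma CkW k U f : Ck k.+1 U f -> Ck k U f.
Proof.
elim: k f => // k IH f [df Df]; split => // v; exact: IH.
Qed.

Lemma Ck_sub k U U' f : U' `<=` U -> Ck k U f -> Ck k U' f.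
Proof.
move=> UU'; elim: k f => // k IH f [df Df]; split=> [x /UU'|v]; first exact: df.
exact: IH (Df v).
Qed.

Lemma smooth_sub U U' f : U' `<=` U -> smooth U f -> smooth U' f.
Proof. by move=> UU' sf k; exact: Ck_sub (sf k). Qed.

Lemma smooth_diff U f x : smooth U f -> U x -> differentiable f x.
Proof. by move=> /(_ 1%N) [] H _; exact: H. Qed.

Lemma smooth_derive U f v : smooth U f -> smooth U (fun x => 'D_v f x).
Proof. by move=> sf k; have [_ H] := sf k.+1; exact: H. Qed.

Lemma smooth_derivable U f x v : smooth U f -> U x -> derivable f x v.
Proof. by move=> sf Ux; apply: diff_derivable; exact: smooth_diff sf Ux. Qed.

Lemma smooth_continuous U f x : smooth U f -> U x -> {for x, continuous f}.
Proof. by move=> sf Ux; apply: differentiable_continuous; exact: smooth_diff sf Ux. Qed.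

Lemma Ck_cst k U (c : W) : Ck k U (fun=> c).
Proof.
elim: k c => // k IH c; split; first by move=> x _; exact: differentiable_cst.
by move=> v; have -> : (fun x => 'D_v (fun=> c) x) = fun=> (0 : W) by apply/funext => x; rewrite derive_cst.
Qed.

Lemma CkD k U f g : open U -> Ck k U f -> Ck k U g -> Ck k U (fun x => f x + g x).
Proof.
move=> oU; elim: k f g => // k IH f g [df Df] [dg Dg]; split.
  by move=> x Ux; apply: differentiableD; [exact: df|exact: dg].
move=> v; apply: Ck_ext (IH _ _ (Df v) (Dg v)) => // x Ux.
by rewrite deriveD //; apply: diff_derivable; [exact: df|exact: dg].
Qed.

Lemma CkN k U f : open U -> Ck k U f -> Ck k U (fun x => - f x).
Proof.
move=> oU; elim: k f => // k IH f [df Df]; split.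
  by move=> x Ux; apply: differentiableN; exact: df.
move=> v; apply: Ck_ext (IH _ (Df v)) => // x Ux.
by rewrite deriveN //; apply: diff_derivable; exact: df.
Qed.

End Ck.

Section CkR.
Variables (n : nat).
Implicit Types (U : set 'rV[R]_n) (f g : 'rV[R]_n -> R).

Lemma CkM k U f g : open U -> Ck k U f -> Ck k U g -> Ck k U (fun x => f x * g x).
Proof.
move=> oU; elim: k f g => // k IH f g Cf Cg.
have [df Df] := Cf; have [dg Dg] := Cg; split.
  by move=> x Ux; apply: differentiableM; [exact: df|exact: dg].
move=> v; have := CkD oU (IH _ _ (CkW Cf) (Dg v)) (IH _ _ (CkW Cg) (Df v)).
apply: Ck_ext => // x Ux.
by rewrite deriveM //; apply: diff_derivable; [exact: df|exact: dg].
Qed.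

Lemma Ck_sum k U m (F : 'I_m -> 'rV[R]_n -> R) : open U ->
  (forall i, Ck k U (F i)) -> Ck k U (fun x => \sum_i F i x).
Proof.
move=> oU; elim: m F => [|m IH] F CF.
  have -> : (fun x => \sum_i F i x) = fun=> 0 by apply/funext => x; rewrite big_ord0.
  exact: Ck_cst.
have -> : (fun x => \sum_i F i x) = fun x => F ord0 x + \sum_i F (lift ord0 i) x.
  by apply/funext => x; rewrite big_ord_recl.
by apply: CkD => //; apply: IH => i; exact: CF.
Qed.

Lemma Ck_coord k U j : Ck k U (fun x : 'rV[R]_n => x 0 j : R).
Proof.
case: k => // k; split=> [x _|v].
  exact: differentiable_coord.
have -> : (fun x => 'D_v (fun y : 'rV[R]_n => y 0 j : R) x) = fun=> v 0 j; last exact: Ck_cst.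
apply/funext => x; rewrite -(@derive_rV _ _ id) // ?derive_id //.
Qed.

End CkR.

Lemma Ck_rV n m k (U : set 'rV[R]_n) (f : 'rV[R]_n -> 'rV[R]_m) : open U ->
  Ck k U f <-> forall j, Ck k U (fun x => f x 0 j : R).
Proof.
move=> oU; split.
  elim: k f => // k IH f [df Df] j; split.
    by move=> x /df /differentiable_rV; exact.
  move=> v; have := IH _ (Df v) j; apply: Ck_ext => // x Ux.
  by rewrite derive_rV //; exact: df.
elim: k f => // k IH f H; have d x : U x -> differentiable f x.
  by move=> Ux; apply/differentiable_rV => j; have [+ _] := H j; exact.
split => // v; apply: IH => j; have [_ /(_ v)] := H j; apply: Ck_ext => // x Ux.
by rewrite derive_rV //; exact: d.
Qed.

Lemma derive_comp n m (W : normedModType R) (f : 'rV[R]_n -> 'rV[R]_m) (g : 'rV[R]_m -> W) x v :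
  differentiable f x -> differentiable g (f x) ->
  'D_v (g \o f) x = \sum_j 'D_v (fun y => f y 0 j) x *: 'D_(delta_mx 0 j) g (f x).
Proof.
move=> df dg; rewrite deriveE; last exact: differentiable_comp.
rewrite diff_comp //= -(deriveE v df) {1}(row_sum_delta ('D_v f x)).
rewrite linear_sum /=; apply: eq_bigr => j _.
by rewrite linearZ /= -deriveE // derive_rV.
Qed.

Lemma Ck_comp n m k (U : set 'rV[R]_n) (U' : set 'rV[R]_m)
    (f : 'rV[R]_n -> 'rV[R]_m) (g : 'rV[R]_m -> R) :
  open U -> (forall x, U x -> U' (f x)) ->
  Ck k U f -> Ck k U' g -> Ck k U (g \o f).
Proof.
move=> oU UU'; elim: k g => // k IH g Cf Cg.
have [df Df] := Cf; have [dg Dg] := Cg.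
split=> [x Ux|v]; first by apply: differentiable_comp; [exact: df|exact/dg/UU'].
apply: (@Ck_ext _ _ _ _ (fun x => \sum_j 'D_v (fun y => f y 0 j) x * 'D_(delta_mx 0 j) g (f x))) => //.
  by move=> x Ux; rewrite derive_comp //; [exact: df|exact/dg/UU'].
apply: Ck_sum => // j; apply: CkM => //.
  by have /(Ck_rV _ _ oU) /(_ j) [_ /(_ v)] := Cf.
by apply: (IH (fun y => 'D_(delta_mx 0 j) g y)); [exact: CkW|exact: Dg].
Qed.

(** [Dl] has the outermost derivative at the head of its list whereas [Ck] removes the innermost
    one; hence the induction from the right end of the list. *)
Lemma smooth_onP n m (U : set 'rV[R]_n) (f : 'rV[R]_n -> 'rV[R]_m) :
  smooth_on U f <-> smooth U f.
Proof.
have Dr (vs : seq 'rV[R]_n) v g : Dl (rcons vs v) g = Dl vs (fun x => 'D_v g x) :> ('rV[R]_n -> 'rV[R]_m).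
  by elim: vs => //= w vs ->.
split=> [sf k|sf vs].
  elim: k f sf => // k IH f sf; split=> [x|v]; first exact: (sf [::]).
  by apply: IH => vs x Ux; rewrite -Dr; exact: sf.
elim/last_ind: vs f sf => [|vs v IH] f sf x Ux; first exact: smooth_diff sf Ux.
by rewrite Dr; apply: IH => //; exact: smooth_derive.
Qed.

End Smooth.

Section SmoothOps.
Variable R : realType.

Section Real.
Variables (n : nat) (U : set 'rV[R]_n).
Hypothesis oU : open U.
Implicit Types (f g : 'rV[R]_n -> R).

Lemma smooth_cst (c : R) : smooth U (fun=> c).
Proof. by move=> k; exact: Ck_cst. Qed.

Lemma smooth_coord j : smooth U (fun x => x 0 j).
Proof. by move=> k; exact: Ck_coord. Qed.

Lemma smoothD f g : smooth U f -> smooth U g -> smooth U (fun x => f x + g x).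
Proof. by move=> sf sg k; exact: CkD. Qed.

Lemma smoothN f : smooth U f -> smooth U (fun x => - f x).
Proof. by move=> sf k; exact: CkN. Qed.

Lemma smoothB f g : smooth U f -> smooth U g -> smooth U (fun x => f x - g x).
Proof. by move=> sf sg; apply: smoothD => //; exact: smoothN. Qed.

Lemma smoothM f g : smooth U f -> smooth U g -> smooth U (fun x => f x * g x).
Proof. by move=> sf sg k; exact: CkM. Qed.

Lemma smoothX f m : smooth U f -> smooth U (fun x => f x ^+ m).
Proof.
move=> sf; elim: m => [|m IH]; first exact: smooth_cst.
by apply: (@smooth_ext _ _ _ _ (fun x => f x * f x ^+ m)) => [//|x _|]; [rewrite exprS|exact: smoothM].
Qed.

Lemma derive_comp1 (g : R -> R) f (x v : 'rV[R]_n) dg : differentiable f x ->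
  is_derive (f x) (1 : R) g dg -> 'D_v (fun y => g (f y)) x = dg * 'D_v f x.
Proof.
move=> df [dg1 dg2].
have dg' : differentiable g (f x) by apply/derivable1_diffP.
rewrite (deriveE _ (differentiable_comp df dg')) diff_comp //= deriv1E //.
by rewrite derive1E dg2 deriveE // mulrC.
Qed.

(** A smooth function of one variable is presented as a sequence [gd] of successive derivatives on
    [J]. This form fits sine, the flat exponential and the coordinates of a curve alike. *)
Lemma Ck_comp1 (J : set R) (gd : nat -> R -> R) f k i :
  (forall i y, J y -> is_derive y (1 : R) (gd i) (gd i.+1 y)) ->
  (forall x, U x -> J (f x)) ->
  Ck k U f -> Ck k U (fun x => gd i (f x)).
Proof.
move=> gdP UJ; elim: k i => // k IH i Cf; have [df Df] := Cf.
split=> [x Ux|v].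
  apply: (@differentiable_comp _ _ _ _ f (gd i)); first exact: df.
  by apply/derivable1_diffP; have [] := gdP i _ (UJ _ Ux).
apply: (@Ck_ext _ _ _ _ _ (fun x => gd i.+1 (f x) * 'D_v f x)) => //.
  by move=> x Ux; rewrite (derive_comp1 _ (df _ Ux) (gdP _ _ (UJ _ Ux))).
by apply: CkM => //; [apply: IH; exact: CkW|exact: Df].
Qed.

Lemma smooth_comp1 (J : set R) (gd : nat -> R -> R) f i :
  (forall i y, J y -> is_derive y (1 : R) (gd i) (gd i.+1 y)) ->
  (forall x, U x -> J (f x)) ->
  smooth U f -> smooth U (fun x => gd i (f x)).
Proof. by move=> gdP UJ sf k; exact: Ck_comp1 UJ (sf k). Qed.

Lemma smoothV f : (forall x, U x -> f x != 0) -> smooth U f ->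
  smooth U (fun x => (f x)^-1).
Proof.
move=> f0 sf; elim=> // k IH; split=> [x Ux|v].
  by apply: differentiableV; [exact: smooth_diff sf Ux|exact: f0].
apply: (@Ck_ext _ _ _ _ _ (fun x => - ((f x)^-1 * (f x)^-1) * 'D_v f x)) => //.
  move=> x Ux; rewrite (@deriveV _ _ f); [|exact: f0|exact: smooth_derivable sf Ux].
  by rewrite expr2 invfM.
by apply: CkM => //; [apply: CkN => //; exact: CkM|exact: smooth_derive].
Qed.

Lemma smooth_div f g : (forall x, U x -> g x != 0) -> smooth U f -> smooth U g ->
  smooth U (fun x => f x / g x).
Proof. by move=> g0 sf sg; apply: smoothM => //; exact: smoothV. Qed.

Lemma smooth_sqrt f : (forall x, U x -> 0 < f x) -> smooth U f ->
  smooth U (fun x => Num.sqrt (f x)).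
Proof.
move=> f0 sf; elim=> // k IH.
have d x : U x -> is_derive (f x) (1 : R) Num.sqrt (2 * Num.sqrt (f x))^-1.
  by move=> Ux; apply: is_derive1_sqrt; exact: f0.
split=> [x Ux|v].
  apply: (@differentiable_comp _ _ _ _ f Num.sqrt); first exact: smooth_diff sf Ux.
  by apply/derivable1_diffP; have [] := d _ Ux.
(* The derivative 1/(2 sqrt f) is written with [Num.sqrt (f x)] in the numerator, so that the
   induction hypothesis applies to it. *)
apply: (@Ck_ext _ _ _ _ _ (fun x => (2^-1 * ((f x)^-1 * Num.sqrt (f x))) * 'D_v f x)) => //.
  move=> x Ux; rewrite (derive_comp1 _ (smooth_diff sf Ux) (d _ Ux)); congr (_ * _).
  rewrite invfM; congr (_ * _).
  have s0 : Num.sqrt (f x) != 0 by rewrite gt_eqF // sqrtr_gt0 f0.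
  by rewrite -{1}(sqr_sqrtr (ltW (f0 _ Ux))) expr2 invfM mulfVK.
apply: CkM => //; last exact: smooth_derive.
by apply: CkM => //; [exact: Ck_cst|apply: CkM => //; apply: smoothV => // x Ux; rewrite gt_eqF ?f0].
Qed.

Lemma smooth_sin_cos f : smooth U f ->
  smooth U (fun x => sin (f x)) /\ smooth U (fun x => cos (f x)).
Proof.
move=> sf.
(* Iterating (p, q) -> (q, -p) on (sin, cos) runs through the derivatives of sine; index 1 is
   cosine. *)
pose gd i : R -> R := (iter i (fun p : (R -> R) * (R -> R) => (p.2, \- p.1)) (@sin R, @cos R)).1.
suff H : forall i y, setT y -> is_derive y (1 : R) (gd i) (gd i.+1 y).
  by split; [apply: (@smooth_comp1 _ gd f 0%N H)|apply: (@smooth_comp1 _ gd f 1%N H)].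
pose gp i := iter i (fun p : (R -> R) * (R -> R) => (p.2, \- p.1)) (@sin R, @cos R).
suff H i : (forall y, is_derive y (1 : R) (gp i).1 ((gp i).2 y)) /\
           (forall y, is_derive y (1 : R) (gp i).2 (- (gp i).1 y)).
  by move=> i y _; have [+ _] := H i; exact.
elim: i => [|i [IH1 IH2]]; first by split => y /=; [exact: is_derive_sin|exact: is_derive_cos].
split=> y /=; first exact: IH2.
by apply: is_deriveN; exact: IH1.
Qed.

Lemma smooth_sin f : smooth U f -> smooth U (fun x => sin (f x)).
Proof. by move=> /smooth_sin_cos[]. Qed.

Lemma smooth_cos f : smooth U f -> smooth U (fun x => cos (f x)).
Proof. by move=> /smooth_sin_cos[]. Qed.

End Real.

Lemma smooth_rV n m (U : set 'rV[R]_n) (f : 'rV[R]_n -> 'rV[R]_m) : open U ->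
  smooth U f <-> forall j, smooth U (fun x => f x 0 j : R).
Proof.
move=> oU; split=> [sf j k|sf k]; first by have /(Ck_rV _ _ oU) := sf k; exact.
by apply/(Ck_rV _ _ oU) => j; exact: sf.
Qed.

Lemma smooth_comp n m (U : set 'rV[R]_n) (U' : set 'rV[R]_m)
    (f : 'rV[R]_n -> 'rV[R]_m) (g : 'rV[R]_m -> R) :
  open U -> (forall x, U x -> U' (f x)) ->
  smooth U f -> smooth U' g -> smooth U (fun x => g (f x)).
Proof. by move=> oU UU' sf sg k; exact: (Ck_comp oU UU' (sf k) (sg k)). Qed.

Lemma smooth_comp_rV n m p (U : set 'rV[R]_n) (U' : set 'rV[R]_m)
    (f : 'rV[R]_n -> 'rV[R]_m) (g : 'rV[R]_m -> 'rV[R]_p) :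
  open U -> open U' -> (forall x, U x -> U' (f x)) ->
  smooth U f -> smooth U' g -> smooth U (fun x => g (f x)).
Proof.
move=> oU oU' UU' sf sg; apply/smooth_rV => // j.
by apply: (smooth_comp oU UU' sf (g := fun y => g y 0 j)); move/smooth_rV : sg; exact.
Qed.

End SmoothOps.

(** * Functions of two variables *)

Section Plane.
Variable R : realType.
Implicit Types (f g : 'rV[R]_2 -> R) (p q : 'rV[R]_2).

Definition pt (x y : R) : 'rV[R]_2 := \row_j (if j == t_ then x else y).

Lemma pt_t x y : pt x y 0 t_ = x. Proof. by rewrite mxE eqxx. Qed.
Lemma pt_th x y : pt x y 0 th_ = y. Proof. by rewrite mxE. Qed.
Lemma ord2P (P : 'I_2 -> Prop) : P t_ -> P th_ -> forall i, P i.
Proof.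
move=> P0 P1 [[|[|i]] Hi] //.
  by have -> : Ordinal Hi = t_ by apply: val_inj.
by have -> : Ordinal Hi = th_ by apply: val_inj.
Qed.
Lemma ptK p : pt (p 0 t_) (p 0 th_) = p.
Proof. by apply/rowP; apply: ord2P; rewrite ?pt_t ?pt_th. Qed.
Lemma eq_pt p q : p 0 t_ = q 0 t_ -> p 0 th_ = q 0 th_ -> p = q.
Proof. by move=> h1 h2; apply/rowP; apply: ord2P. Qed.
Lemma e_t_t : e_t R 0 t_ = 1. Proof. by rewrite mxE. Qed.
Lemma e_t_th : e_t R 0 th_ = 0. Proof. by rewrite mxE. Qed.
Lemma e_th_t : e_th R 0 t_ = 0. Proof. by rewrite mxE. Qed.
Lemma e_th_th : e_th R 0 th_ = 1. Proof. by rewrite mxE. Qed.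

Lemma ballP p q d : ball p d q <->
  `|q 0 t_ - p 0 t_| < d /\ `|q 0 th_ - p 0 th_| < d.
Proof.
split=> [[d0 H]|[h1 h2]].
  by split; rewrite distrC; exact: H.
split=> [|i]; first exact: le_lt_trans h1.
by rewrite (ord1 i); apply: ord2P; rewrite /ball /= distrC.
Qed.

Lemma near_ballP p (P : 'rV[R]_2 -> Prop) :
  (\forall q \near p, P q) <-> exists2 d, 0 < d & forall q, ball p d q -> P q.
Proof. by split=> [/nbhs_ballP [d d0 H]|[d d0 H]]; [exists d|apply/nbhs_ballP; exists d]. Qed.

Lemma norm_rV2 p : `|p| = Num.max `|p 0 t_| `|p 0 th_|.
Proof.
apply/eqP; rewrite eq_le; apply/andP; split; last first.
  rewrite /Num.Def.normr /= mx_normrE.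
  by rewrite ge_max; apply/andP; split; [exact: (le_bigmax _ _ (0, t_))|exact: (le_bigmax _ _ (0, th_))].
rewrite {1}/Num.Def.normr /= mx_normrE; apply: bigmax_le => [|[i j] _ /=].
  by rewrite le_max normr_ge0.
rewrite (ord1 i); move: j; apply: ord2P; by rewrite le_max lexx ?orbT.
Qed.

Lemma ler_norm_t p : `|p 0 t_| <= `|p|.
Proof. by rewrite norm_rV2 le_max lexx. Qed.
Lemma ler_norm_th p : `|p 0 th_| <= `|p|.
Proof. by rewrite norm_rV2 le_max lexx orbT. Qed.

Lemma pt_shift_t x y h : h *: e_t R + pt x y = pt (h + x) y.
Proof. by apply: eq_pt; rewrite 2!mxE ?pt_t ?pt_th ?e_t_t ?e_t_th; ring. Qed.
Lemma pt_shift_th x y h : h *: e_th R + pt x y = pt x (h + y).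
Proof. by apply: eq_pt; rewrite 2!mxE ?pt_t ?pt_th ?e_th_t ?e_th_th; ring. Qed.

Lemma is_derive_tP (W : normedModType R) (f : 'rV[R]_2 -> W) x y a :
  is_derive (pt x y) (e_t R) f a <-> is_derive x (1 : R) (fun x => f (pt x y)) a.
Proof.
have E : (fun h : R => h^-1 *: ((f \o shift (pt x y)) (h *: e_t R) - f (pt x y))) =
   (fun h : R => h^-1 *: (((fun x => f (pt x y)) \o shift x) (h *: (1 : R)) - f (pt x y))).
  by apply/funext => h /=; rewrite pt_shift_t [_ *: 1]mulr1.
by split=> -[H1 H2]; split; move: H1 H2; rewrite /derivable /derive E.
Qed.

Lemma is_derive_thP (W : normedModType R) (f : 'rV[R]_2 -> W) x y a :
  is_derive (pt x y) (e_th R) f a <-> is_derive y (1 : R) (fun y => f (pt x y)) a.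
Proof.
have E : (fun h : R => h^-1 *: ((f \o shift (pt x y)) (h *: e_th R) - f (pt x y))) =
   (fun h : R => h^-1 *: (((fun y => f (pt x y)) \o shift y) (h *: (1 : R)) - f (pt x y))).
  by apply/funext => h /=; rewrite pt_shift_th [_ *: 1]mulr1.
by split=> -[H1 H2]; split; move: H1 H2; rewrite /derivable /derive E.
Qed.

(** No order between [a] and [b] is imposed, since increments of both signs occur. The bound on
    [|c - a|] is what converts a bound on the derivative into a power of the increment. *)
Lemma MVT_interval (J : set R) (u du : R -> R) a b : is_interval J ->
  (forall x, J x -> is_derive x (1 : R) u (du x)) -> J a -> J b ->
  exists c, [/\ J c, `|c - a| <= `|b - a| & u b - u a = du c * (b - a)].
Proof.
move=> iJ H.
have cont x : J x -> {for x, continuous u}.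
  by move=> /H [d _]; apply: differentiable_continuous; exact/derivable1_diffP.
have main a' b' : a' <= b' -> J a' -> J b' ->
    exists c, [/\ J c, a' <= c <= b' & u b' - u a' = du c * (b' - a')].
  move=> ab Ja Jb.
  have sub x : x \in `[a', b'] -> J x by rewrite in_itv /=; exact: iJ Ja Jb _.
  have [||c cab E] := @MVT_segment R u du a' b' ab.
  - by move=> x xab; apply: H; apply: sub; move: xab; rewrite !in_itv /= => /andP[/ltW -> /ltW ->].
  - by apply: continuous_in_subspaceT => x; rewrite inE /= => xab; apply: cont; exact: sub.
  by exists c; split => //; exact: sub.
move=> Ja Jb; have [ab|/ltW ba] := leP a b.
  have [c [Jc /andP[ac cb] E]] := main _ _ ab Ja Jb; exists c; split => //.
  by rewrite !ger0_norm ?subr_ge0 // lerD2r.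
have [c [Jc /andP[bc ca] E]] := main _ _ ba Jb Ja; exists c; split => //.
  by rewrite !ler0_norm ?subr_le0 // !opprB lerD2l lerN2.
by rewrite -[LHS]opprB E -mulrN opprB.
Qed.

Lemma is_interval_dist (m d : R) : is_interval [set x | `|x - m| < d].
Proof.
move=> x y /=; rewrite !ltr_norml => /andP[h1 h2] /andP[h3 h4] z /andP[h5 h6]; rewrite ltr_norml.
by apply/andP; split; lra.
Qed.

(** The increment is split into a vertical and a horizontal one and the mean value theorem is
    applied to each. In the sup norm a ball is a square, so both segments stay inside. Continuity of
    the partial derivatives at [p] alone controls the error. *)
Lemma C1_differentiable f fx fy p :
  (\forall q \near p, is_derive q (e_t R) f (fx q) /\ is_derive q (e_th R) f (fy q)) ->
  {for p, continuous fx} -> {for p, continuous fy} ->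
  differentiable f p /\ forall v, 'D_v f p = v 0 t_ * fx p + v 0 th_ * fy p.
Proof.
move=> /near_ballP [d d0 H] cx cy.
pose L (h : 'rV[R]_2) : R := h 0 t_ * fx p + h 0 th_ * fy p.
have linL : linear L by move=> k u v; rewrite /L !mxE /GRing.scale /=; ring.
pose LM := GRing.isLinear.Build _ _ _ _ _ linL.
pose LL : {linear 'rV[R]_2 -> R} := HB.pack L LM.
have cL : continuous L.
  move=> z; apply: differentiable_continuous.
  by apply: differentiableD; apply: differentiableM => //; exact: differentiable_coord.
suff [df dE] : is_diff p f LL by split => // v; rewrite deriveE // dE.
apply: is_diff_eps => // e e0; rewrite /LL /= /L.
have e20 : 0 < e / 2 by rewrite divr_gt0.
have /near_ballP[d1 d10 H1] : \forall q \near p, `|fx q - fx p| < e / 2.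
  by have /cvgrPdist_lt /(_ _ e20) := cx; apply: filterS => q; rewrite distrC.
have /near_ballP[d2 d20 H2] : \forall q \near p, `|fy q - fy p| < e / 2.
  by have /cvgrPdist_lt /(_ _ e20) := cy; apply: filterS => q; rewrite distrC.
pose m := Num.min d (Num.min d1 d2).
have m0 : 0 < m by rewrite !lt_min d0 d10.
apply/near_ballP; exists m => // h /ballP; rewrite !mxE !subr0 => -[ha hb].
set a := h 0 t_; set b := h 0 th_; rewrite -/a -/b in ha hb.
set x := p 0 t_; set y := p 0 th_.
have Ep : p = pt x y by rewrite ptK.
have Eh : h + p = pt (x + a) (y + b) by apply: eq_pt; rewrite mxE ?pt_t ?pt_th addrC.
have inb x' y' : `|x' - x| < m -> `|y' - y| < m ->
   [/\ ball p d (pt x' y'), ball p d1 (pt x' y') & ball p d2 (pt x' y')].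
  by rewrite !lt_min => /and3P[? ? ?] /and3P[? ? ?]; split; apply/ballP; rewrite pt_t pt_th.
have [||||c1 [Jc1 _ E1]] := @MVT_interval [set z | `|z - x| < m] (fun z => f (pt z (y + b)))
     (fun z => fx (pt z (y + b))) x (x + a).
- exact: is_interval_dist.
- move=> z /= zx; apply/is_derive_tP.
  have [|B _ _] := @inb z (y + b) zx; first by rewrite addrC addKr.
  by have [] := H _ B.
- by rewrite /= subrr normr0.
- by rewrite /= addrC addKr.
have [||||c2 [Jc2 _ E2]] := @MVT_interval [set z | `|z - y| < m] (fun z => f (pt x z))
     (fun z => fy (pt x z)) y (y + b).
- exact: is_interval_dist.
- move=> z /= zy; apply/is_derive_thP.
  have [|B _ _] := @inb x z _ zy; first by rewrite subrr normr0.
  by have [] := H _ B.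
- by rewrite /= subrr normr0.
- by rewrite /= addrC addKr.
have B1 : `|fx (pt c1 (y + b)) - fx p| < e / 2.
  by apply: H1; have [|//] := @inb c1 (y + b) Jc1; rewrite addrC addKr.
have B2 : `|fy (pt x c2) - fy p| < e / 2.
  by apply: H2; have [|//] := @inb x c2 _ Jc2; rewrite subrr normr0.
rewrite Eh {1}Ep.
have -> : f (pt (x + a) (y + b)) - f (pt x y) - (a * fx p + b * fy p) =
   a * (fx (pt c1 (y + b)) - fx p) + b * (fy (pt x c2) - fy p).
  have -> : f (pt (x + a) (y + b)) - f (pt x y) =
    (f (pt (x + a) (y + b)) - f (pt x (y + b))) + (f (pt x (y + b)) - f (pt x y)) by ring.
  rewrite E1 E2; ring.
apply: (le_trans (ler_normD _ _)); rewrite !normrM.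
have La : `|a| <= `|h| := ler_norm_t h.
have Lb : `|b| <= `|h| := ler_norm_th h.
have K1 : `|a| * `|fx (pt c1 (y + b)) - fx p| <= `|h| * (e / 2).
  by apply: ler_pM => //; exact: ltW.
have K2 : `|b| * `|fy (pt x c2) - fy p| <= `|h| * (e / 2).
  by apply: ler_pM => //; exact: ltW.
by rewrite [e * _]mulrC [e in leRHS](splitr e) mulrDr lerD.
Qed.

(** Locally bounded partial derivatives give continuity by the mean value theorem, and continuous
    ones give differentiability. A class of locally bounded functions stable under partial
    derivatives therefore bootstraps to smoothness; this serves for the Borel series and for
    quotients of flat functions. *)
Lemma class_smooth (U : set 'rV[R]_2) (C : ('rV[R]_2 -> R) -> Prop) : open U ->
  (forall f, C f -> forall p, U p -> exists K, \forall q \near p, `|f q| <= K) ->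
  (forall f, C f -> exists fx fy, [/\ C fx, C fy &
     forall p, U p -> is_derive p (e_t R) f (fx p) /\ is_derive p (e_th R) f (fy p)]) ->
  forall f, C f -> smooth U f.
Proof.
move=> oU bC dC.
have cC f : C f -> forall p, U p -> {for p, continuous f}.
  move=> Cf p Up; have [fx [fy [Cfx Cfy D]]] := dC _ Cf.
  have [K1 B1] := bC _ Cfx _ Up; have [K2 B2] := bC _ Cfy _ Up.
  have : \forall q \near p, U q /\ (`|fx q| <= K1 /\ `|fy q| <= K2).
    have U' : \forall q \near p, U q by exact: near_open Up _.
    by apply: (@filterS3 _ (nbhs p) (nbhs_filter p) _ _ _ _ _ U' B1 B2) => q.
  move=> /near_ballP[d d0 H].
  apply/(@cvgrPdist_le _ _ _ (nbhs p) (nbhs_filter p)) => e e0.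
  pose K := 1 + `|K1| + `|K2|.
  have K0 : 0 < K by rewrite /K -addrA ltr_pwDl // addr_ge0.
  pose m := Num.min d (e / K / 2).
  have m0 : 0 < m by rewrite lt_min d0 !divr_gt0.
  apply/near_ballP; exists m => // q /ballP.
  set x := p 0 t_; set y := p 0 th_; set x' := q 0 t_; set y' := q 0 th_ => -[hx hy].
  have inb a b : `|a - x| < m -> `|b - y| < m -> ball p d (pt a b).
    by rewrite !lt_min => /andP[? ?] /andP[? ?]; apply/ballP; rewrite pt_t pt_th.
  have [||||c1 [Jc1 _ E1]] := @MVT_interval [set z | `|z - x| < m] (fun z => f (pt z y'))
     (fun z => fx (pt z y')) x x'.
  - exact: is_interval_dist.
  - move=> z /= zx; apply/is_derive_tP.
    by have [/D []] := H _ (inb _ _ zx hy).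
  - by rewrite /= subrr normr0.
  - by [].
  have [||||c2 [Jc2 _ E2]] := @MVT_interval [set z | `|z - y| < m] (fun z => f (pt x z))
     (fun z => fy (pt x z)) y y'.
  - exact: is_interval_dist.
  - move=> z /= zy; apply/is_derive_thP.
    have xx : `|x - x| < m by rewrite subrr normr0.
    by have [/D []] := H _ (inb _ _ xx zy).
  - by rewrite /= subrr normr0.
  - by [].
  have [_ [b1 _]] := H _ (inb _ _ Jc1 hy).
  have xx : `|x - x| < m by rewrite subrr normr0.
  have [_ [_ b2]] := H _ (inb _ _ xx Jc2).
  rewrite distrC -[q]ptK -[p]ptK -/x -/y -/x' -/y'.
  have -> : f (pt x' y') - f (pt x y) =
    (f (pt x' y') - f (pt x y')) + (f (pt x y') - f (pt x y)) by ring.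
  rewrite E1 E2; apply: (le_trans (ler_normD _ _)); rewrite !normrM.
  have k1 : `|fx (pt c1 y')| <= K.
    by apply: (le_trans b1); rewrite (le_trans (ler_norm _)) // /K -addrA addrCA lerDl addr_ge0.
  have k2 : `|fy (pt x c2)| <= K.
    by apply: (le_trans b2); rewrite (le_trans (ler_norm _)) // /K lerDr addr_ge0.
  have half a : `|a| < m -> `|a| <= e / K / 2 by rewrite lt_min => /andP[_ /ltW].
  have -> : e = K * (e / K / 2) + K * (e / K / 2) by field; rewrite gt_eqF.
  by apply: lerD; apply: ler_pM => //; exact: half.
have main k : forall f, C f -> Ck k U f.
  elim: k => // k IH f Cf; have [fx [fy [Cfx Cfy D]]] := dC _ Cf.
  have C1 p : U p -> differentiable f p /\ forall v, 'D_v f p = v 0 t_ * fx p + v 0 th_ * fy p.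
    move=> Up; apply: C1_differentiable; [|exact: cC|exact: cC].
    exact: near_open Up D.
  split=> [p /C1 []//|v].
  apply: (@Ck_ext _ _ _ _ _ (fun p => v 0 t_ * fx p + v 0 th_ * fy p)) => //.
    by move=> p /C1 [_ ->].
  by apply: CkD => //; apply: CkM => //; [exact: Ck_cst|exact: IH|exact: Ck_cst|exact: IH].
by move=> f Cf k; exact: main.
Qed.

End Plane.

(** * The implicit function theorem in the plane *)

Section Implicit.
Variable R : realType.
Implicit Types (f : 'rV[R]_2 -> R) (p q r : 'rV[R]_2).

Lemma smooth_pt n (U : set 'rV[R]_n) (a b : 'rV[R]_n -> R) : open U ->
  smooth U a -> smooth U b -> smooth U (fun x => pt (a x) (b x)).
Proof.
move=> oU sa sb; apply/smooth_rV => //; apply: ord2P.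
  by apply: smooth_ext sa => // x _; rewrite pt_t.
by apply: smooth_ext sb => // x _; rewrite pt_th.
Qed.

Lemma derive_lin2 f p v : differentiable f p ->
  'D_v f p = v 0 t_ * 'D_(e_t R) f p + v 0 th_ * 'D_(e_th R) f p.
Proof.
move=> df; rewrite !deriveE //.
have {1}-> : v = v 0 t_ *: e_t R + v 0 th_ *: e_th R.
  by apply: eq_pt; rewrite !mxE /=; ring.
by rewrite linearD !linearZ.
Qed.

(** Differentiability of [f] along the graph bounds the increment [dx] of [k] by a multiple of
    [|h|]; inserting this bound in the same expansion makes the remainder small compared with
    [|h|]. *)
Lemma implicit_differentiable f (k : 'rV[R]_2 -> R) (B : set 'rV[R]_2) r :
  open B -> B r -> let K q := pt (k q) (q 0 th_) in
  {for r, continuous k} -> (forall q, B q -> f (K q) = q 0 t_) ->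
  differentiable f (K r) -> 0 < 'D_(e_t R) f (K r) ->
  differentiable k r /\ forall v,
    'D_v k r = (v 0 t_ - 'D_(e_th R) f (K r) * v 0 th_) / 'D_(e_t R) f (K r).
Proof.
move=> oB Br K ck fK df m0.
set m := 'D_(e_t R) f (K r) in m0 *; set l := 'D_(e_th R) f (K r).
pose L (h : 'rV[R]_2) : R := (h 0 t_ - l * h 0 th_) / m.
have linL : linear L.
  by move=> c u v; rewrite /L !mxE /GRing.scale /=; field; rewrite gt_eqF.
pose LM := GRing.isLinear.Build _ _ _ _ _ linL.
pose LL : {linear 'rV[R]_2 -> R} := HB.pack L LM.
have cL : continuous L.
  move=> z; apply: differentiable_continuous.
  apply: differentiableM => //; apply: differentiableB; first exact: differentiable_coord.
  by apply: differentiableM => //; exact: differentiable_coord.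
suff [dk dE] : is_diff r k LL by split => // v; rewrite deriveE // dE.
apply: is_diff_eps => // e e0; rewrite /LL /= /L.
pose C := 2 / m * (1 + `|l| + m).
have C0 : 0 < C by rewrite /C mulr_gt0 ?divr_gt0 // ltr_wpDl // addr_ge0.
(* The first entry lets the term in [|dx|] be absorbed on the left, giving [|dx| <= C * |h|]; the
   second makes the remainder, then at most [eps * (C + 1) * |h|], fit under [e * m * |h|]. *)
pose eps := Num.min (m / 2) (e * m / (C + 1)).
have C10 : 0 < C + 1 by rewrite addr_gt0.
have eps0 : 0 < eps by rewrite lt_min !divr_gt0 // mulr_gt0.
have eps1 : eps <= m / 2 by rewrite ge_min lexx.
have eps2 : eps * (C + 1) <= e * m by rewrite -ler_pdivlMr // ge_min lexx orbT.
have /near_ballP[d d0 Hd] := differentiable_eps df eps0.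
have /near_ballP[d1 d10 Hd1] : \forall q \near r, B q by exact: near_open Br _.
have /near_ballP[d2 d20 Hd2] : \forall q \near r, `|k r - k q| < d.
  by have /cvgrPdist_lt /(_ _ d0) := ck.
pose s := Num.min d (Num.min d1 d2).
have s0 : 0 < s by rewrite !lt_min d0 d10.
apply/near_ballP; exists s => // h /ballP; rewrite !mxE !subr0.
rewrite !lt_min => -[/and3P[ha ha1 ha2] /and3P[hb hb1 hb2]].
have Bh : B (h + r) by apply: Hd1; apply/ballP; rewrite !mxE !addrK.
have kh : `|k (h + r) - k r| < d.
  by rewrite distrC; apply: Hd2; apply/ballP; rewrite !mxE !addrK.
set dx := k (h + r) - k r in kh *.
pose D := pt dx (h 0 th_).
have KD : D + K r = K (h + r).
  by apply: eq_pt; rewrite mxE ?pt_t ?pt_th ?mxE // /dx subrK.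
have /Hd : ball (0 : 'rV[R]_2) d D by apply/ballP; rewrite !mxE /= !subr0.
rewrite KD !fK // mxE addrK -deriveE // derive_lin2 // -/m -/l pt_t pt_th => Hf.
have nD : `|D| <= `|dx| + `|h|.
  rewrite norm_rV2 pt_t pt_th ge_max lerDl normr_ge0 /=.
  by rewrite (le_trans (ler_norm_th h)) // lerDr.
have Hf' : `|h 0 t_ - (dx * m + h 0 th_ * l)| <= eps * (`|dx| + `|h|).
  by apply: (le_trans Hf); rewrite ler_pM2l.
have bt := ler_norm_t h; have bth := ler_norm_th h.
have Cdx : `|dx| <= C * `|h|.
  have h1 : `|dx| * m <= eps * (`|dx| + `|h|) + (`|h| + `|h| * `|l|).
    have -> : `|dx| * m = `|dx * m| by rewrite normrM (gtr0_norm m0).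
    have -> : dx * m = - (h 0 t_ - (dx * m + h 0 th_ * l)) + (h 0 t_ - h 0 th_ * l) by ring.
    apply: (le_trans (ler_normD _ _)); rewrite normrN; apply: lerD => //.
    apply: (le_trans (ler_normB _ _)); apply: lerD => //.
    by rewrite normrM ler_pM.
  have h2 : eps * (`|dx| + `|h|) <= m / 2 * (`|dx| + `|h|).
    by rewrite ler_wpM2r // addr_ge0.
  have h3 : `|dx| * m <= (m / 2) * `|dx| + (1 + `|l| + m) * `|h|.
    have := normr_ge0 h; have := normr_ge0 dx; nra.
  rewrite /C -mulrA mulrAC ler_pdivlMr //; lra.
have -> : dx - (h 0 t_ - l * h 0 th_) / m = - (h 0 t_ - (dx * m + h 0 th_ * l)) / m.
  by field; rewrite gt_eqF.
rewrite normrM normrN normfV (gtr0_norm m0) ler_pdivrMr //.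
apply: (le_trans Hf').
have : eps * (`|dx| + `|h|) <= eps * (C + 1) * `|h|.
  by rewrite -mulrA ler_pM2l // mulrDl mul1r lerD2r.
have g1 := ler_wpM2r (normr_ge0 h) eps2; clear -g1; lra.
Qed.

(** The conclusion describes the local inverse of q -> (f q, q_th). For such a triangular change of
    coordinates the argument is one-dimensional: [f] is strictly increasing in the first coordinate
    and the intermediate value theorem solves the equation on each horizontal line. *)
Lemma implicit_pos (U : set 'rV[R]_2) f p : open U -> smooth U f -> U p ->
  0 < 'D_(e_t R) f p ->
  exists (A B : set 'rV[R]_2) (k : 'rV[R]_2 -> R),
   [/\ [/\ open A, open B, A `<=` U & smooth B k],
       A p,
       (forall q, A q -> B (pt (f q) (q 0 th_)) /\ k (pt (f q) (q 0 th_)) = q 0 t_) &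
       (forall r, B r -> A (pt (k r) (r 0 th_)) /\ f (pt (k r) (r 0 th_)) = r 0 t_)].
Proof.
move=> oU sf Up a0; set a := 'D_(e_t R) f p in a0.
set x0 := p 0 t_; set y0 := p 0 th_.
have a20 : 0 < a / 2 by rewrite divr_gt0.
have [d d0 Hd] : exists2 d, 0 < d & forall q, ball p d q -> U q /\ a / 2 < 'D_(e_t R) f q.
  apply/near_ballP.
  have c1 := smooth_continuous (smooth_derive (e_t R) sf) Up.
  have U' : \forall q \near p, U q by exact: near_open Up _.
  have /cvgrPdist_lt /(_ _ a20) := c1.
  move: U'; apply: filterS2 => q Uq; rewrite ltr_norml => /andP[_ h]; split => //.
  by rewrite -/a in h; lra.
have inb x y : `|x - x0| < d -> `|y - y0| < d -> ball p d (pt x y).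
  by move=> ? ?; apply/ballP; rewrite pt_t pt_th.
have mono x x' y : `|y - y0| < d -> `|x - x0| < d -> `|x' - x0| < d -> x <= x' ->
    a / 2 * (x' - x) <= f (pt x' y) - f (pt x y).
  move=> hy hx hx' xx'.
  have [|||//|c [Jc _ ->]] := @MVT_interval _ [set z | `|z - x0| < d] (fun z => f (pt z y))
     (fun z => 'D_(e_t R) f (pt z y)) x x'.
  - exact: is_interval_dist.
  - move=> z /= zx; apply/is_derive_tP; apply: derivableP.
    by have [Uz _] := Hd _ (inb _ _ zx hy); exact: smooth_derivable sf Uz.
  - by [].
  have [_ h] := Hd _ (inb _ _ Jc hy).
  by rewrite ler_wpM2r ?subr_ge0 // ltW.
have fcont x y : `|x - x0| < d -> `|y - y0| < d -> {for pt x y, continuous f}.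
  by move=> hx hy; have [Uz _] := Hd _ (inb _ _ hx hy); exact: smooth_continuous sf Uz.
pose dl := d / 2.
have dl0 : 0 < dl by rewrite divr_gt0.
have dld : dl < d by rewrite /dl; lra.
(* With slope at least [a / 2], the values of [f] at [(x0 + dl, y0)] and [(x0 - dl, y0)] differ from
   [f p] by at least [a * dl / 2]. Half of this is kept as a margin when [y] moves away from
   [y0]. *)
pose eta := a * dl / 4.
have eta0 : 0 < eta by rewrite divr_gt0 // mulr_gt0.
have yy : `|y0 - y0| < d by rewrite subrr normr0.
have xx : `|x0 - x0| < d by rewrite subrr normr0.
have xp : `|x0 + dl - x0| < d by rewrite addrC addKr gtr0_norm.
have xm : `|x0 - dl - x0| < d by rewrite addrC addKr normrN gtr0_norm.
have Ep : pt x0 y0 = p by rewrite ptK.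
have [d' [d'0 d'd Hp Hm]] : exists d', [/\ 0 < d', d' <= d,
   (forall y, `|y - y0| < d' -> f p + eta < f (pt (x0 + dl) y)) &
   (forall y, `|y - y0| < d' -> f (pt (x0 - dl) y) < f p - eta)].
  have P1 : f p + eta < f (pt (x0 + dl) y0).
    have := @mono x0 (x0 + dl) y0 yy xx xp; rewrite lerDl (ltW dl0) => /(_ isT).
    rewrite Ep /eta addrC addKr; nra.
  have M1 : f (pt (x0 - dl) y0) < f p - eta.
    have := @mono (x0 - dl) x0 y0 yy xm xx; rewrite gerBl (ltW dl0) => /(_ isT).
    rewrite Ep /eta opprB addrC subrK; nra.
  have /cvgrPdist_lt /(_ (f (pt (x0 + dl) y0) - (f p + eta))) := fcont _ _ xp yy.
  rewrite subr_gt0 => /(_ P1) /near_ballP[d1 d10 H1].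
  have /cvgrPdist_lt /(_ (f p - eta - f (pt (x0 - dl) y0))) := fcont _ _ xm yy.
  rewrite subr_gt0 => /(_ M1) /near_ballP[d2 d20 H2].
  exists (Num.min d (Num.min d1 d2)); split.
  - by rewrite !lt_min d0 d10.
  - by rewrite ge_min lexx.
  - move=> y; rewrite !lt_min => /and3P[_ h1 _].
    have := H1 (pt (x0 + dl) y); rewrite ballP !pt_t !pt_th subrr normr0.
    by move=> /(_ (conj d10 h1)); rewrite ltr_norml => /andP[_]; lra.
  - move=> y; rewrite !lt_min => /and3P[_ _ h1].
    have := H2 (pt (x0 - dl) y); rewrite ballP !pt_t !pt_th subrr normr0.
    by move=> /(_ (conj d20 h1)); rewrite ltr_norml => /andP[]; lra.
have d'd2 y : `|y - y0| < d' -> `|y - y0| < d by move=> h; exact: lt_le_trans h d'd.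
have dld2 x : `|x - x0| < dl -> `|x - x0| < d by move=> h; exact: lt_trans h dld.
pose A := [set q : 'rV[R]_2 | [/\ `|q 0 t_ - x0| < dl, `|q 0 th_ - y0| < d' & `|f q - f p| < eta]].
pose B := [set r : 'rV[R]_2 | `|r 0 t_ - f p| < eta /\ `|r 0 th_ - y0| < d'].
have lt_near (q : 'rV[R]_2) j c e : `|q 0 j - c| < e -> \forall z \near q, `|(z : 'rV[R]_2) 0 j - c| < e.
  move=> h; have e0 : 0 < e - `|q 0 j - c| by rewrite subr_gt0.
  have cj : {for q, continuous (fun z : 'rV[R]_2 => z 0 j : R)}.
    by apply: differentiable_continuous; exact: differentiable_coord.
  have /cvgrPdist_lt /(_ _ e0) := cj.
  apply: filterS => z; rewrite distrC => hz.
  have -> : z 0 j - c = (z 0 j - q 0 j) + (q 0 j - c) by ring.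
  by apply: (le_lt_trans (ler_normD _ _)); rewrite -ltrBrDr.
have oB : open B.
  rewrite openE => r [h1 h2]; rewrite /interior.
  have := lt_near _ _ _ _ h1; have := lt_near _ _ _ _ h2.
  by apply: filterS2 => z ? ?.
have oA : open A.
  rewrite openE => q [h1 h2 h3]; rewrite /interior.
  have e0 : 0 < eta - `|f q - f p| by rewrite subr_gt0.
  have cq : {for q, continuous f} by rewrite -(ptK q); apply: fcont; [exact: dld2|exact: d'd2].
  have /cvgrPdist_lt /(_ _ e0) := cq.
  have := lt_near _ _ _ _ h1; have := lt_near _ _ _ _ h2.
  apply: filterS3 => z z1 z2 z3; split => //.
  have -> : f z - f p = (f z - f q) + (f q - f p) by ring.
  by apply: (le_lt_trans (ler_normD _ _)); rewrite -ltrBrDr distrC.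
(* The condition [B r] sits inside the existential so that choice gives a total function; its value
   outside [B] is arbitrary. *)
have kex r : exists z, B r -> `|z - x0| < dl /\ f (pt z (r 0 th_)) = r 0 t_.
  have [Br|nB] := pselect (B r); last by exists 0.
  have [h1 h2] := Br.
  have le : x0 - dl <= x0 + dl by lra.
  have fm := Hm _ h2; have fp := Hp _ h2.
  have itvd z : z \in `[x0 - dl, x0 + dl] -> `|z - x0| < d.
    by rewrite in_itv /= => /andP[k1 k2]; rewrite ltr_distl; apply/andP; split; clear -dld k1 k2; lra.
  have [||c cin fc] := @IVT R (fun z => f (pt z (r 0 th_))) (x0 - dl) (x0 + dl) (r 0 t_) le.
  - apply: continuous_in_subspaceT => z; rewrite inE /= => /itvd zd.
    apply: differentiable_continuous; apply/derivable1_diffP.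
    have [Uz _] := Hd _ (inb _ _ zd (d'd2 _ h2)).
    by have /derivableP/is_derive_tP [] := @smooth_derivable _ _ _ _ _ _ (e_t R) sf Uz.
  - move: h1; rewrite ltr_norml => /andP[k1 k2].
    by rewrite ge_min le_max; apply/andP; split; apply/orP; [left|right]; clear -fm fp k1 k2; lra.
  exists c => _; split => //.
  move: cin; rewrite in_itv /= => /andP[]; rewrite !le_eqVlt => /orP[/eqP cE|c1].
    move: h1; rewrite -fc -cE ltr_norml => /andP[k1 k2]; clear -fm fp k1 k2; lra.
  move=> /orP[/eqP cE|c2].
    move: h1; rewrite -fc cE ltr_norml => /andP[k1 k2]; clear -fm fp k1 k2; lra.
  by rewrite ltr_distl c1 c2.
have [k kP] := choice kex.
have kU q : A q -> forall z, `|z - x0| < dl -> f (pt z (q 0 th_)) = f q -> z = q 0 t_.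
  move=> [h1 h2 h3] z hz fz.
  have [zq|/ltW qz] := leP z (q 0 t_).
    have := @mono z (q 0 t_) (q 0 th_) (d'd2 _ h2) (dld2 _ hz) (dld2 _ h1) zq.
    rewrite fz ptK subrr pmulr_rle0 // subr_le0 => qz; exact: le_anti (introT andP (conj zq qz)).
  have := @mono (q 0 t_) z (q 0 th_) (d'd2 _ h2) (dld2 _ h1) (dld2 _ hz) qz.
  rewrite fz ptK subrr pmulr_rle0 // subr_le0 => zq; exact: le_anti (introT andP (conj zq qz)).
have AB q : A q -> B (pt (f q) (q 0 th_)) by move=> [h1 h2 h3]; split; rewrite ?pt_t ?pt_th.
have BA r : B r -> A (pt (k r) (r 0 th_)).
  by move=> Br; have [k1 k2] := kP _ Br; have [h1 h2] := Br; split; rewrite ?pt_t ?pt_th ?k2.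
have ck r : B r -> {for r, continuous k}.
  move=> Br; have [k1 k2] := kP _ Br; have [h1 h2] := Br.
  apply/(@cvgrPdist_lt _ _ _ (nbhs r) (nbhs_filter r)) => e e0.
  have e40 : 0 < a * e / 4 by rewrite divr_gt0 // mulr_gt0.
  have /cvgrPdist_lt /(_ _ e40) /near_ballP [d1 d10 H1] := fcont _ _ (dld2 _ k1) (d'd2 _ h2).
  have nB : \forall z \near r, B z by exact: near_open Br _.
  have nt : \forall z \near r, `|(z : 'rV[R]_2) 0 t_ - r 0 t_| < a * e / 4.
    by apply: lt_near; rewrite subrr normr0.
  have nth : \forall z \near r, `|(z : 'rV[R]_2) 0 th_ - r 0 th_| < d1.
    by apply: lt_near; rewrite subrr normr0.
  apply: (@filterS3 _ (nbhs r) (nbhs_filter r) _ _ _ _ _ nB nt nth) => z Bz zt zth.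
  have [l1 l2] := kP _ Bz; have [g1 g2] := Bz.
  have F1 : `|f (pt (k r) (r 0 th_)) - f (pt (k r) (z 0 th_))| < a * e / 4.
    by apply: H1; apply/ballP; rewrite !pt_t !pt_th subrr normr0.
  have F2 : `|f (pt (k z) (z 0 th_)) - f (pt (k r) (z 0 th_))| < a * e / 2.
    rewrite l2; rewrite k2 in F1.
    have -> : z 0 t_ - f (pt (k r) (z 0 th_)) = (z 0 t_ - r 0 t_) + (r 0 t_ - f (pt (k r) (z 0 th_))) by ring.
    apply: (le_lt_trans (ler_normD _ _)); clear -zt F1; lra.
  move: F2; rewrite !ltr_norml => /andP[F2 F3].
  have [zq|/ltW qz] := leP (k z) (k r).
    have := @mono _ _ _ (d'd2 _ g2) (dld2 _ l1) (dld2 _ k1) zq.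
    by move=> hh; clear -hh F2 F3 zq a0 e0; apply/andP; split; nra.
  have := @mono _ _ _ (d'd2 _ g2) (dld2 _ k1) (dld2 _ l1) qz.
  by move=> hh; clear -hh F2 F3 qz a0 e0; apply/andP; split; nra.
have main r : B r -> differentiable k r /\ forall v,
    'D_v k r = (v 0 t_ - 'D_(e_th R) f (pt (k r) (r 0 th_)) * v 0 th_) / 'D_(e_t R) f (pt (k r) (r 0 th_)).
  move=> Br; have [k1 k2] := kP _ Br; have [h1 h2] := Br.
  have [Uq aq] := Hd _ (inb _ _ (dld2 _ k1) (d'd2 _ h2)).
  apply: (@implicit_differentiable f k B r) => //.
  - exact: ck.
  - by move=> q Bq; have [] := kP _ Bq.
  - exact: smooth_diff sf Uq.
  - exact: lt_trans aq.
exists A, B, k; split.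
- split => //; first by move=> q [h1 h2 _]; rewrite -(ptK q); have [] := Hd _ (inb _ _ (dld2 _ h1) (d'd2 _ h2)).
  (* Bootstrap: the derivative of [k] is a smooth function of [f]'s partial derivatives evaluated at
     [K], and [K] has the regularity of [k]. *)
  elim=> // j IH; split=> [r /main []//|v].
  pose K r := pt (k r) (r 0 th_).
  have CK : Ck j B K.
    apply/Ck_rV => //; apply: ord2P.
      by apply: Ck_ext IH => // x _; rewrite pt_t.
    by apply: Ck_ext (@Ck_coord _ _ j B th_) => // x _; rewrite pt_th.
  have KU r : B r -> (U `&` [set q | 'D_(e_t R) f q != 0]) (K r).
    move=> Br; have [k1 k2] := kP _ Br; have [h1 h2] := Br.
    have [Uq aq] := Hd _ (inb _ _ (dld2 _ k1) (d'd2 _ h2)).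
    by split => //=; rewrite gt_eqF // (lt_trans _ aq).
  have oU' : open (U `&` [set q | 'D_(e_t R) f q != 0]).
    rewrite openE => q [Uq /= nz]; rewrite /interior.
    have cq := smooth_continuous (smooth_derive (e_t R) sf) Uq.
    have nzq : \forall z \near q, 'D_(e_t R) f z != 0.
      have e0 : 0 < `|'D_(e_t R) f q| by rewrite normr_gt0.
      have /cvgrPdist_lt /(_ _ e0) := cq; apply: filterS => z hz.
      by apply: contraTneq hz => ->; rewrite subr0 ltxx.
    have Uz : \forall z \near q, U z by exact: near_open Uq _.
    by move: Uz nzq; apply: filterS2 => z.
  have sG : smooth (U `&` [set q | 'D_(e_t R) f q != 0])
      (fun q => (v 0 t_ - 'D_(e_th R) f q * v 0 th_) / 'D_(e_t R) f q).
    have sub : (U `&` [set q | 'D_(e_t R) f q != 0]) `<=` U by move=> q [].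
    apply: smooth_div => //; first by move=> q [].
      apply: smoothB => //; first exact: smooth_cst.
      by apply: smoothM => //; [apply: smooth_sub sub _; exact: smooth_derive|exact: smooth_cst].
    by apply: smooth_sub sub _; exact: smooth_derive.
  apply: (@Ck_ext _ _ _ _ _ (fun r => (v 0 t_ - 'D_(e_th R) f (K r) * v 0 th_) / 'D_(e_t R) f (K r))) => //.
    by move=> r /main [_ ->].
  exact: (Ck_comp oB KU CK (sG j)).
- by split; rewrite ?subrr ?normr0.
- move=> q Aq; split; first exact: AB.
  have [k1 k2] := kP _ (AB _ Aq); apply: (kU _ Aq) => //.
  by move: k2; rewrite pt_t pt_th.
- by move=> r Br; split; [exact: BA|have [] := kP _ Br].
Qed.

End Implicit.

Section ImplicitVariants.
Variable R : realType.
Implicit Types (f : 'rV[R]_2 -> R) (p q r : 'rV[R]_2).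

Lemma open_preimage n m (U : set 'rV[R]_n) (V : set 'rV[R]_m) (h : 'rV[R]_n -> 'rV[R]_m) :
  open U -> open V -> smooth U h -> open (U `&` h @^-1` V).
Proof.
move=> oU oV sh; rewrite openE => q [Uq /= Vq]; rewrite /interior.
have cq := smooth_continuous sh Uq.
have nV : \forall z \near q, V (h z) by apply: cq; exact: near_open Vq _.
have nU : \forall z \near q, U z by exact: near_open Uq _.
by apply: (@filterS2 _ (nbhs q) (nbhs_filter q) _ _ _ _ nU nV) => z.
Qed.

Lemma open_preimageT n m (V : set 'rV[R]_m) (h : 'rV[R]_n -> 'rV[R]_m) :
  open V -> smooth setT h -> open (h @^-1` V).
Proof. by move=> oV sh; have := open_preimage openT oV sh; rewrite setTI. Qed.

Definition negt q := pt (- q 0 t_) (q 0 th_).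
Definition swap q := pt (q 0 th_) (q 0 t_).

Lemma smooth_negt U : open U -> smooth U negt.
Proof. by move=> oU; apply: smooth_pt => //; [apply: smoothN => //; exact: smooth_coord|exact: smooth_coord]. Qed.
Lemma smooth_swap U : open U -> smooth U swap.
Proof. by move=> oU; apply: smooth_pt => //; exact: smooth_coord. Qed.
Lemma swapK : involutive swap.
Proof. by move=> q; apply: eq_pt; rewrite !(pt_t, pt_th). Qed.

(** A negative derivative is brought to the positive case by passing to [- f]; the reflection [negt]
    of the first coordinate then corrects the inverse. *)
Lemma implicit_t (U : set 'rV[R]_2) f p : open U -> smooth U f -> U p ->
  'D_(e_t R) f p != 0 ->
  exists (A B : set 'rV[R]_2) (k : 'rV[R]_2 -> R),
   [/\ [/\ open A, open B, A `<=` U & smooth B k],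
       A p,
       (forall q, A q -> B (pt (f q) (q 0 th_)) /\ k (pt (f q) (q 0 th_)) = q 0 t_) &
       (forall r, B r -> A (pt (k r) (r 0 th_)) /\ f (pt (k r) (r 0 th_)) = r 0 t_)].
Proof.
move=> oU sf Up; rewrite neq_lt => /orP[n0|]; last exact: implicit_pos sf Up.
have sNf : smooth U (fun q => - f q) by exact: smoothN.
have [|A [B [k [[oA oB AU sk] Ap AB BA]]]] := implicit_pos oU sNf Up.
  by rewrite deriveN ?oppr_gt0 //; exact: smooth_derivable sf Up.
have sn := smooth_negt openT.
exists A, (negt @^-1` B), (fun r => k (negt r)); split => //.
- split => //; first exact: open_preimageT.
  apply: (smooth_comp (U' := B)) => //; first exact: open_preimageT.
  by apply: smooth_negt; exact: open_preimageT.
- by move=> q /AB; rewrite /negt /= pt_t pt_th.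
- by move=> r /= /BA; rewrite /negt pt_th pt_t => -[H1 /eqP]; rewrite eqr_opp => /eqP.
Qed.

Lemma implicit_th (U : set 'rV[R]_2) f p : open U -> smooth U f -> U p ->
  'D_(e_th R) f p != 0 ->
  exists (A B : set 'rV[R]_2) (k : 'rV[R]_2 -> R),
   [/\ [/\ open A, open B, A `<=` U & smooth B k],
       A p,
       (forall q, A q -> B (pt (q 0 t_) (f q)) /\ k (pt (q 0 t_) (f q)) = q 0 th_) &
       (forall r, B r -> A (pt (r 0 t_) (k r)) /\ f (pt (r 0 t_) (k r)) = r 0 th_)].
Proof.
move=> oU sf Up nz.
have sw := smooth_swap openT.
pose U' := swap @^-1` U.
have oU' : open U' by exact: open_preimageT.
have sf' : smooth U' (fun q => f (swap q)).
  by apply: (smooth_comp (U' := U)) => //; exact: smooth_swap.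
have [||A [B [k [[oA oB AU sk] Ap AB BA]]]] := implicit_t (p := swap p) oU' sf'.
- by rewrite /U' /= swapK.
- have -> : 'D_(e_t R) (fun q => f (swap q)) (swap p) = 'D_(e_th R) f p; last by [].
  have : is_derive (pt (p 0 t_) (p 0 th_)) (e_th R) f ('D_(e_th R) f p).
    by rewrite ptK; apply: derivableP; exact: smooth_derivable sf Up.
  move/is_derive_thP => H.
  have : is_derive (swap p) (e_t R) (fun q => f (swap q)) ('D_(e_th R) f p).
    apply/is_derive_tP.
    have -> : (fun x => f (swap (pt x (p 0 t_)))) = (fun y => f (pt (p 0 t_) y)); last by [].
    by apply/funext => x; rewrite /swap pt_t pt_th.
  by case.
exists (swap @^-1` A), (swap @^-1` B), (fun r => k (swap r)); split.
- split; [exact: open_preimageT|exact: open_preimageT| |].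
    by move=> q /= /AU; rewrite /U' /= swapK.
  by apply: (smooth_comp (U' := B)) => //; [exact: open_preimageT|apply: smooth_swap; exact: open_preimageT].
- by rewrite /= .
- by move=> q /= /AB; rewrite swapK /swap !(pt_t, pt_th).
- by move=> r /= /BA; rewrite /swap !(pt_t, pt_th).
Qed.

End ImplicitVariants.

(** * Flat functions and Borel's lemma *)

Section Bump.
Variable R : realType.

Lemma near_is_derive1 (u w : R -> R) x d : (\near x, u x = w x) ->
  is_derive x (1 : R) u d -> is_derive x (1 : R) w d.
Proof. by move=> h H; exact: (near_eq_is_derive h H). Qed.

Lemma expRN_monomial_le (s : R) n : 0 < s -> s ^+ n * expR (- s) <= n`!%:R.
Proof.
move=> s0; rewrite expRN ler_pdivrMr ?expR_gt0 //.
case: n => [|n].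
  rewrite expr0 fact0 mul1r; apply: le_trans (expR_ge1Dx s); by rewrite lerDl ltW.
rewrite -ler_pdivrMl ?ltr0n ?fact_gt0 // mulrC.
by apply: le_trans (expR_ge1Dxn n (ltW s0)); rewrite lerDr.
Qed.

Lemma expRN_poly_le (p : {poly R}) : exists C, forall s, 0 < s -> `|p.[s] * expR (- s)| <= C.
Proof.
exists (\sum_(i < size p) `|p`_i| * i`!%:R) => s s0.
rewrite horner_coef mulr_suml; apply: (le_trans (ler_norm_sum _ _ _)).
apply: ler_sum => i _; rewrite -mulrA normrM ler_wpM2l // ger0_norm.
  exact: expRN_monomial_le.
by rewrite mulr_ge0 ?expR_ge0 // exprn_ge0 // ltW.
Qed.

(** For x > 0 the m-th derivative of exp(-1/x) is P_m(1/x) exp(-1/x). Differentiating once more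
    gives P_(m+1) = X^2 (P_m - P_m'). *)
Fixpoint flat_poly m : {poly R} :=
  if m is m'.+1 then 'X^2 * (flat_poly m' - (flat_poly m')^`()) else 1.

Definition flat_exp m (x : R) : R :=
  if 0 < x then (flat_poly m).[x^-1] * expR (- x^-1) else 0.

Lemma flat_expP m (x : R) : is_derive x 1 (flat_exp m) (flat_exp m.+1 x).
Proof.
have [x0|x0|<-] := ltgtP 0 x.
- have near0 : \forall z \near x, 0 < z by exact: lt_nbhsr.
  apply: (@near_is_derive1 (fun z => (flat_poly m).[z^-1] * expR (- z^-1))).
    by move: near0; apply: filterS => z z0; rewrite /flat_exp z0.
  have dV : is_derive x (1 : R) (fun z : R => z^-1) (- x ^- 2).
    have := @is_derive1_comp; move=> _.
    split; first by apply: (@derivableV _ _ id) => //; rewrite gt_eqF.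
    by rewrite (@deriveV _ _ id) ?gt_eqF // derive_id [_ *: _]mulr1.
  have d1 : is_derive x (1 : R) (fun z : R => (flat_poly m).[z^-1]) ((flat_poly m)^`().[x^-1] * - x ^- 2).
    exact: (@is_derive1_comp _ (horner (flat_poly m)) (fun z => z^-1)).
  have d2 : is_derive x (1 : R) (fun z : R => expR (- z^-1)) (expR (- x^-1) * x ^- 2).
    apply: (@is_derive1_comp _ expR (fun z => - z^-1)).
    by apply: (@is_derive_eq _ _ _ _ _ _ _ _ (is_deriveN dV)); rewrite opprK.
  apply: (@is_derive_eq _ _ _ _ _ _ _ _ (is_deriveM d1 d2)).
  rewrite /flat_exp x0 /= !(hornerM, hornerX, hornerD, hornerN) /GRing.scale /= -exprVn; ring.
- have near0 : \forall z \near x, z < 0 by exact: lt_nbhsl.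
  rewrite /flat_exp ltNge (ltW x0) /=.
  apply: (@near_is_derive1 (cst (0 : R))).
  by move: near0; apply: filterS => z z0; rewrite ltNge (ltW z0).
- have E0 : forall k, flat_exp k 0 = 0 by move=> k; rewrite /flat_exp ltxx.
  (* At 0 the difference quotient is h^-1 P(h^-1) exp(-1/h) = h * (X^2 P)(h^-1) exp(-1/h), that is,
     h times a bounded quantity. *)
  have [C HC] := expRN_poly_le ('X^2 * flat_poly m).
  have C0 : 0 <= C by apply: le_trans (HC 1 _).
  rewrite E0.
  have lim0 : (fun h : R => h^-1 *: ((flat_exp m \o shift 0) (h *: 1) - flat_exp m 0)) @ 0^' --> (0 : R).
    apply/cvgrPdist_le => e e0; near=> h.
    rewrite sub0r normrN E0 subr0 /= addr0 [h *: 1]mulr1 /flat_exp.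
    have [h0|h0] := ltP 0 h; last by rewrite scaler0 normr0 ltW.
    have hV0 : 0 < h^-1 by rewrite invr_gt0.
    have -> : h^-1 *: ((flat_poly m).[h^-1] * expR (- h^-1)) =
       h * (('X^2 * flat_poly m).[h^-1] * expR (- h^-1)).
      by rewrite !hornerM !hornerX /GRing.scale /=; field; rewrite gt_eqF.
    rewrite normrM (gtr0_norm h0).
    have hC : h * (C + 1) <= e.
      rewrite -ler_pdivlMr ?ltr_wpDl //; apply: (le_trans (ler_norm _)).
      by near: h; apply: dnbhs0_le; rewrite divr_gt0 // ltr_wpDl.
    apply: le_trans hC; rewrite ler_pM2l //; apply: (le_trans (HC _ hV0)).
    by rewrite lerDl.
  split; first by apply/cvg_ex; exists 0.
  exact: cvg_lim lim0.
Unshelve. all: by end_near. Qed.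

Lemma flat_exp_ge0 x : 0 <= flat_exp 0 x.
Proof. by rewrite /flat_exp; case: ifP => // _; rewrite hornerC mul1r expR_ge0. Qed.
Lemma flat_exp_gt0 x : 0 < x -> 0 < flat_exp 0 x.
Proof. by rewrite /flat_exp => ->; rewrite hornerC mul1r expR_gt0. Qed.
Lemma flat_exp_eq0 x : x <= 0 -> flat_exp 0 x = 0.
Proof. by rewrite /flat_exp ltNge => ->. Qed.

(** A bump equal to 1 for |y| <= 1/2 and to 0 for |y| >= 1. The arguments 1 - y^2 and y^2 - 1/4 are
    never both nonpositive, so the denominator is positive. It is a function on the plane so that
    the smoothness calculus applies; [cutoff m] recovers the m-th derivative in y. *)
Definition cutoff2 (p : 'rV[R]_2) : R :=
  flat_exp 0 (1 - p 0 th_ ^+ 2) /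
  (flat_exp 0 (1 - p 0 th_ ^+ 2) + flat_exp 0 (p 0 th_ ^+ 2 - 4^-1)).

Definition cutoff m (y : R) : R := iter m (fun f p => 'D_(e_th R) f p) cutoff2 (pt 0 y).

Lemma cutoff_den_gt0 (y : R) : 0 < flat_exp 0 (1 - y ^+ 2) + flat_exp 0 (y ^+ 2 - 4^-1).
Proof.
have [h|h] := ltP (y ^+ 2) 1.
  by rewrite ltr_pwDl ?flat_exp_ge0 // flat_exp_gt0 // subr_gt0.
by rewrite ltr_wpDl ?flat_exp_ge0 // flat_exp_gt0 // subr_gt0 (lt_le_trans _ h) //; lra.
Qed.

Lemma smooth_cutoff2 : smooth setT cutoff2.
Proof.
have oT : open (setT : set 'rV[R]_2) by exact: openT.
have sy : smooth setT (fun p : 'rV[R]_2 => p 0 th_ : R) by exact: smooth_coord.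
have fe g : smooth setT g -> smooth setT (fun p : 'rV[R]_2 => flat_exp 0 (g p)).
  by move=> sg; apply: (@smooth_comp1 _ _ _ oT setT flat_exp g 0%N) => // i y _; exact: flat_expP.
have s1 : smooth setT (fun p : 'rV[R]_2 => flat_exp 0 (1 - p 0 th_ ^+ 2)).
  by apply: fe; apply: smoothB => //; [exact: smooth_cst|exact: smoothX].
apply: smooth_div => //; first by move=> p _; rewrite gt_eqF // cutoff_den_gt0.
apply: smoothD => //; apply: fe; apply: smoothB => //; [exact: smoothX|exact: smooth_cst].
Qed.

Lemma cutoffP m y : is_derive y (1 : R) (cutoff m) (cutoff m.+1 y).
Proof.
apply/is_derive_thP; apply: derivableP.
have : smooth setT (iter m (fun f p => 'D_(e_th R) f p) cutoff2).
  by elim: m => [|m IH]; [exact: smooth_cutoff2|exact: smooth_derive].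
by move=> /smooth_derivable; apply.
Qed.

Lemma cutoff0E y : cutoff 0 y = flat_exp 0 (1 - y ^+ 2) /
  (flat_exp 0 (1 - y ^+ 2) + flat_exp 0 (y ^+ 2 - 4^-1)).
Proof. by rewrite /cutoff /= /cutoff2 pt_th. Qed.

Lemma cutoff_eq1 y : `|y| <= 2^-1 -> cutoff 0 y = 1.
Proof.
move=> h; have h2 : y ^+ 2 <= 4^-1.
  rewrite -real_normK ?num_real //.
  have -> : (4^-1 : R) = 2^-1 ^+ 2 by rewrite exprVn; congr (_^-1); ring.
  by rewrite ler_pXn2r ?nnegrE ?invr_ge0.
rewrite cutoff0E (flat_exp_eq0 (x := y ^+ 2 - _)) ?subr_le0 // addr0 divff //.
by rewrite gt_eqF // flat_exp_gt0 // subr_gt0 (le_lt_trans h2) //; lra.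
Qed.

Lemma cutoff_norm_le1 y : `|cutoff 0 y| <= 1.
Proof.
rewrite cutoff0E ger0_norm; last by rewrite divr_ge0 ?flat_exp_ge0 // ltW // cutoff_den_gt0.
by rewrite ler_pdivrMr ?cutoff_den_gt0 // mul1r lerDl flat_exp_ge0.
Qed.

Lemma cutoff_eq0 m y : 1 < `|y| -> cutoff m y = 0.
Proof.
elim: m y => [|m IH] y hy.
  rewrite cutoff0E (flat_exp_eq0 (x := 1 - y ^+ 2)) ?mul0r // subr_le0.
  by rewrite -real_normK ?num_real // exprn_ege1 // ltW.
have ny : \forall z \near y, 1 < `|z|.
  have e0 : 0 < `|y| - 1 by rewrite subr_gt0.
  have /cvgrPdist_lt /(_ _ e0) : (id : R -> R) z @[z --> y] --> y by exact: cvg_id.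
  apply: filterS => z /= hz; have := ler_normB (y - z) (- z); rewrite opprK subrK normrN; lra.
have [_ <-] := cutoffP m y.
rewrite (@near_eq_derive _ _ _ _ (cst 0)) ?derive_cst //.
by move: ny; apply: filterS => z /IH.
Qed.

Lemma continuous_bounded (u : R -> R) a b :
  (forall x, a <= x <= b -> {for x, continuous u}) ->
  exists K, forall x, a <= x <= b -> `|u x| <= K.
Proof.
move=> cu; have [ab|ba] := leP a b; last first.
  by exists 0 => x /andP[h1 h2]; have := le_lt_trans (le_trans h1 h2) ba; rewrite ltxx.
have [|c _ H] := @EVT_max R (fun x => `|u x|) a b ab.
  apply: continuous_in_subspaceT => x; rewrite inE /= in_itv /= => /cu cx.
  exact: (continuous_comp cx (@norm_continuous _ R^o _)).
by exists `|u c| => x hx; apply: H; rewrite in_itv.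
Qed.

Lemma is_derive_continuous (u : R -> R) x du : is_derive x (1 : R) u du -> {for x, continuous u}.
Proof. by move=> [d _]; apply: differentiable_continuous; apply/derivable1_diffP. Qed.

(** The m-th derivative of y^j * cutoff(y), by the Leibniz rule for one factor y at a time. For m =
    0 the truncated predecessor is harmless because its coefficient is 0. *)
Fixpoint cutoff_mono j m (y : R) : R :=
  if j is j'.+1 then y * cutoff_mono j' m y + m%:R * cutoff_mono j' m.-1 y else cutoff m y.

Lemma cutoff_monoP j m y : is_derive y (1 : R) (cutoff_mono j m) (cutoff_mono j m.+1 y).
Proof.
elim: j m y => [|j IH] m y /=; first exact: cutoffP.
have d1 := is_deriveM (is_derive_id y 1) (IH m y).
have d2 := is_deriveZ m%:R (IH m.-1 y).
apply: (@is_derive_eq _ _ _ _ _ _ _ _ (is_deriveD d1 d2)).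
case: m {d1 d2} => [|m]; rewrite /GRing.scale /= ?mulr1 ?mul0r ?addr0 ?mul1r //.
rewrite -[m.+2]addn1 natrD; ring.
Qed.

Lemma cutoff_mono0E j y : cutoff_mono j 0 y = y ^+ j * cutoff 0 y.
Proof. by elim: j => [|j /= ->]; rewrite ?expr0 ?mul1r // mul0r addr0 exprS mulrA. Qed.

Lemma cutoff_mono_bounded j m : exists K, forall y, `|cutoff_mono j m y| <= K.
Proof.
have z j' m' y : 1 < `|y| -> cutoff_mono j' m' y = 0.
  by move=> hy; elim: j' m' => [|j' IH] m' /=; [exact: cutoff_eq0|rewrite !IH !mulr0 addr0].
have [|K HK] := @continuous_bounded (cutoff_mono j m) (-1) 1.
  by move=> x _; exact: is_derive_continuous (cutoff_monoP _ _ _).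
exists K => y; have [h|h] := leP `|y| 1; first by apply: HK; rewrite -ler_norml.
rewrite z // normr0; apply: le_trans (HK 0 _) => //; lra.
Qed.

End Bump.

(** * Termwise differentiation of dominated series *)

Section Series.
Variable R : realType.
Implicit Types (u v M : nat -> R).

Definition Sum u : R := limn (series u).

Lemma dominated_cvg_series u M : (forall j, `|u j| <= M j) -> cvgn (series M) ->
  cvgn (series u).
Proof.
move=> uM cM; apply: normed_cvg; apply: (@series_le_cvg _ _ M) => // n; first exact: normr_ge0.
exact: le_trans (normr_ge0 _) (uM n).
Qed.

Lemma Sum_norm_le u M : (forall j, `|u j| <= M j) -> cvgn (series M) -> `|Sum u| <= Sum M.
Proof.
move=> uM cM.
have cn : cvgn [normed series u].
  by apply: (@series_le_cvg _ _ M) => // n; [exact: normr_ge0|]; exact: le_trans (normr_ge0 _) (uM n).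
by apply: le_trans (lim_series_norm cn) _; exact: lim_series_le.
Qed.

Lemma SumB u v : cvgn (series u) -> cvgn (series v) -> Sum (fun j => u j - v j) = Sum u - Sum v.
Proof. by move=> cu cv; exact: lim_seriesB. Qed.

Lemma SumZ k u : cvgn (series u) -> Sum (fun j => k * u j) = k * Sum u.
Proof. by move=> cu; exact: lim_seriesZ. Qed.

Lemma Sum_fin u n : (forall j, (n <= j)%N -> u j = 0) ->
  cvgn (series u) /\ Sum u = \sum_(j < n) u j.
Proof.
move=> u0.
have : series u @ \oo --> \sum_(j < n) u j.
  apply: cvg_near_cst.
  near=> k; have nk : (n <= k)%N by near: k; exact: nbhs_infty_ge.
  rewrite /series /= -(big_mkord xpredT) (big_cat_nat (leq0n n) nk) //=.
  rewrite [X in _ + X]big_nat_cond [X in _ + X]big1 ?addr0 // => j /andP[/andP[/u0]] //.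
by move=> h; split; [apply/cvg_ex; eexists; exact: h|exact: cvg_lim h].
Unshelve. all: by end_near. Qed.

Lemma MVT_ball (u du : R -> R) x0 r a b :
  (forall x, `|x - x0| < r -> is_derive x (1 : R) u (du x)) ->
  `|a - x0| < r -> `|b - x0| < r ->
  exists c, [/\ `|c - x0| < r, `|c - a| <= `|b - a| & u b - u a = du c * (b - a)].
Proof.
move=> D ha hb.
exact: (@MVT_interval _ [set z | `|z - x0| < r] u du a b (@is_interval_dist _ x0 r) D ha hb).
Qed.

(** Dominated second derivatives make each first-order remainder at most [|h|^2 * M j] after two
    applications of the mean value theorem; summing gives the derivative without discussing uniform
    convergence. *)
Lemma series_is_derive (u du ddu : nat -> R -> R) M x0 r : 0 < r ->
  (forall j x, `|x - x0| < r -> is_derive x (1 : R) (u j) (du j x) /\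
                               is_derive x (1 : R) (du j) (ddu j x)) ->
  (forall j x, `|x - x0| < r -> [/\ `|u j x| <= M j, `|du j x| <= M j & `|ddu j x| <= M j]) ->
  cvgn (series M) ->
  is_derive x0 (1 : R) (fun x => Sum (u^~ x)) (Sum (du^~ x0)).
Proof.
move=> r0 D B cM.
have x0r : `|x0 - x0| < r by rewrite subrr normr0.
have est h j : `|h| < r -> `|u j (h + x0) - u j x0 - h * du j x0| <= `|h| ^+ 2 * M j.
  move=> hr; have hx : `|h + x0 - x0| < r by rewrite addrK.
  have [c [Jc ch E]] := MVT_ball (fun x hx => (D j x hx).1) x0r hx.
  have [c' [Jc' _ E']] := MVT_ball (fun x hx => (D j x hx).2) x0r Jc.
  rewrite E addrK in ch *.
  have -> : du j c * h - h * du j x0 = h * (du j c - du j x0) by ring.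
  rewrite E' !normrM expr2 -mulrA ler_wpM2l // mulrC.
  have [_ _ b] := B j _ Jc'.
  by apply: ler_pM.
have cu x : `|x - x0| < r -> cvgn (series (u^~ x)).
  by move=> hx; apply: dominated_cvg_series cM => j; have [] := B j _ hx.
have cdu : cvgn (series (du^~ x0)).
  by apply: dominated_cvg_series cM => j; have [] := B j _ x0r.
have main h : `|h| < r ->
   `|Sum (u^~ (h + x0)) - Sum (u^~ x0) - h * Sum (du^~ x0)| <= `|h| ^+ 2 * Sum M.
  move=> hr; have hx : `|h + x0 - x0| < r by rewrite addrK.
  have c1 := cu _ hx; have c2 := cu _ x0r.
  have c12 : cvgn (series (fun j => u j (h + x0) - u j x0)) by exact: is_cvg_seriesB c1 c2.
  have c3 : cvgn (series (fun j => h * du j x0)) by exact: is_cvg_seriesZ.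
  rewrite -(SumZ h cdu) -(SumB c1 c2) -(SumB c12 c3) -(SumZ _ cM).
  by apply: Sum_norm_le; [move=> j; exact: est|exact: is_cvg_seriesZ].
have M0 : 0 <= Sum M.
  by apply: le_trans (Sum_norm_le (u := u^~ x0) _ cM) => // j; have [] := B j _ x0r.
have L : (fun h : R => h^-1 *: (((fun x => Sum (u^~ x)) \o shift x0) (h *: 1) - Sum (u^~ x0))) @ 0^' --> Sum (du^~ x0).
  apply/cvgrPdist_le => e e0; near=> h.
  have h0 : h != 0 by near: h; exact: nbhs_dnbhs_neq.
  have hr : `|h| < r by near: h; exact: dnbhs0_lt.
  rewrite /= [h *: 1]mulr1 distrC.
  have -> : h^-1 *: (Sum (u^~ (h + x0)) - Sum (u^~ x0)) - Sum (du^~ x0) =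
     h^-1 * (Sum (u^~ (h + x0)) - Sum (u^~ x0) - h * Sum (du^~ x0)).
    by rewrite /GRing.scale /= [RHS]mulrBr mulKf.
  rewrite normrM normfV ler_pdivrMl ?normr_gt0 //; apply: (le_trans (main _ hr)).
  rewrite expr2 -mulrA ler_wpM2l //.
  have : `|h| <= e / (Sum M + 1) by near: h; apply: dnbhs0_le; rewrite divr_gt0 // ltr_wpDl.
  rewrite ler_pdivlMr ?ltr_wpDl // => hh; apply: le_trans hh.
  by rewrite ler_wpM2l // lerDl.
by split; [apply/cvg_ex; eexists; exact: L|exact: cvg_lim L].
Unshelve. all: by end_near. Qed.

End Series.

(** * Borel's lemma with a parameter *)

Section Borel.
Variable R : realType.

Lemma half_series_cvg : cvgn (series (fun j => 2^-1 ^+ j : R)).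
Proof.
have -> : (fun j => 2^-1 ^+ j : R) = geometric 1 2^-1.
  by apply/funext => j; rewrite /= mul1r.
apply: is_cvg_geometric_series.
by rewrite ger0_norm ?invr_ge0 // invf_lt1 // ltr1n.
Qed.

(** Estimates of the Borel terms are geometric only once the index exceeds the order of derivation.
    The finitely many earlier terms get whatever bound they admit, which does not affect
    convergence. *)
Lemma eventual_half_bound (P : nat -> R -> Prop) n :
  (forall j a b, P j a -> a <= b -> P j b) ->
  (forall j, exists a, P j a) -> (forall j, (n < j)%N -> P j (2^-1 ^+ j)) ->
  exists M, (forall j, P j (M j)) /\ cvgn (series M).
Proof.
move=> Pm Pe Pn; have [B HB] := choice Pe.
pose F j := if (j <= n)%N then `|B j| else 0.
exists (fun j => F j + 2^-1 ^+ j); split.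
  move=> j; rewrite /F; case: leqP => [jn|nj].
    by apply: Pm (HB j) _; rewrite (le_trans (ler_norm _)) // lerDl exprn_ge0 // invr_ge0.
  by rewrite add0r; exact: Pn.
apply: (@is_cvg_seriesD R F); last exact: half_series_cvg.
have [j nj|//] := @Sum_fin _ F n.+1.
by rewrite /F leqNgt nj.
Qed.

Variables (c : nat -> nat -> R -> R) (d d' : R).
Hypotheses (d'0 : 0 < d') (d'd : d' < d).
Hypothesis cP : forall j i x, `|x| < d -> is_derive x (1 : R) (c j i) (c j i.+1 x).

Let cB j i : exists K, forall x, `|x| <= d' -> `|c j i x| <= K.
Proof.
have [|K HK] := @continuous_bounded _ (c j i) (- d') d'.
  by move=> x; rewrite -ler_norml => hx; exact: is_derive_continuous (cP _ _ (le_lt_trans hx d'd)).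
by exists K => x; rewrite ler_norml; exact: HK.
Qed.

(** One constant serves all derivatives of orders at most [j] in each variable: there are finitely
    many of them, so the sum of their bounds suffices. *)
Let Kex j : exists K, [/\ 0 <= K, (forall x, `|x| <= d' -> `|c j 0 x| <= K) &
  forall i m x y, (i <= j)%N -> (m <= j)%N -> `|x| <= d' -> `|c j i x * cutoff_mono j m y| <= K].
Proof.
have [C HC] := choice (cB j).
have [P HP] := choice (@cutoff_mono_bounded R j).
exists (\sum_(i < j.+1) \sum_(m < j.+1) `|C i| * `|P m| + `|C 0%N|); split.
- by apply: addr_ge0 => //; apply: sumr_ge0 => i _; apply: sumr_ge0 => m _; rewrite mulr_ge0.
- move=> x /(HC 0%N) h; apply: (le_trans h); apply: (le_trans (ler_norm _)); rewrite lerDr.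
  by apply: sumr_ge0 => i _; apply: sumr_ge0 => m _; rewrite mulr_ge0.
move=> i m x y ij mj hx.
have : `|c j i x * cutoff_mono j m y| <= `|C i| * `|P m|.
  rewrite normrM; apply: ler_pM => //.
    by apply: (le_trans (HC i _ hx)); exact: ler_norm.
  by apply: (le_trans (HP m _)); exact: ler_norm.
move=> /le_trans; apply.
rewrite (bigD1 (Ordinal (ij : (i < j.+1)%N))) //= (bigD1 (Ordinal (mj : (m < j.+1)%N))) //=.
rewrite -!addrA lerDl !addr_ge0 //.
  by apply: sumr_ge0 => k _; rewrite mulr_ge0.
by apply: sumr_ge0 => k _; apply: sumr_ge0 => l _; rewrite mulr_ge0.
Qed.

Let K : nat -> R := projT1 (choice Kex).
Let KP j := projT2 (choice Kex) j.
(** Width of the j-th cutoff. Each y-derivative costs a factor [(eps j)^-1]; after m < j of them the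
    term keeps [eps j ^+ (j - m)], at most [eps j], and [K j * eps j] is at most 2^-j. *)
Let eps j : R := (2 ^+ j * (K j + 1))^-1.

Let K1 j : 0 < K j + 1.
Proof. by have [h _ _] := KP j; rewrite ltr_wpDl. Qed.
Let eps_gt0 j : 0 < eps j.
Proof. by rewrite invr_gt0 mulr_gt0 // exprn_gt0. Qed.
Let epsV_gt0 j : 0 < (eps j)^-1.
Proof. by rewrite invr_gt0; exact: eps_gt0. Qed.
Let eps_le1 j : eps j <= 1.
Proof.
rewrite invf_le1 ?mulr_gt0 ?exprn_gt0 //.
have [h _ _] := KP j.
rewrite -[leLHS]mulr1 ler_pM ?ler01 //; first by rewrite exprn_ege1 // ler1n.
by rewrite lerDr.
Qed.
Let Keps j : K j * eps j <= 2^-1 ^+ j.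
Proof.
rewrite /eps invfM exprVn mulrCA -[leRHS]mulr1 ler_wpM2l ?invr_ge0 ?exprn_ge0 //.
by rewrite ler_pdivrMr // mul1r lerDl.
Qed.

(** The derivative of order i in x and m in y of c_j(x) y^j cutoff(y / eps_j), after writing y^j as
    eps_j^j (y / eps_j)^j. *)
Definition borel_term i m j (x y : R) : R :=
  c j i x * (eps j ^+ j * (eps j)^-1 ^+ m * cutoff_mono j m ((eps j)^-1 * y)).

Definition borel_sum i m (p : 'rV[R]_2) : R := Sum (fun j => borel_term i m j (p 0 t_) (p 0 th_)).

Let term_dx i m j x y : `|x| < d ->
  is_derive x (1 : R) (fun x => borel_term i m j x y) (borel_term i.+1 m j x y).
Proof.
move=> hx; rewrite /borel_term.
set e := eps j ^+ j * _ * _.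
have := is_deriveM (cP j i hx) (is_derive_cst e x 1).
by move=> H; apply: (@is_derive_eq _ _ _ _ _ _ _ _ H); rewrite /GRing.scale /= mulr0 add0r mulrC.
Qed.

Let term_dy i m j x y :
  is_derive y (1 : R) (fun y => borel_term i m j x y) (borel_term i m.+1 j x y).
Proof.
have d1 : is_derive y (1 : R) (fun y : R => (eps j)^-1 * y) (eps j)^-1.
  have := is_deriveZ (eps j)^-1 (is_derive_id y 1).
  by move=> H; apply: (@is_derive_eq _ _ _ _ _ _ _ _ H); rewrite [_ *: _]mulr1.
have d2 : is_derive y (1 : R) (fun y : R => cutoff_mono j m ((eps j)^-1 * y))
    (cutoff_mono j m.+1 ((eps j)^-1 * y) * (eps j)^-1).
  exact: (@is_derive1_comp _ (cutoff_mono j m) (fun y => (eps j)^-1 * y) y _ _ (cutoff_monoP _ _ _) d1).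
have := is_deriveZ (c j i x * (eps j ^+ j * (eps j)^-1 ^+ m)) d2.
move=> H; have -> : (fun y => borel_term i m j x y) =
  (c j i x * (eps j ^+ j * (eps j)^-1 ^+ m) \*: (fun y => cutoff_mono j m ((eps j)^-1 * y))).
  by apply/funext => z; rewrite /borel_term /GRing.scale /= !mulrA.
by apply: (@is_derive_eq _ _ _ _ _ _ _ _ H); rewrite /borel_term /GRing.scale /= exprSr; ring.
Qed.

Let term_bound i m : exists M, (forall j x y, `|x| <= d' -> `|borel_term i m j x y| <= M j) /\ cvgn (series M).
Proof.
pose P j a := forall x y, `|x| <= d' -> `|borel_term i m j x y| <= a.
have [|||M [MP cM]] := @eventual_half_bound P (maxn i m).
- by move=> j a b Pa ab x y hx; exact: le_trans (Pa x y hx) ab.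
- move=> j; have [C HC] := cB j i; have [B HB] := cutoff_mono_bounded R j m.
  exists (C * (`|eps j ^+ j * (eps j)^-1 ^+ m| * B)) => x y hx.
  rewrite /borel_term !normrM; apply: ler_pM => //; first exact: HC.
  by rewrite -!normrM [X in X <= _]normrM ler_wpM2l.
- move=> j; rewrite gtn_max => /andP[ij mj] x y hx.
  have [_ _ /(_ i m x ((eps j)^-1 * y) (ltnW ij) (ltnW mj) hx) H] := KP j.
  apply: le_trans (Keps j).
  have -> : borel_term i m j x y = c j i x * cutoff_mono j m ((eps j)^-1 * y) * eps j ^+ (j - m).
    rewrite /borel_term expfB_cond; last by rewrite gt_eqF // (ltnW mj).
    by rewrite exprVn; ring.
  rewrite normrM ler_pM //.
  rewrite normrX (gtr0_norm (eps_gt0 j)) -[leRHS]expr1.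
  by apply: ler_wiXn2l; [exact: ltW|exact: eps_le1|rewrite subn_gt0].
by exists M; split => // j x y; exact: MP.
Qed.

Let strip := [set p : 'rV[R]_2 | `|p 0 t_| < d'].

Let open_strip : open strip.
Proof.
rewrite openE => p hp; rewrite /interior; apply/near_ballP.
exists (d' - `|p 0 t_|); first by rewrite subr_gt0.
move=> q /ballP [h _]; rewrite /strip /=.
have := ler_normD (q 0 t_ - p 0 t_) (p 0 t_); rewrite subrK => /le_lt_trans; apply.
by rewrite -ltrBrDr.
Qed.

Lemma borel_sum_smooth : smooth strip (borel_sum 0 0).
Proof.
(* The formally differentiated series form a class stable under both partial derivatives, as
   [class_smooth] requires. *)
pose C f := exists i m, f = borel_sum i m.
apply: (@class_smooth _ strip C) => //; last by exists 0%N, 0%N.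
- move=> f [i [m ->]] p Up; have [M [HM cM]] := term_bound i m.
  exists (Sum M); apply: near_open Up _ => // q Uq.
  by apply: Sum_norm_le => // j; apply: HM; exact: ltW.
move=> f [i [m ->]]; exists (borel_sum i.+1 m), (borel_sum i m.+1); split; [by exists i.+1, m|by exists i, m.+1|].
move=> p Up.
have [M0 [HM0 cM0]] := term_bound i m.
have M00 j : 0 <= M0 j by apply: le_trans (HM0 j 0 0 _) => //; rewrite normr0 ltW.
rewrite -[p]ptK; set x := p 0 t_; set y := p 0 th_; split.
  apply/is_derive_tP; rewrite {2}/borel_sum pt_t pt_th.
  have -> : (fun x => borel_sum i m (pt x y)) = (fun x => Sum (fun j => borel_term i m j x y)).
    by apply/funext => z; rewrite /borel_sum pt_t pt_th.
  have [M1 [HM1 cM1]] := term_bound i.+1 m; have [M2 [HM2 cM2]] := term_bound i.+2 m.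
  have M10 j : 0 <= M1 j by apply: le_trans (HM1 j 0 0 _) => //; rewrite normr0 ltW.
  have M20 j : 0 <= M2 j by apply: le_trans (HM2 j 0 0 _) => //; rewrite normr0 ltW.
  have r0 : 0 < d' - `|x| by rewrite subr_gt0.
  have inr z : `|z - x| < d' - `|x| -> `|z| < d'.
    by move=> h; have := ler_normD (z - x) x; rewrite subrK => /le_lt_trans; apply; rewrite -ltrBrDr.
  apply: (@series_is_derive _ (fun j x => borel_term i m j x y) (fun j x => borel_term i.+1 m j x y)
    (fun j x => borel_term i.+2 m j x y) (fun j => M0 j + M1 j + M2 j) x _ r0).
  - by move=> j z /inr hz; split; apply: term_dx; exact: lt_trans d'd.
  - move=> j z /inr/ltW hz; split.
    + by apply: le_trans (HM0 _ _ _ hz) _; rewrite -addrA lerDl addr_ge0.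
    + by apply: le_trans (HM1 _ _ _ hz) _; rewrite addrAC lerDr addr_ge0.
    + by apply: le_trans (HM2 _ _ _ hz) _; rewrite lerDr addr_ge0.
  - by apply: (@is_cvg_seriesD R (fun j => M0 j + M1 j)) => //; exact: is_cvg_seriesD.
apply/is_derive_thP; rewrite {2}/borel_sum pt_t pt_th.
have -> : (fun y => borel_sum i m (pt x y)) = (fun y => Sum (fun j => borel_term i m j x y)).
  by apply/funext => z; rewrite /borel_sum pt_t pt_th.
have [M1 [HM1 cM1]] := term_bound i m.+1; have [M2 [HM2 cM2]] := term_bound i m.+2.
have M10 j : 0 <= M1 j by apply: le_trans (HM1 j 0 0 _) => //; rewrite normr0 ltW.
have M20 j : 0 <= M2 j by apply: le_trans (HM2 j 0 0 _) => //; rewrite normr0 ltW.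
have hx : `|x| <= d' by exact: ltW.
apply: (@series_is_derive _ (fun j y => borel_term i m j x y) (fun j y => borel_term i m.+1 j x y)
  (fun j y => borel_term i m.+2 j x y) (fun j => M0 j + M1 j + M2 j) y 1 ltr01).
- by move=> j z _; split; exact: term_dy.
- move=> j z _; split.
  + by apply: le_trans (HM0 _ _ _ hx) _; rewrite -addrA lerDl addr_ge0.
  + by apply: le_trans (HM1 _ _ _ hx) _; rewrite addrAC lerDr addr_ge0.
  + by apply: le_trans (HM2 _ _ _ hx) _; rewrite lerDr addr_ge0.
- by apply: (@is_cvg_seriesD R (fun j => M0 j + M1 j)) => //; exact: is_cvg_seriesD.
Qed.

(** The difference is summed term by term. For j < n only the deviation of the cutoff from 1 counts,
    and it lives away from y = 0; for j > n the support condition |y| <= eps_j supplies the missing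
    powers. *)
Lemma borel_sum_taylor n : exists C, forall x y, `|x| <= d' -> `|y| <= 1 ->
  `|borel_sum 0 0 (pt x y) - \sum_(j < n) c j 0 x * y ^+ j| <= C * `|y| ^+ n.
Proof.
have term0 j x y : borel_term 0 0 j x y = c j 0 x * (y ^+ j * cutoff 0 ((eps j)^-1 * y)).
  rewrite /borel_term cutoff_mono0E; move: (cutoff 0 _) => C.
  have : eps j != 0 by rewrite gt_eqF.
  move: (eps j) => e e0; rewrite expr0 mulr1 exprMn exprVn.
  by field; rewrite expf_neq0.
pose w j x y := borel_term 0 0 j x y - (if (j < n)%N then c j 0 x * y ^+ j else 0).
pose P j a := forall x y, `|x| <= d' -> `|y| <= 1 -> `|w j x y| <= a * `|y| ^+ n.
have [|||M [MP cM]] := @eventual_half_bound P n.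
- by move=> j a b Pa ab x y hx hy; apply: le_trans (Pa x y hx hy) _; rewrite ler_wpM2r // exprn_ge0.
- move=> j; have [K0 cK _] := KP j.
  rewrite /P /w; case: ltnP => jn.
    (* Where the cutoff differs from 1 one has [1 <= (2 / eps j) * |y|], so the n - j missing powers
       of [|y|] can be bought at that price; the leading 2 bounds the deviation of the cutoff. *)
    exists (2 * K j * (2 * (eps j)^-1) ^+ (n - j)) => x y hx hy.
    rewrite term0 mulrA -[X in _ - X]mulr1 -mulrBr !normrM.
    have [ye|ye] := leP (`|(eps j)^-1 * y|) 2^-1.
      rewrite cutoff_eq1 // subrr normr0 mulr0 !mulr_ge0 ?exprn_ge0 //.
      by rewrite mulr_ge0 // (ltW (epsV_gt0 j)).
    have y1 : 1 <= (2 * (eps j)^-1) * `|y|.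
      move: ye; rewrite normrM (gtr0_norm (epsV_gt0 j)) => ye; lra.
    have c2 : `|cutoff 0 ((eps j)^-1 * y) - 1| <= 2.
      apply: le_trans (ler_normB _ _) _; have := cutoff_norm_le1 ((eps j)^-1 * y).
      rewrite normr1; lra.
    have z1 : `|y| ^+ j <= (2 * (eps j)^-1) ^+ (n - j) * `|y| ^+ n.
      rewrite -{2}(subnK (ltnW jn)) exprD mulrA -exprMn ler_peMl ?exprn_ge0 //.
      by rewrite exprn_ege1.
    rewrite normrX.
    have -> : 2 * K j * (2 / eps j) ^+ (n - j) * `|y| ^+ n =
       K j * ((2 / eps j) ^+ (n - j) * `|y| ^+ n) * 2 by ring.
    by apply: ler_pM => //; apply: ler_pM => //; exact: cK.
  exists (K j) => x y hx hy; rewrite subr0 term0 2!normrM normrX.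
  apply: ler_pM => //; [exact: cK|].
  rewrite -[leRHS]mulr1; apply: ler_pM => //; [|exact: cutoff_norm_le1].
  exact: ler_wiXn2l.
- move=> j nj x y hx hy; rewrite /w ltnNge (ltnW nj) /= subr0 term0.
  have [K0 cK _] := KP j.
  have [ye|ye] := leP (`|(eps j)^-1 * y|) 1; last first.
    by rewrite cutoff_eq0 // !mulr0 normr0 mulr_ge0 ?exprn_ge0 // invr_ge0.
  have ye' : `|y| <= eps j.
    by move: ye; rewrite normrM (gtr0_norm (epsV_gt0 j)) ler_pdivrMl // mulr1.
  rewrite 2!normrM normrX -(subnK (ltnW nj)) exprD (subnK (ltnW nj)).
  apply: (@le_trans _ _ (K j * eps j * `|y| ^+ n)); last first.
    by rewrite ler_wpM2r ?exprn_ge0 // Keps.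
  rewrite -!mulrA; apply: ler_pM => //; [exact: cK|].
  apply: ler_pM => //; [|].
    apply: (@le_trans _ _ (eps j ^+ (j - n))).
      by rewrite lerXn2r ?nnegrE // ltW.
    by rewrite -[leRHS]expr1; apply: ler_wiXn2l; [exact: ltW|exact: eps_le1|rewrite subn_gt0].
  by rewrite -[leRHS]mulr1; apply: ler_pM => //; exact: cutoff_norm_le1.
exists (Sum M) => x y hx hy.
have [M0 [HM0 cM0]] := term_bound 0 0.
pose g j := if (j < n)%N then c j 0 x * y ^+ j else 0.
have [|cg Eg] := @Sum_fin _ g n; first by move=> j nj; rewrite /g ltnNge nj.
have -> : \sum_(j < n) c j 0 x * y ^+ j = Sum g.
  by rewrite Eg; apply: eq_bigr => j _; rewrite /g ltn_ord.
rewrite /borel_sum pt_t pt_th -SumB //; last first.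
  by apply: dominated_cvg_series cM0 => j; exact: HM0.
rewrite mulrC -SumZ //; apply: Sum_norm_le.
  by move=> j; rewrite mulrC; exact: MP.
exact: is_cvg_seriesZ.
Qed.

End Borel.

Lemma borel (R : realType) (c : nat -> nat -> R -> R) (d d' : R) : 0 < d' -> d' < d ->
  (forall j i x, `|x| < d -> is_derive x (1 : R) (c j i) (c j i.+1 x)) ->
  exists S : 'rV[R]_2 -> R, smooth [set p | `|p 0 t_| < d'] S /\
    forall n, exists C, forall x y, `|x| <= d' -> `|y| <= 1 ->
      `|S (pt x y) - \sum_(j < n) c j 0 x * y ^+ j| <= C * `|y| ^+ n.
Proof.
move=> d'0 d'd cP; exists (borel_sum d'd cP 0 0); split.
  exact: borel_sum_smooth.
by move=> n; exact: borel_sum_taylor.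
Qed.

(** * Even and odd parts of smooth functions *)

Section Flat.
Variable R : realType.
Implicit Types (f r : 'rV[R]_2 -> R) (p q : 'rV[R]_2).

Definition box2 (a b : R) := [set p : 'rV[R]_2 | `|p 0 t_| < a /\ `|p 0 th_| < b].
Definition box d := box2 d d.

Lemma near_coord_lt p j (a : R) : `|p 0 j| < a -> \forall q \near p, `|(q : 'rV[R]_2) 0 j| < a.
Proof.
move=> h; have e0 : 0 < a - `|p 0 j| by rewrite subr_gt0.
have cj : {for p, continuous (fun z : 'rV[R]_2 => z 0 j : R)}.
  by apply: differentiable_continuous; exact: differentiable_coord.
have /cvgrPdist_lt /(_ _ e0) := cj.
apply: filterS => z hz; have := ler_normB (p 0 j) (p 0 j - z 0 j).
rewrite subKr; move/le_lt_trans; apply; by rewrite -ltrBrDl.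
Qed.

Lemma open_box2 a b : open (box2 a b).
Proof.
rewrite openE => p [h1 h2]; rewrite /interior.
by apply: (@filterS2 _ (nbhs p) (nbhs_filter p) _ _ _ _ (near_coord_lt h1) (near_coord_lt h2)).
Qed.

Lemma open_box d : open (box d). Proof. exact: open_box2. Qed.

Lemma box_sub d d' : d' <= d -> box d' `<=` box d.
Proof. by move=> h p [h1 h2]; split; exact: lt_le_trans h. Qed.

Lemma box_pt d x y : `|x| < d -> `|y| < d -> box d (pt x y).
Proof. by move=> ? ?; split; rewrite ?pt_t ?pt_th. Qed.

Lemma smooth_bounded d d' f : d' < d -> smooth (box d) f ->
  exists K, 0 <= K /\ forall p, box d' p -> `|f p| <= K.
Proof.
move=> d'd sf; have [d'0|d'0] := ltP 0 d'; last first.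
  by exists 0; split => // p [h1 _]; have := le_lt_trans (normr_ge0 _) h1; rewrite ltNge d'0.
pose A := [set v : 'rV[R]_2 | forall i, `[- d', d']%classic (v 0 i)].
have cA : compact A.
  by apply: (@rV_compact _ 2 (fun=> `[- d', d']%classic)) => _; exact: segment_compact.
have [|||p0 _ H] := @EVT_max_rV R 2 (fun p => `|f p|) A.
- by exists 0 => i; rewrite mxE /= in_itv /=; apply/andP; split; lra.
- exact: cA.
- apply: continuous_in_subspaceT => p; rewrite inE => Ap.
  have Bp : box d p by split; [have := Ap t_|have := Ap th_];
    rewrite /= in_itv /= -ler_norml => /le_lt_trans; apply.
  exact: (continuous_comp (smooth_continuous sf Bp) (@norm_continuous _ R^o _)).
exists `|f p0|; split=> // p [h1 h2]; apply: H; rewrite inE /A /=; apply: ord2P;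
  by rewrite in_itv /= -ler_norml ltW.
Qed.

Lemma is_derive_line n (f : 'rV[R]_n -> R) (p v : 'rV[R]_n) (s a : R) :
  is_derive (p + s *: v) v f a -> is_derive s (1 : R) (fun s => f (p + s *: v)) a.
Proof.
have E : (fun h : R => h^-1 *: ((f \o shift (p + s *: v)) (h *: v) - f (p + s *: v))) =
   (fun h : R => h^-1 *: (((fun s => f (p + s *: v)) \o shift s) (h *: (1 : R)) - f (p + s *: v))).
  apply/funext => h /=; rewrite [_ *: 1]mulr1; congr (_ *: (f _ - _)).
  by rewrite scalerDl addrCA.
by move=> -[H1 H2]; split; move: H1 H2; rewrite /derivable /derive E.
Qed.

Lemma line_coord p s (e : 'rV[R]_2) j : (p + s *: e) 0 j = p 0 j + s * e 0 j.
Proof. by rewrite mxE [X in _ + X]mxE. Qed.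

(** Points of the axis are left out because the step used to estimate a derivative is proportional
    to a power of the second coordinate and degenerates there. *)
Definition flat d r := forall n d', d' < d ->
  exists C, 0 <= C /\ forall p, box d' p -> p 0 th_ != 0 -> `|r p| <= C * `|p 0 th_| ^+ n.

Definition smooth_flat d r := smooth (box d) r /\ flat d r.

(* Interpolation between the smallness of r and a bound on its second derivative,
   with a step proportional to an odd power of the second coordinate (so that it is never crossed). *)
Lemma smooth_flat_derive d r i : d <= 1 -> smooth_flat d r ->
  smooth_flat d (fun p => 'D_(delta_mx 0 i) r p).
Proof.
set e := delta_mx 0 i => d1 [sr fr]; split; first exact: smooth_derive.
have de : smooth (box d) (fun p => 'D_e r p) by exact: smooth_derive.
move=> n d' d'd; pose d'' := (d + d') / 2.
have d''d : d'' < d by rewrite /d''; lra.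
pose a := (d'' - d') / 2.
have a0 : 0 < a by rewrite /a /d''; lra.
have [d'0|d'0] := ltP 0 d'; last first.
  by exists 0; split => // p [h1 _]; have := le_lt_trans (normr_ge0 _) h1; rewrite ltNge d'0.
have a1 : a < 1 by rewrite /a /d''; lra.
have [M [M0 HM]] := smooth_bounded d''d (smooth_derive e de).
pose k := n.*2.+1.
have [C [C0 HC]] := fr k.*2 _ d''d.
have G0 : 0 <= (C * 2 ^+ k.*2 + C) / a + M * a.
  apply: addr_ge0; last by apply: mulr_ge0 => //; exact: ltW.
  apply: divr_ge0; last exact: ltW.
  by apply: addr_ge0 => //; apply: mulr_ge0 => //; exact: exprn_ge0.
exists ((C * 2 ^+ k.*2 + C) / a + M * a); split => //.
move=> p Bp V0; set V := p 0 th_ in V0 *.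
have V1 : `|V| <= 1 by have [_ /ltW h] := Bp; apply: le_trans h _; rewrite ltW // (lt_le_trans d'd).
have Vp : 0 < `|V| by rewrite normr_gt0.
pose h := a * V ^+ k.
have hE : `|h| = a * `|V| ^+ k by rewrite normrM normrX gtr0_norm.
have h0 : 0 < `|h| by rewrite hE mulr_gt0 // exprn_gt0.
have ha : `|h| <= a by rewrite hE ger_pMr // exprn_ile1.
have e1 j : `|e 0 j| <= 1 by rewrite mxE eqxx /=; case: eqP => _; rewrite ?normr1 ?normr0.
have Bs s : `|s| < 2 * a -> box d'' (p + s *: e).
  move=> hs; have [h1 h2] := Bp.
  have aux j : `|p 0 j| < d' -> `|(p + s *: e) 0 j| < d''.
    move=> hj; rewrite line_coord; apply: le_lt_trans (ler_normD _ _) _.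
    have : `|s * e 0 j| <= `|s| by rewrite normrM ler_piMr.
    have : 2 * a = d'' - d' by rewrite /a; field.
    by move=> A1 A2; clear -hs hj A1 A2; lra.
  by split; exact: aux.
have D1 s : `|s - 0| < 2 * a -> is_derive s (1 : R) (fun s => r (p + s *: e)) ('D_e r (p + s *: e)).
  rewrite subr0 => /Bs Bq; apply: is_derive_line; apply: derivableP.
  by apply: (smooth_derivable sr); exact: box_sub (ltW d''d) _ Bq.
have D2 s : `|s - 0| < 2 * a -> is_derive s (1 : R) (fun s => 'D_e r (p + s *: e))
    ('D_e (fun p => 'D_e r p) (p + s *: e)).
  rewrite subr0 => /Bs Bq; apply: (@is_derive_line _ (fun p => 'D_e r p)); apply: derivableP.
  by apply: (smooth_derivable de); exact: box_sub (ltW d''d) _ Bq.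
have ha2 : `|h - 0| < 2 * a by rewrite subr0; lra.
have z2 : `|(0 : R) - 0| < 2 * a by rewrite subr0 normr0; lra.
have [c [Jc ch E]] := MVT_ball D1 z2 ha2.
have [c' [Jc' _ E']] := MVT_ball D2 z2 Jc.
rewrite !subr0 scale0r addr0 in Jc Jc' ch E E'.
have Bc' := HM _ (Bs _ Jc').
have key : `|'D_e r p| * `|h| <= `|r (p + h *: e)| + `|r p| + M * `|h| * `|h|.
  have -> : `|'D_e r p| * `|h| = `|(r (p + h *: e) - r p) - ('D_e r (p + c *: e) - 'D_e r p) * h|.
    by rewrite -normrM; congr `|_|; rewrite E; ring.
  apply: le_trans (ler_normB _ _) _; apply: lerD; first exact: ler_normB.
  rewrite normrM ler_wpM2r // E' normrM.
  by apply: ler_pM.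
have Bq : box d'' (p + h *: e) by apply: Bs; move: ha2; rewrite subr0.
have qV : (p + h *: e) 0 th_ != 0 /\ `|(p + h *: e) 0 th_| <= 2 * `|V|.
  rewrite line_coord -/V.
  have -> : V + h * e 0 th_ = V * (1 + a * e 0 th_ * (V ^+ n) ^+ 2).
    by rewrite /h /k exprS -mul2n mulnC exprM; ring.
  have u1 : 0 <= (V ^+ n) ^+ 2 <= 1.
    by rewrite sqr_ge0 /= -real_normK ?num_real // normrX exprn_ile1 ?exprn_ge0 // exprn_ile1.
  have u2 : 0 <= e 0 th_ <= 1.
    by rewrite mxE eqxx /=; case: eqP => _; rewrite ?lexx ler01.
  move: u1 u2; move: ((V ^+ n) ^+ 2) (e 0 th_) => u w /andP[u1 u1'] /andP[u2 u2'].
  have aw0 : 0 <= a * w by apply: mulr_ge0 => //; exact: ltW.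
  have w0 : 0 <= a * w * u by exact: mulr_ge0.
  have w1 : a * w * u <= 1.
    by apply: mulr_ile1 => //; apply: mulr_ile1 => //; exact: ltW.
  split; first by rewrite mulf_neq0 // gt_eqF // ltr_pwDl.
  by rewrite normrM mulrC ler_wpM2r // ger0_norm; clear -w0 w1; lra.
have [q0 q2] := qV.
have r1 : `|r (p + h *: e)| <= C * 2 ^+ k.*2 * `|V| ^+ k.*2.
  apply: le_trans (HC _ Bq q0) _; rewrite -mulrA -exprMn ler_wpM2l //.
  by rewrite lerXn2r ?nnegrE // mulr_ge0.
have r2 : `|r p| <= C * `|V| ^+ k.*2.
  by apply: HC => //; apply: box_sub Bp; rewrite /d''; lra.
have Vk : `|V| ^+ k.*2 = `|h| / a * `|V| ^+ k.
  by rewrite hE -addnn exprD; field; rewrite gt_eqF.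
have Mh : M * `|h| * `|h| = M * a * `|V| ^+ k * `|h| by rewrite {1}hE; ring.
rewrite -(ler_pM2r h0); apply: le_trans key _.
have Vn : `|V| ^+ k <= `|V| ^+ n.
  by apply: ler_wiXn2l => //; rewrite /k -addnn -addnS leq_addr.
apply: (@le_trans _ _ (((C * 2 ^+ k.*2 + C) / a + M * a) * `|V| ^+ k * `|h|)).
  rewrite Mh.
  have -> : ((C * 2 ^+ k.*2 + C) / a + M * a) * `|V| ^+ k * `|h| =
    C * 2 ^+ k.*2 * (`|h| / a * `|V| ^+ k) + C * (`|h| / a * `|V| ^+ k) + M * a * `|V| ^+ k * `|h| by ring.
  by rewrite -Vk lerD2r; exact: lerD.
by rewrite ler_wpM2r // ler_wpM2l.
Qed.

Lemma smooth_flatD d r r' : smooth_flat d r -> smooth_flat d r' ->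
  smooth_flat d (fun p => r p + r' p).
Proof.
move=> [s1 f1] [s2 f2]; split; first by apply: smoothD => //; exact: open_box.
move=> n d' d'd; have [C1 [C10 H1]] := f1 n d' d'd; have [C2 [C20 H2]] := f2 n d' d'd.
exists (C1 + C2); split; first exact: addr_ge0.
move=> p Bp Vp; rewrite mulrDl; apply: le_trans (ler_normD _ _) _.
by apply: lerD; [exact: H1|exact: H2].
Qed.

Lemma smooth_flatM d (g : 'rV[R]_2 -> R) r : smooth (box d) g -> smooth_flat d r ->
  smooth_flat d (fun p => g p * r p).
Proof.
move=> sg [s1 f1]; split; first by apply: smoothM => //; exact: open_box.
move=> n d' d'd; have [C1 [C10 H1]] := f1 n d' d'd; have [K [K0 HK]] := smooth_bounded d'd sg.
exists (K * C1); split; first exact: mulr_ge0.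
by move=> p Bp Vp; rewrite normrM -mulrA; apply: ler_pM => //; [exact: HK|exact: H1].
Qed.

Definition flip p := pt (p 0 t_) (- p 0 th_).

Lemma smooth_flat_flip d r : smooth_flat d r -> smooth_flat d (fun p => r (flip p)).
Proof.
move=> [s1 f1]; split.
  apply: (smooth_comp (U' := box d)) => //; first exact: open_box.
    by move=> p [h1 h2]; apply: box_pt; rewrite ?normrN.
  have oB := @open_box d.
  by apply: smooth_pt => //; [exact: smooth_coord|apply: smoothN => //; exact: smooth_coord].
move=> n d' d'd; have [C1 [C10 H1]] := f1 n d' d'd; exists C1; split=> // p [h1 h2] V0.
have := H1 (flip p); rewrite /flip pt_th oppr_eq0 normrN; apply => //.
by apply: box_pt; rewrite ?normrN.
Qed.

Lemma is_derive1X (u : R -> R) y du m : is_derive y (1 : R) u du ->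
  is_derive y (1 : R) (fun z => u z ^+ m) (m%:R * u y ^+ m.-1 * du).
Proof.
move=> D; have := is_deriveX m D.
have -> : (u ^+ m : R -> R) = (fun z => u z ^+ m) by apply/funext => z; rewrite fctE.
by [].
Qed.

Lemma is_derive1V (u : R -> R) y du : u y != 0 -> is_derive y (1 : R) u du ->
  is_derive y (1 : R) (fun z => (u z)^-1) (- (u y) ^- 2 * du).
Proof.
move=> n0 [Dx Ex]; split; first exact: derivableV n0 Dx.
by rewrite (deriveV n0 Dx) Ex.
Qed.

(** For a flat even or odd function this is the function of y^2 that it defines, divided by a power
    of y, and extended by 0 to y <= 0. *)
Definition sqrt_quot r m (p : 'rV[R]_2) : R :=
  if 0 < p 0 th_ then r (pt (p 0 t_) (Num.sqrt (p 0 th_))) / Num.sqrt (p 0 th_) ^+ m else 0.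

Lemma sqrt_lt (y d : R) : 0 < d -> `|y| < d ^+ 2 -> `|Num.sqrt y| < d.
Proof.
move=> d0 hy; rewrite ger0_norm ?sqrtr_ge0 //.
rewrite -(ger0_norm (ltW d0)) -sqrtr_sqr ltr_sqrt ?exprn_gt0 //.
exact: le_lt_trans (ler_norm _) hy.
Qed.

Lemma sqrt_quot_le d r m n d' : 0 < d -> smooth_flat d r -> 0 < d' -> d' < d ->
  exists C, 0 <= C /\ forall x y, `|x| < d' -> 0 < y -> `|y| < d' ^+ 2 ->
  `|sqrt_quot r m (pt x y)| <= C * Num.sqrt y ^+ n.
Proof.
move=> d0 [_ fr] d'0 d'd; have [C [C0 H]] := fr (m + n)%N _ d'd; exists C; split => // x y hx y0 hy.
rewrite /sqrt_quot pt_t pt_th y0.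
have s0 : 0 < Num.sqrt y by rewrite sqrtr_gt0.
rewrite normrM normfV normrX (gtr0_norm s0) ler_pdivrMr ?exprn_gt0 //.
have := H (pt x (Num.sqrt y)); rewrite pt_th (gtr0_norm s0) exprD mulrA mulrAC; apply.
  by apply: box_pt => //; exact: sqrt_lt.
by rewrite gt_eqF.
Qed.

(** Quotients of flat functions by arbitrary powers of sqrt y are stable under differentiation and
    locally bounded, flatness outweighing the denominator; [class_smooth] does the rest. *)
Lemma sqrt_quot_smooth d r m : 0 < d <= 1 -> smooth_flat d r ->
  smooth (box2 d (d ^+ 2)) (sqrt_quot r m).
Proof.
move=> /andP[d0 d1] FL.
pose C f := exists r m, smooth_flat d r /\ f = sqrt_quot r m.
apply: (@class_smooth _ _ C); [exact: open_box2| | |by exists r, m].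
- move=> _ [{}r [{}m [{}FL ->]]] p [h1 h2].
  have [d' [d'0 d'd g1 g2]] : exists d', [/\ 0 < d', d' < d, `|p 0 t_| < d' & `|p 0 th_| < d' ^+ 2].
    pose s := Num.sqrt `|p 0 th_|.
    have sd : s < d by have := sqrt_lt d0 (y := `|p 0 th_|); rewrite normr_id => /(_ h2); rewrite ger0_norm ?sqrtr_ge0.
    have s0 : 0 <= s by exact: sqrtr_ge0.
    pose t := Num.max `|p 0 t_| s.
    have td : t < d by rewrite gt_max h1.
    have t0 : 0 <= t by rewrite le_max normr_ge0.
    exists ((t + d) / 2); split; [lra|lra| |].
      have : `|p 0 t_| <= t by rewrite le_max lexx.
      by move=> A1; clear -td A1; lra.
    rewrite -(sqr_sqrtr (normr_ge0 (p 0 th_))) -/s ltrXn2r // ?nnegrE //; try lra.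
    have : s <= t by rewrite le_max lexx orbT.
    by move=> A1; clear -td A1; lra.
  have [K [K0 HK]] := sqrt_quot_le m 0 d0 FL d'0 d'd.
  exists K; apply: (@filterS2 _ (nbhs p) (nbhs_filter p) _ _ _ _ (near_coord_lt g1) (near_coord_lt g2)) => q q1 q2.
  have [y0|y0] := ltP 0 (q 0 th_); last by rewrite /sqrt_quot ltNge y0 normr0.
  by have := HK _ _ q1 y0 q2; rewrite ptK expr0 mulr1.
move=> _ [{}r [{}m [{}FL ->]]].
have [sr fr] := FL.
have oB := @open_box d.
have FLt := smooth_flat_derive t_ d1 FL.
have FLth := smooth_flat_derive th_ d1 FL.
(* With s = sqrt y, the y-derivative of r(x, s) / s^m is (s r_th - m r) / (2 s^(m+2)), so [r'] goes
   with the exponent m + 2. *)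
pose r' := fun p => 2^-1 * (p 0 th_ * 'D_(e_th R) r p + (- m%:R) * r p).
have FL' : smooth_flat d r'.
  apply: (smooth_flatM (g := fun=> 2^-1)); first exact: smooth_cst.
  apply: smooth_flatD; first by apply: smooth_flatM => //; exact: smooth_coord.
  by apply: (smooth_flatM (g := fun=> - m%:R)) => //; exact: smooth_cst.
exists (sqrt_quot (fun p => 'D_(e_t R) r p) m), (sqrt_quot r' m.+2); split.
- by exists (fun p => 'D_(e_t R) r p), m; split.
- by exists r', m.+2.
move=> p [h1 h2]; rewrite -(ptK p); set x := p 0 t_ in h1 *; set y := p 0 th_ in h2 *.
split.
  apply/(is_derive_tP (sqrt_quot r m) x y).
  have -> : (fun x => sqrt_quot r m (pt x y)) = (fun x => if 0 < y then r (pt x (Num.sqrt y)) / Num.sqrt y ^+ m else 0).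
    by apply/funext => z; rewrite /sqrt_quot pt_t pt_th.
  rewrite /sqrt_quot pt_t pt_th; case: ifP => y0; last exact: is_derive_cst.
  have D : is_derive x (1 : R) (fun x => r (pt x (Num.sqrt y))) ('D_(e_t R) r (pt x (Num.sqrt y))).
    apply/is_derive_tP/derivableP/(smooth_derivable sr).
    by apply: box_pt => //; exact: sqrt_lt.
  have := is_deriveM D (is_derive_cst (Num.sqrt y ^- m) x 1).
  by move=> H; apply: (@is_derive_eq _ _ _ _ _ _ _ _ H); rewrite /GRing.scale /= mulr0 add0r mulrC.
apply/(is_derive_thP (sqrt_quot r m) x y).
have E : (fun y => sqrt_quot r m (pt x y)) = (fun y => if 0 < y then r (pt x (Num.sqrt y)) / Num.sqrt y ^+ m else 0).
  by apply/funext => z; rewrite /sqrt_quot pt_t pt_th.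
rewrite [sqrt_quot r' m.+2 _]/sqrt_quot pt_t pt_th.
have [y0|y0|y0] := ltgtP 0 y.
- have near0 : \forall z \near y, 0 < z by exact: lt_nbhsr.
  rewrite E; apply: (@near_is_derive1 _ (fun y => r (pt x (Num.sqrt y)) * (Num.sqrt y ^+ m)^-1)).
    by move: near0; apply: filterS => z ->.
  have s0 : 0 < Num.sqrt y by rewrite sqrtr_gt0.
  have ds := is_derive1_sqrt y0.
  have D : is_derive (Num.sqrt y) (1 : R) (fun z => r (pt x z)) ('D_(e_th R) r (pt x (Num.sqrt y))).
    apply/is_derive_thP/derivableP/(smooth_derivable sr).
    by apply: box_pt => //; exact: sqrt_lt.
  have D1 := @is_derive1_comp _ (fun z => r (pt x z)) Num.sqrt y _ _ D ds.
  have D2 := is_derive1X m ds.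
  have n0 : Num.sqrt y ^+ m != 0 by rewrite expf_neq0 // gt_eqF.
  have D3 := @is_derive1V (fun z => Num.sqrt z ^+ m) y _ n0 D2.
  apply: (@is_derive_eq _ _ _ _ _ _ _ _ (is_deriveM D1 D3)).
  rewrite /r' pt_th /GRing.scale /=.
  have s1 : Num.sqrt y != 0 by rewrite gt_eqF.
  clear -s1; case: m => [|m]; first by rewrite /= !expr0; field.
  by rewrite /= !exprS; field; rewrite expf_neq0.
- have near0 : \forall z \near y, z < 0 by exact: lt_nbhsl.
  rewrite E; apply: (@near_is_derive1 _ (cst (0 : R))).
  by move: near0; apply: filterS => z z0; rewrite ltNge (ltW z0).
rewrite -y0 in h2 *.
have [d' /andP[xd' d'd]] : exists d', `|x| < d' < d.
  by exists ((`|x| + d) / 2); apply/andP; split; lra.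
have d'0 : 0 < d' by exact: le_lt_trans xd'.
(* Order 4 in sqrt h is h^2, so the difference quotient at 0 is O(h). *)
have [K [K0 HK]] := sqrt_quot_le m 4 d0 FL d'0 d'd.
have L : (fun h : R => h^-1 *: (((fun y => sqrt_quot r m (pt x y)) \o shift 0) (h *: 1) - sqrt_quot r m (pt x 0))) @ 0^' --> (0 : R).
  apply/cvgrPdist_le => e e0; near=> h.
  rewrite sub0r normrN /= addr0 [h *: 1]mulr1 {2}/sqrt_quot pt_th ltxx subr0.
  have [h0|h0] := ltP 0 h; last by rewrite /sqrt_quot pt_th ltNge h0 /= scaler0 normr0 ltW.
  have hd : `|h| < d' ^+ 2 by near: h; apply: dnbhs0_lt; rewrite exprn_gt0.
  rewrite normrM normfV (gtr0_norm h0) ler_pdivrMl //.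
  apply: le_trans (HK _ _ xd' h0 hd) _.
  have -> : Num.sqrt h ^+ 4 = h * h by rewrite (exprM _ 2 2) sqr_sqrtr ?ltW.
  have hC : h * (K + 1) <= e.
    rewrite -ler_pdivlMr ?ltr_wpDl //; apply: (le_trans (ler_norm _)).
    by near: h; apply: dnbhs0_le; rewrite divr_gt0 // ltr_wpDl.
  by rewrite mulrCA ler_pM2l //; clear -hC h0 K0; nra.
by split; [apply/cvg_ex; eexists; exact: L|exact: cvg_lim L].
Unshelve. all: by end_near. Qed.

End Flat.

(** * Even and odd parts as functions of the square *)

Section Malgrange.
Variable R : realType.
Implicit Types (f r : 'rV[R]_2 -> R) (p q : 'rV[R]_2).

Definition Dt i f := iter i (fun g p => 'D_(e_t R) g p) f.
Definition Dth j f := iter j (fun g p => 'D_(e_th R) g p) f.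

Lemma smooth_Dt U i f : smooth U f -> smooth U (Dt i f).
Proof. by move=> sf; elim: i => // i IH; exact: smooth_derive. Qed.
Lemma smooth_Dth U i f : smooth U f -> smooth U (Dth i f).
Proof. by move=> sf; elim: i => // i IH; exact: smooth_derive. Qed.

Definition taylor_coef f j (x : R) := Dth j f (pt x 0) / j`!%:R.

(** The remainder vanishes at y = 0 and its y-derivative is the remainder of order n of the
    y-derivative of [f]; the mean value theorem gains one power of |y|. *)
Lemma taylor_th d f n d' : d' < d -> smooth (box d) f -> exists C, 0 <= C /\ forall x y,
  `|x| < d' -> `|y| < d' ->
  `|f (pt x y) - \sum_(j < n) taylor_coef f j x * y ^+ j| <= C * `|y| ^+ n.
Proof.
move=> d'd; elim: n f => [|n IH] f sf.
  have [K [K0 HK]] := smooth_bounded d'd sf.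
  exists K; split => // x y hx hy.
  by rewrite big_ord0 subr0 expr0 mulr1; apply: HK; exact: box_pt.
have [C [C0 HC]] := IH _ (smooth_derive (e_th R) sf); exists C; split => // x y hx hy.
pose u z := f (pt x z) - \sum_(j < n.+1) taylor_coef f j x * z ^+ j.
pose du z := 'D_(e_th R) f (pt x z) - \sum_(j < n) taylor_coef (fun p => 'D_(e_th R) f p) j x * z ^+ j.
have z0 : `|(0 : R) - 0| < d' by rewrite subr0 normr0; apply: le_lt_trans hx.
have Du z : `|z - 0| < d' -> is_derive z (1 : R) u (du z).
  rewrite subr0 => hz; rewrite /u /du.
  have D1 : is_derive z (1 : R) (fun z => f (pt x z)) ('D_(e_th R) f (pt x z)).
    apply/is_derive_thP/derivableP/(smooth_derivable sf).
    by apply: box_pt; exact: lt_trans d'd.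
  have D2 : is_derive z (1 : R) (fun z => \sum_(j < n.+1) taylor_coef f j x * z ^+ j)
     (\sum_(j < n) taylor_coef (fun p => 'D_(e_th R) f p) j x * z ^+ j).
    have Dj (j : 'I_n.+1) : is_derive z (1 : R) (fun z => taylor_coef f j x * z ^+ j)
       (taylor_coef f j x * (j%:R * z ^+ j.-1)).
      have := is_deriveZ (taylor_coef f j x) (is_derive1X j (is_derive_id z (1 : R))).
      by move=> H; apply: (@is_derive_eq _ _ _ _ _ _ _ _ H); rewrite mulr1.
    have := is_derive_sum Dj; rewrite fct_sumE => H; apply: (@is_derive_eq _ _ _ _ _ _ _ _ H).
    rewrite big_ord_recl /= mul0r mulr0 add0r; apply: eq_bigr => j _.
    rewrite /taylor_coef /bump /= add1n /= mulrA; congr (_ * _).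
    rewrite /Dth -iterSr iterS factS natrM.
    have n1 : j.+1%:R != 0 :> R by rewrite pnatr_eq0.
    have n2 : j`!%:R != 0 :> R by rewrite pnatr_eq0 -lt0n fact_gt0.
    move: (j.+1%:R : R) (j`!%:R : R) n1 n2 => u0 v0 n1 n2.
    by field; rewrite n1 n2.
  exact: (is_deriveB D1 D2).
have hy0 : `|y - 0| < d' by rewrite subr0.
have [c [Jc ch E]] := MVT_ball Du z0 hy0.
have u0 : u 0 = 0.
  rewrite /u big_ord_recl /= expr0 mulr1 /taylor_coef /= fact0 divr1 big1 ?addr0 ?subrr // => j _.
  by rewrite /bump /= add1n exprS mul0r mulr0.
move: E; rewrite u0 !subr0 -/(u y) => ->.
rewrite !subr0 in Jc ch; rewrite normrM exprSr mulrA ler_wpM2r //.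
apply: (le_trans (HC x c hx Jc)); rewrite ler_wpM2l //.
by rewrite lerXn2r ?nnegrE.
Qed.

Lemma taylor_coefP d f i j x : smooth (box d) f -> `|x| < d ->
  is_derive x (1 : R) (fun x => Dt i (Dth j f) (pt x 0)) (Dt i.+1 (Dth j f) (pt x 0)).
Proof.
move=> sf hx; apply/is_derive_tP/derivableP.
apply: (smooth_derivable (smooth_Dt i (smooth_Dth j sf))).
by apply: box_pt => //; rewrite normr0; exact: le_lt_trans hx.
Qed.

Lemma big_even_odd n (a : nat -> R) (y : R) :
  \sum_(j < n.*2.+2) a j * y ^+ j = a 0%N + a 1%N * y +
   y ^+ 2 * \sum_(j < n) a j.*2.+2 * (y ^+ 2) ^+ j +
   y ^+ 3 * \sum_(j < n) a j.*2.+3 * (y ^+ 2) ^+ j.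
Proof.
elim: n => [|n IH]; first by rewrite !big_ord_recr !big_ord0 /= !mulr0 expr0 mulr1 expr1 add0r !addr0.
rewrite doubleS big_ord_recr big_ord_recr /= IH !big_ord_recr /=.
have -> : y ^+ n.*2.+2 = y ^+ 2 * (y ^+ 2) ^+ n by rewrite -exprM -exprD add2n mul2n.
have -> : y ^+ n.*2.+3 = y ^+ 3 * (y ^+ 2) ^+ n by rewrite -exprM -exprD add3n mul2n.
by ring.
Qed.

Lemma box2_sub a b a' b' : a <= a' -> b <= b' -> box2 a b `<=` @box2 R a' b'.
Proof. by move=> h h' p [h1 h2]; split; [exact: lt_le_trans h|exact: lt_le_trans h']. Qed.

Lemma smooth_ax d (U : set 'rV[R]_2) (a : 'rV[R]_2 -> R) f :
  open U -> smooth (box d) f -> smooth U a -> (forall p, U p -> `|a p| < d /\ `|p 0 t_| < d) ->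
  smooth U (fun p => f (pt (p 0 t_) (a p))).
Proof.
move=> oU sf sa H; apply: (smooth_comp (U' := box d)) => //.
  by move=> p /H [h1 h2]; exact: box_pt.
by apply: smooth_pt => //; exact: smooth_coord.
Qed.

(** Borel's lemma provides candidates for [A] and [B] with the right Taylor coefficients in y. The
    error is flat along y = 0, and its even and odd halves, divided by y^2 and y^3, are smooth
    functions of y^2. The constant and linear terms stay apart because the kernel condition will
    kill the linear one. *)
Theorem malgrange2 d0 f : 0 < d0 -> smooth (box d0) f ->
  exists d (A B : 'rV[R]_2 -> R), [/\ [/\ 0 < d, d <= 1 & d <= d0], smooth (box d) A, smooth (box d) B &
   forall x y, `|x| < d -> `|y| < d ->
     f (pt x y) = f (pt x 0) + 'D_(e_th R) f (pt x 0) * y +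
       y ^+ 2 * (A (pt x (y ^+ 2)) + y * B (pt x (y ^+ 2)))].
Proof.
move=> d00 sf0; pose d1 := Num.min d0 1.
have d10 : 0 < d1 by rewrite lt_min d00 ltr01.
have d11 : d1 <= 1 by rewrite ge_min lexx orbT.
have sf : smooth (box d1) f by apply: smooth_sub sf0; apply: box_sub; rewrite ge_min lexx.
pose d2 := d1 / 2.
have d20 : 0 < d2 by rewrite divr_gt0.
have d21 : d2 < d1 by rewrite /d2; lra.
(* The i-th x-derivative of the coefficient of y^(2j+k): k = 2 collects the even coefficients for
   [A], k = 3 the odd ones for [B]. *)
pose c k j i x := (j.*2 + k)%N`!%:R^-1 * Dt i (Dth (j.*2 + k) f) (pt x 0).
have cP k j i x : `|x| < d1 -> is_derive x (1 : R) (c k j i) (c k j i.+1 x).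
  move=> hx; have D := taylor_coefP i (j.*2 + k)%N sf hx.
  exact: (is_deriveZ ((j.*2 + k)%N`!%:R^-1) D).
have [SA [sA HA]] := borel d20 d21 (cP 2%N).
have [SB [sB HB]] := borel d20 d21 (cP 3%N).
have y2 (y : R) : `|y| < d2 -> `|y ^+ 2| < d2 ^+ 2.
  by move=> hy; rewrite normrX ltrXn2r ?nnegrE // ltW.
have d2le1 : d2 <= 1 by rewrite ltW // (lt_le_trans d21).
have d2sq : d2 ^+ 2 <= d2 by rewrite -[leRHS]expr1 ler_wiXn2l // ltW.
pose r p := f p - f (pt (p 0 t_) 0) - 'D_(e_th R) f (pt (p 0 t_) 0) * p 0 th_
   - p 0 th_ ^+ 2 * (SA (pt (p 0 t_) (p 0 th_ ^+ 2)) + p 0 th_ * SB (pt (p 0 t_) (p 0 th_ ^+ 2))).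
have oB := @open_box R d2.
have sth : smooth (box d2) (fun p : 'rV[R]_2 => p 0 th_ : R) by exact: smooth_coord.
have sf2 : smooth (box d2) f by apply: smooth_sub sf; apply: box_sub; exact: ltW.
have s0 : smooth (box d2) (fun=> 0 : R) by exact: smooth_cst.
have c0 p : box d2 p -> `|0 : R| < d2 /\ `|p 0 t_| < d2 by move=> [h _]; rewrite normr0.
have cth p : box d2 p -> `|p 0 th_ ^+ 2| < d2 /\ `|p 0 t_| < d2.
  by move=> [h1 h2]; split => //; apply: lt_le_trans d2sq; exact: y2.
have sSA : smooth (box d2) (fun p => SA (pt (p 0 t_) (p 0 th_ ^+ 2))).
  apply: (@smooth_ax d2) => //; first by apply: smooth_sub sA => p [].
  exact: smoothX.
have sSB : smooth (box d2) (fun p => SB (pt (p 0 t_) (p 0 th_ ^+ 2))).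
  apply: (@smooth_ax d2) => //; first by apply: smooth_sub sB => p [].
  exact: smoothX.
have sr : smooth (box d2) r.
  apply: smoothB => //; first apply: smoothB => //; first apply: smoothB => //.
  - exact: (@smooth_ax d2).
  - apply: smoothM => //; apply: (@smooth_ax d2 _ (fun=> 0) (fun p => 'D_(e_th R) f p)) => //.
    exact: smooth_derive.
  - by apply: smoothM => //; [exact: smoothX|apply: smoothD => //; exact: smoothM].
have fr : smooth_flat d2 r.
  split => // n d' d'd.
  have [C1 [C10 H1]] := taylor_th n.*2.+2 (lt_trans d'd d21) sf.
  have [C2 H2] := HA n; have [C3 H3] := HB n.
  exists (C1 + `|C2| + `|C3|); split; first by rewrite !addr_ge0.
  move=> p [hx hy] _; rewrite -(ptK p); set x := p 0 t_ in hx *; set y := p 0 th_ in hy *.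
  rewrite /r !pt_t !pt_th.
  have T0 : taylor_coef f 0 x = f (pt x 0) by rewrite /taylor_coef ?fact0 divr1.
  have T1 : taylor_coef f 1 x = 'D_(e_th R) f (pt x 0) by rewrite /taylor_coef ?fact0 divr1.
  have := H1 x y hx hy; rewrite (big_even_odd n (fun j => taylor_coef f j x)) T0 T1.
  have hx2 : `|x| <= d2 by rewrite ltW // (lt_trans hx).
  have hy1 : `|y| <= 1 by rewrite ltW // (lt_le_trans hy) // (le_trans (ltW d'd)).
  have hy21 : `|y ^+ 2| <= 1 by rewrite normrX exprn_ile1.
  have := H2 x (y ^+ 2) hx2 hy21; have := H3 x (y ^+ 2) hx2 hy21.
  rewrite normrX -exprM mul2n.
  have E2 : \sum_(j < n) c 2%N j 0%N x * (y ^+ 2) ^+ j = \sum_(j < n) taylor_coef f j.*2.+2 x * (y ^+ 2) ^+ j.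
    by apply: eq_bigr => j _; rewrite /c /taylor_coef addn2 [_^-1 * _]mulrC.
  have E3 : \sum_(j < n) c 3%N j 0%N x * (y ^+ 2) ^+ j = \sum_(j < n) taylor_coef f j.*2.+3 x * (y ^+ 2) ^+ j.
    by apply: eq_bigr => j _; rewrite /c /taylor_coef addn3 [_^-1 * _]mulrC.
  rewrite E2 E3; clear E2 E3.
  move: (\sum_(j < n) taylor_coef f j.*2.+2 x * (y ^+ 2) ^+ j) => S2.
  move: (\sum_(j < n) taylor_coef f j.*2.+3 x * (y ^+ 2) ^+ j) => S3.
  move: (SA _) (SB _) (f (pt x y)) (f (pt x 0)) ('D_(e_th R) f (pt x 0)) => a b u v w h3 h2 h1.
  have -> : u - v - w * y - y ^+ 2 * (a + y * b) =
    (u - (v + w * y + y ^+ 2 * S2 + y ^+ 3 * S3)) - y ^+ 2 * (a - S2) - y ^+ 3 * (b - S3) by ring.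
  have Yn m : (n <= m)%N -> `|y| ^+ m <= `|y| ^+ n by move=> nm; exact: ler_wiXn2l.
  have n2 : (n <= n.*2)%N by rewrite -addnn leq_addr.
  have sm m z C : `|z| <= C * `|y| ^+ n.*2 -> `|y ^+ m * z| <= `|C| * `|y| ^+ n.
    move=> hz; rewrite normrM normrX.
    have hz' : `|z| <= `|C| * `|y| ^+ n.
      apply: le_trans hz _; apply: (@le_trans _ _ (`|C| * `|y| ^+ n.*2)).
        by rewrite ler_wpM2r ?exprn_ge0 // ler_norm.
      by rewrite ler_wpM2l // Yn.
    by rewrite -[leRHS]mul1r; apply: ler_pM => //; rewrite exprn_ile1.
  rewrite !mulrDl; apply: le_trans (ler_normB _ _) _; apply: lerD; last exact: sm.
  apply: le_trans (ler_normB _ _) _; apply: lerD; last exact: sm.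
  by apply: le_trans h1 _; rewrite ler_wpM2l // Yn // (leq_trans n2) // -addn2 leq_addr.
(* The halves [rp] and [rm] are even and odd in y, so their values at |y| determine those at y. *)
pose rp p := 2^-1 * (r p + r (flip p)).
pose rm p := 2^-1 * (r p + (-1) * r (flip p)).
have s2 : smooth (box d2) (fun=> 2^-1 : R) by exact: smooth_cst.
have frp : smooth_flat d2 rp.
  by apply: smooth_flatM => //; apply: smooth_flatD => //; exact: (smooth_flat_flip fr).
have frm : smooth_flat d2 rm.
  apply: smooth_flatM => //; apply: smooth_flatD => //; apply: (smooth_flatM (g := fun=> -1)).
    exact: smooth_cst.
  exact: (smooth_flat_flip fr).
have d2b : 0 < d2 <= 1 by rewrite d20.
have spA := sqrt_quot_smooth 2 d2b frp.
have spB := sqrt_quot_smooth 3 d2b frm.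
(* The square roots of numbers below [d] stay below [d2]. *)
pose d := d2 ^+ 2.
have dsub : box d `<=` box2 d2 (d2 ^+ 2) by apply: box2_sub.
have osub : open (box d) by exact: open_box.
exists d, (fun p => SA p + sqrt_quot rp 2 p), (fun p => SB p + sqrt_quot rm 3 p); split.
- split; [by rewrite exprn_gt0|exact: le_trans d2sq d2le1|].
  by apply: le_trans d2sq _; apply: le_trans (ltW d21) _; rewrite ge_min lexx.
- apply: smoothD => //; last exact: smooth_sub dsub spA.
  by apply: smooth_sub sA => p [h1 _]; exact: lt_le_trans d2sq.
- apply: smoothD => //; last exact: smooth_sub dsub spB.
  by apply: smooth_sub sB => p [h1 _]; exact: lt_le_trans d2sq.
move=> x y hx hy.
have rE : r (pt x y) = f (pt x y) - f (pt x 0) - 'D_(e_th R) f (pt x 0) * y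
   - y ^+ 2 * (SA (pt x (y ^+ 2)) + y * SB (pt x (y ^+ 2))) by rewrite /r !pt_t !pt_th.
have [->|y0] := eqVneq y 0; first by rewrite mulr0 expr0n /= mul0r !addr0.
have ys : 0 < y ^+ 2 by rewrite lt_def sqrf_eq0 y0 sqr_ge0.
suff : r (pt x y) = y ^+ 2 * (sqrt_quot rp 2 (pt x (y ^+ 2)) + y * sqrt_quot rm 3 (pt x (y ^+ 2))).
  rewrite rE; move: (SA _) (SB _) (sqrt_quot rp _ _) (sqrt_quot rm _ _) => a b u v.
  move=> E; apply/eqP; rewrite -subr_eq0; apply/eqP.
  by rewrite -[RHS](subrr (y ^+ 2 * (u + y * v))) -{1}E; ring.
rewrite /sqrt_quot !pt_t !pt_th ys sqrtr_sqr /rp /rm /flip !pt_t !pt_th.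
have [yp|yn] := leP 0 y.
  by rewrite ger0_norm //; move: (r _) (r _) => u v; field.
by rewrite ltr0_norm // opprK; move: (r _) (r _) => u v; field; rewrite ?oppr_eq0 y0.
Qed.

End Malgrange.

(** * Germs of diffeomorphisms and the prenormal form *)

Section Germs.
Variable R : realType.

Lemma diffeo_germ_intro n (phi psi : 'rV[R]_n -> 'rV[R]_n) (U V : set 'rV[R]_n) x :
  open U -> open V -> U x -> smooth U phi -> smooth V psi ->
  (forall z, U z -> V (phi z) /\ psi (phi z) = z) ->
  (forall z, V z -> U (psi z) /\ phi (psi z) = z) ->
  diffeo_germ phi x (phi x) /\ diffeo_germ psi (phi x) x.
Proof.
move=> oU oV Ux sU sV UV VU; have [Vx Kx] := UV _ Ux; split.
  by exists U, V, psi; split => //; split => //; exact/smooth_onP.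
by exists V, U, phi; split => //; split => //; exact/smooth_onP.
Qed.

Lemma diffeo_germ_comp n (phi psi : 'rV[R]_n -> 'rV[R]_n) x y z :
  diffeo_germ phi x y -> diffeo_germ psi y z -> diffeo_germ (fun p => psi (phi p)) x z.
Proof.
move=> [U1 [V1 [phi' [[oU1 oV1] [U1x xy] [/smooth_onP sU1 /smooth_onP sV1] UV1 VU1]]]].
move=> [U2 [V2 [psi' [[oU2 oV2] [U2y yz] [/smooth_onP sU2 /smooth_onP sV2] UV2 VU2]]]].
have oU : open (U1 `&` phi @^-1` U2) by exact: open_preimage.
have oV : open (V2 `&` psi' @^-1` V1) by exact: open_preimage.
exists (U1 `&` phi @^-1` U2), (V2 `&` psi' @^-1` V1), (fun p => phi' (psi' p)); split.
- by [].
- by rewrite /= xy.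
- split; apply/smooth_onP.
    apply: (smooth_comp_rV (U' := U2)) => //; first by move=> p [].
    by apply: smooth_sub sU1 => p [].
  apply: (smooth_comp_rV (U' := V1)) => //; first by move=> p [].
  by apply: smooth_sub sV2 => p [].
- move=> p [U1p /= U2p]; have [V1p Kp] := UV1 _ U1p; have [V2p Kp2] := UV2 _ U2p.
  by split; [split; rewrite /= ?Kp2|rewrite Kp2].
- move=> p [V2p /= V1p]; have [U2p Kp] := VU2 _ V2p; have [U1p Kp2] := VU1 _ V1p.
  by split; [split; rewrite /= ?Kp2|rewrite Kp2].
Qed.

Lemma is_derive_pt (a b : R -> R) r da db : is_derive r (1 : R) a da -> is_derive r (1 : R) b db ->
  differentiable (fun r => pt (a r) (b r)) r /\ 'D_1 (fun r => pt (a r) (b r)) r = pt da db.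
Proof.
move=> [Da Ea] [Db Eb].
have dif : differentiable (fun r => pt (a r) (b r)) r.
  apply/differentiable_rV; apply: ord2P.
    by have -> : (fun y => pt (a y) (b y) 0 t_ : R) = a; [apply/funext => y; rewrite pt_t|exact/derivable1_diffP].
  by have -> : (fun y => pt (a y) (b y) 0 th_ : R) = b; [apply/funext => y; rewrite pt_th|exact/derivable1_diffP].
split => //; apply: eq_pt; rewrite derive_rV // ?pt_t ?pt_th.
  by have -> : (fun y => pt (a y) (b y) 0 t_ : R) = a; [apply/funext => y; rewrite pt_t|].
by have -> : (fun y => pt (a y) (b y) 0 th_ : R) = b; [apply/funext => y; rewrite pt_th|].
Qed.

Lemma is_derive_curve n (W : normedModType R) (c : R -> 'rV[R]_n) (f : 'rV[R]_n -> W) r :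
  differentiable c r -> differentiable f (c r) ->
  is_derive r (1 : R) (fun r => f (c r)) ('D_('D_1 c r) f (c r)).
Proof.
move=> dc df; have d := differentiable_comp dc df; split; first exact: diff_derivable.
rewrite (deriveE _ d) diff_comp //= -(deriveE _ dc) [RHS]deriveE //.
Qed.

Lemma is_derive_comp2 (a b : R -> R) (f : 'rV[R]_2 -> R) r da db :
  is_derive r (1 : R) a da -> is_derive r (1 : R) b db -> differentiable f (pt (a r) (b r)) ->
  is_derive r (1 : R) (fun r => f (pt (a r) (b r)))
    (da * 'D_(e_t R) f (pt (a r) (b r)) + db * 'D_(e_th R) f (pt (a r) (b r))).
Proof.
move=> Da Db df; have [dc Ec] := is_derive_pt Da Db.
have := is_derive_curve dc df; rewrite Ec => H.
by apply: (@is_derive_eq _ _ _ _ _ _ _ _ H); rewrite derive_lin2 // pt_t pt_th.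
Qed.

Lemma box_of_open (U : set 'rV[R]_2) : open U -> U 0 -> exists2 d, 0 < d & box d `<=` U.
Proof.
move=> oU U0; have : \forall q \near (0 : 'rV[R]_2), U q by exact: near_open U0 _.
move=> /near_ballP[d d0 H]; exists d => // q [h1 h2]; apply: H; apply/ballP.
by rewrite mxE subr0 mxE subr0.
Qed.

Lemma box_of_near (P : 'rV[R]_2 -> Prop) : (\forall q \near (0 : 'rV[R]_2), P q) ->
  exists2 d, 0 < d & forall q, box d q -> P q.
Proof.
move=> /near_ballP[d d0 H]; exists d => // q [h1 h2]; apply: H; apply/ballP.
by rewrite mxE subr0 mxE subr0.
Qed.

Lemma pt00 : pt 0 0 = 0 :> 'rV[R]_2.
Proof. by apply: eq_pt; rewrite ?pt_t ?pt_th mxE. Qed.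

Lemma box00 (d : R) : 0 < d -> box d 0.
Proof. by move=> d0; split; rewrite mxE normr0. Qed.

End Germs.

(** * Coordinates adapted to a kernel direction transversal to the singular curve *)

Section NormalForm.
Variable R : realType.
Implicit Types (p q : 'rV[R]_2).

Lemma derive_along_kernel (U : set 'rV[R]_2) (f T : 'rV[R]_2 -> R) (X : R) (k : R) :
  smooth U f -> U (pt (T (pt X 0)) 0) -> is_derive (0 : R) (1 : R) (fun y => T (pt X y)) (- k) ->
  'D_(e_th R) f (pt (T (pt X 0)) 0) = k * 'D_(e_t R) f (pt (T (pt X 0)) 0) ->
  is_derive (0 : R) (1 : R) (fun y => f (pt (T (pt X y)) y)) 0.
Proof.
move=> sf Uq DT E.
have := is_derive_comp2 DT (is_derive_id 0 (1 : R)) (smooth_diff sf Uq).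
by move=> H; apply: (@is_derive_eq _ _ _ _ _ _ _ _ H); rewrite E; ring.
Qed.

(** The hypothesis on [kap] says that (- kap t, 1) is a kernel direction of (x, y, z) along th = 0;
    the last one says that y has a nonzero quadratic term on curves tangent to it. The final clause
    keeps track of the V-direction, which is again the kernel, so that third-order terms can later
    be evaluated along it. *)
Theorem cuspidal_normal_form (d0 : R) (x y z : 'rV[R]_2 -> R) (kap : R -> R) :
  0 < d0 -> smooth (box d0) x -> smooth (box d0) y -> smooth (box d0) z ->
  x 0 = 0 -> 'D_(e_t R) x 0 != 0 ->
  (forall t, `|t| < d0 -> forall f, f = x \/ f = y \/ f = z ->
      'D_(e_th R) f (pt t 0) = kap t * 'D_(e_t R) f (pt t 0)) ->
  (forall a : R -> R, a 0 = 0 -> is_derive (0 : R) (1 : R) a (- kap 0) ->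
     exists G : R -> R, [/\ {for 0, continuous G}, G 0 != 0 & forall r, y (pt (a r) r) = r ^+ 2 * G r]) ->
  exists d (a b K0 k0 B : 'rV[R]_2 -> R) (sg : R),
  [/\ [/\ 0 < d, sg = 1 \/ sg = -1 & diffeo_germ (fun p => pt (a p) (b p)) 0 0],
      [/\ smooth (box d) a, smooth (box d) b, smooth (box d) K0, smooth (box d) k0 & smooth (box d) B],
      (forall p, box d p -> `|a p| < d0 /\ `|b p| < d0),
      (forall X V, `|X| < d -> `|V| < d -> let q := pt (a (pt X V)) (b (pt X V)) in
         [/\ x q = X, y q = K0 (pt X 0) + sg * V ^+ 2, `|V ^+ 2| < d &
             z q = k0 (pt X (V ^+ 2)) + V ^+ 3 * B (pt X (V ^+ 2))]) &
      (forall X, `|X| < d -> [/\ b (pt X 0) = 0, 'D_(e_th R) b (pt X 0) != 0 &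
         'D_(e_th R) a (pt X 0) = - kap (a (pt X 0)) * 'D_(e_th R) b (pt X 0)])].
Proof.
move=> d00 sx sy sz x0 xt0 ker deg.
have oB0 := @open_box R d0.
have B00 := box00 d00.
pose U1 := box d0 `&` [set q | 'D_(e_t R) x q != 0].
have oU1 : open U1.
  rewrite openE => q [Uq /= nz]; rewrite /interior.
  have cq := smooth_continuous (smooth_derive (e_t R) sx) Uq.
  have nzq : \forall z \near q, 'D_(e_t R) x z != 0.
    have e0 : 0 < `|'D_(e_t R) x q| by rewrite normr_gt0.
    have /cvgrPdist_lt /(_ _ e0) := cq; apply: filterS => u hu.
    by apply: contraTneq hu => ->; rewrite subr0 ltxx.
  have Uz : \forall z \near q, box d0 z by exact: near_open Uq _.
  by apply: (@filterS2 _ (nbhs q) (nbhs_filter q) _ _ _ _ Uz nzq).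
have sub1 : U1 `<=` box d0 by move=> q [].
have [|A1 [B1 [T [[oA1 oB1 AU1 sT] A10 AB1 BA1]]]] := @implicit_t R U1 x 0 oU1 (smooth_sub sub1 sx) _ xt0.
  by [].
have B10 : B1 0 by have [] := AB1 _ A10; rewrite x0 mxE pt00.
have T0 : T 0 = 0 by have [_] := AB1 _ A10; rewrite x0 !mxE pt00.
have [d1 d10 HB1] := box_of_open oB1 B10.
have oB1' := @open_box R d1.
have sT1 : smooth (box d1) T by exact: smooth_sub HB1 sT.
(* In the coordinates [Q], where [x] is the first coordinate, the kernel along th = 0 is the second
   coordinate direction. Hence y and z lose their linear term there ([kerT]). *)
pose Q p := pt (T p) (p 0 th_).
have QU p : box d1 p -> U1 (Q p) by move=> /HB1/BA1 [/AU1].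
have sQ : smooth (box d1) Q by apply: smooth_pt => //; exact: smooth_coord.
have comp (f : 'rV[R]_2 -> R) : smooth (box d0) f -> smooth (box d1) (fun p => f (Q p)).
  by move=> sf; apply: (smooth_comp oB1' _ sQ sf) => p /QU [].
have d1pt X y' : `|X| < d1 -> `|y'| < d1 -> box d1 (pt X y') by exact: box_pt.
have z1 : `|0 : R| < d1 by rewrite normr0.
have Td X : `|X| < d1 -> is_derive (0 : R) (1 : R) (fun y => T (pt X y)) (- kap (T (pt X 0))).
  move=> hX; have Bp := d1pt _ _ hX z1.
  have [UQ /= nz] := QU _ Bp; rewrite /Q pt_th in UQ nz.
  have dT : is_derive (0 : R) (1 : R) (fun y => T (pt X y)) ('D_(e_th R) T (pt X 0)).
    by apply/is_derive_thP/derivableP/(smooth_derivable sT1).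
  have H := is_derive_comp2 dT (is_derive_id 0 (1 : R)) (smooth_diff sx UQ).
  have H2 : is_derive (0 : R) (1 : R) (fun y => x (pt (T (pt X y)) y)) 0.
    apply: (@near_is_derive1 _ (cst X)).
    have : \forall y \near (0 : R), `|y| < d1.
      by have /cvgrPdist_lt /(_ _ d10) : (id : R -> R) z @[z --> (0 : R)] --> (0 : R);
        [exact: cvg_id|apply: filterS => v; rewrite sub0r normrN].
    apply: filterS => v hv.
    by have [_] := BA1 _ (HB1 _ (d1pt _ _ hX hv)); rewrite !(pt_t, pt_th) => ->.
  have [_ E1] := H; have [_ E2] := H2; move: E1; rewrite E2 mul1r.
  have [h1 h2] := UQ; rewrite pt_t in h1.
  rewrite (ker _ h1 x) ?orbT //; last by left.
  rewrite -mulrDl => /esym/eqP; rewrite mulf_eq0 (negbTE nz) orbF addr_eq0 => /eqP E.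
  by apply: (@is_derive_eq _ _ _ _ _ _ _ _ dT).
have kerT (f : 'rV[R]_2 -> R) X : f = y \/ f = z -> `|X| < d1 -> 'D_(e_th R) (fun p => f (Q p)) (pt X 0) = 0.
  move=> fyz hX; have Bp := d1pt _ _ hX z1.
  have [UQ _] := QU _ Bp; rewrite /Q pt_th in UQ.
  have sf : smooth (box d0) f by case: fyz => ->.
  have [h1 _] := UQ; rewrite pt_t in h1.
  have D := derive_along_kernel sf UQ (Td _ hX) (ker _ h1 f (or_intror fyz)).
  have : is_derive (pt X 0) (e_th R) (fun p => f (Q p)) 0.
    apply/is_derive_thP; rewrite /Q.
    by have -> : (fun y => f (pt (T (pt X y)) (pt X y 0 th_))) = (fun y => f (pt (T (pt X y)) y));
      [apply/funext => v; rewrite pt_th|].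
  by case.
have [d2 [A [B [[d20 d21 d2d1] sA sB Hy]]]] := malgrange2 d10 (comp _ sy).
have oB2 := @open_box R d2.
pose qf p := A (pt (p 0 t_) (p 0 th_ ^+ 2)) + p 0 th_ * B (pt (p 0 t_) (p 0 th_ ^+ 2)).
have sq2 (v dd : R) : dd <= 1 -> `|v| < dd -> `|v ^+ 2| < dd.
  move=> dd1 hv; rewrite normrX; apply: (le_lt_trans _ hv).
  by rewrite -[leRHS]expr1 ler_wiXn2l // ltW // (lt_le_trans hv).
have sth d : smooth (box d) (fun p : 'rV[R]_2 => p 0 th_ : R) by exact: smooth_coord.
have sqf : smooth (box d2) qf.
  have H (f : 'rV[R]_2 -> R) : smooth (box d2) f -> smooth (box d2) (fun p => f (pt (p 0 t_) (p 0 th_ ^+ 2))).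
    move=> sf; apply: (@smooth_ax _ d2) => //; first exact: smoothX.
    by move=> p [h1 h2]; split => //; exact: sq2.
  by apply: smoothD => //; [exact: H|apply: smoothM => //; exact: H].
have Hyq X v : `|X| < d2 -> `|v| < d2 -> y (Q (pt X v)) = y (Q (pt X 0)) + v ^+ 2 * qf (pt X v).
  move=> hX hv; rewrite Hy // kerT ?mul0r ?addr0; last 2 first.
  - by left.
  - exact: lt_le_trans d2d1.
  by rewrite /qf !pt_t !pt_th.
have q0 : qf 0 != 0.
  (* The curve x = 0 is tangent to the kernel at the origin and y equals r^2 qf(0, r) on it;
     dividing by r^2 and letting r tend to 0 identifies [qf 0] with [G 0]. *)
  have [||G [cG G0 HG]] := deg (fun r => T (pt 0 r)).
  - by rewrite pt00.
  - by have := Td 0 z1; rewrite pt00 T0.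
  suff -> : qf 0 = G 0 by [].
  have cq : {for 0, continuous (fun r : R => qf (pt 0 r))}.
    have D : is_derive (0 : R) (1 : R) (fun r : R => qf (pt 0 r)) ('D_(e_th R) qf (pt 0 0)).
      by apply/is_derive_thP/derivableP/(smooth_derivable sqf); rewrite pt00; exact: box00.
    exact: is_derive_continuous D.
  have y00 : y (Q (pt 0 0)) = 0.
    by have := HG 0; rewrite expr0n /= mul0r /Q pt_th.
  have E : \forall r \near 0^', qf (pt 0 r) = G r.
    near=> r.
    have r0 : r != 0 by near: r; exact: nbhs_dnbhs_neq.
    have rd : `|r| < d2 by near: r; exact: dnbhs0_lt.
    have z2 : `|0 : R| < d2 by rewrite normr0.
    have := Hyq 0 r z2 rd; rewrite y00 add0r /Q pt_th HG => /mulfI -> //.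
    by rewrite expf_neq0.
  have L1 : qf (pt 0 r) @[r --> 0^'] --> qf 0.
    by rewrite -[X in _ --> qf X]pt00; apply: cvg_within_filter; exact: cq.
  have L2 : G r @[r --> 0^'] --> G 0.
    by apply: cvg_within_filter; exact: cG.
  have L3 : qf (pt 0 r) @[r --> 0^'] --> G 0.
    by apply: cvg_trans L2; apply: near_eq_cvg; near=> r; apply/esym; near: r.
  exact: (cvg_unique _ L1 L3).
pose sg : R := Num.sg (qf 0).
have sgE : sg = 1 \/ sg = -1.
  rewrite /sg; case: (ltgtP (qf 0) 0) => h; [right|left|by rewrite h eqxx in q0].
    by rewrite ltr0_sg.
  by rewrite gtr0_sg.
have sg2 : sg * sg = 1 by case: sgE => ->; ring.
have [d3 [d30 d32 Hq]] : exists d3, [/\ 0 < d3, d3 <= d2 & forall p, box d3 p -> 0 < sg * qf p].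
  have c1 : {for 0, continuous qf} by apply: (smooth_continuous sqf); exact: box00.
  have e0 : 0 < `|qf 0| by rewrite normr_gt0.
  have /cvgrPdist_lt /(_ _ e0) /box_of_near[d3 d30 H] := c1.
  exists (Num.min d3 d2); split; [by rewrite lt_min d30|by rewrite ge_min lexx orbT|].
  move=> p Bp; have /H : box d3 p by apply: box_sub Bp; rewrite ge_min lexx.
  rewrite /sg; case: (ltgtP (qf 0) 0) => h; last by rewrite h eqxx in q0.
    by rewrite ltr0_sg // (ltr0_norm h) ltr_norml => /andP[h1 h2]; clear -h1 h2 h; lra.
  by rewrite gtr0_sg // (gtr0_norm h) ltr_norml => /andP[h1 h2]; clear -h1 h2 h; lra.
have oB3 := @open_box R d3.
(* With this coordinate [sg * V ^+ 2] is exactly the term th^2 * qf of y. *)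
pose Vf p := p 0 th_ * Num.sqrt (sg * qf p).
have ssq : smooth (box d3) (fun p => Num.sqrt (sg * qf p)).
  apply: smooth_sqrt => //; apply: smoothM => //; first exact: smooth_cst.
  by apply: smooth_sub sqf; exact: box_sub.
have sV : smooth (box d3) Vf by exact: smoothM.
have VX X : Vf (pt X 0) = 0 by rewrite /Vf pt_th mul0r.
have Vth : 'D_(e_th R) Vf 0 != 0.
  have D0 : is_derive (0 : R) (1 : R) (fun r : R => Num.sqrt (sg * qf (pt 0 r))) ('D_(e_th R) (fun p => Num.sqrt (sg * qf p)) (pt 0 0)).
    apply/(is_derive_thP (fun p => Num.sqrt (sg * qf p)))/derivableP/(smooth_derivable ssq).
    by rewrite pt00; exact: box00.
  have D1 := is_deriveM (is_derive_id 0 (1 : R)) D0.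
  have : is_derive (pt 0 0) (e_th R) Vf (Num.sqrt (sg * qf 0)).
    apply/is_derive_thP; rewrite /Vf.
    have -> : (fun v => pt 0 v 0 th_ * Num.sqrt (sg * qf (pt 0 v))) = (fun v => v * Num.sqrt (sg * qf (pt 0 v))).
      by apply/funext => v; rewrite pt_th.
    by apply: (@is_derive_eq _ _ _ _ _ _ _ _ D1); rewrite /GRing.scale /= mul0r add0r mulr1 pt00.
  rewrite pt00 => -[_ ->]; rewrite gt_eqF // sqrtr_gt0; apply: Hq; exact: box00.
have [|A3 [B3 [Th [[oA3 oB3' AU3 sTh] A30 AB3 BA3]]]] := @implicit_th R (box d3) Vf 0 oB3 sV _ Vth.
  exact: box00.
have V0 : Vf 0 = 0 by rewrite -pt00 VX.
have B30 : B3 0 by have [] := AB3 _ A30; rewrite V0 mxE pt00.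
have Th0 : Th 0 = 0 by have [_] := AB3 _ A30; rewrite V0 !mxE pt00.
have [d4 d40 HB3] := box_of_open oB3' B30.
have [d5 d50 HA3] := box_of_open oA3 A30.
pose d6 := Num.min d4 d5.
have d60 : 0 < d6 by rewrite lt_min d40.
have d64 : d6 <= d4 by rewrite ge_min lexx.
have d65 : d6 <= d5 by rewrite ge_min lexx orbT.
have oB6 := @open_box R d6.
have sTh6 : smooth (box d6) Th by apply: smooth_sub sTh; apply: subset_trans HB3; exact: box_sub.
pose P p := pt (p 0 t_) (Th p).
have PA p : box d6 p -> A3 (P p) by move=> Bp; have [] := BA3 _ (HB3 _ (box_sub d64 Bp)).
have P3 p : box d6 p -> box d3 (P p) by move=> /PA/AU3.
have P1 p : box d6 p -> box d1 (P p).
  by move=> /P3; apply: box_sub; exact: le_trans d2d1.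
have sP : smooth (box d6) P by apply: smooth_pt => //; exact: smooth_coord.
have z6 : `|0 : R| < d6 by rewrite normr0.
have ThX X : `|X| < d6 -> Th (pt X 0) = 0.
  move=> hX; have z5 : `|0 : R| < d5 by rewrite normr0.
  have [_] := AB3 _ (HA3 _ (box_pt (lt_le_trans hX d65) z5)).
  by rewrite VX pt_t pt_th.
have d6_1 (X : R) : `|X| < d6 -> `|X| < d1.
  by move=> hX; have [h1 _] := P1 _ (box_pt hX z6); move: h1; rewrite /P !pt_t.
have ThD X : `|X| < d6 -> is_derive (0 : R) (1 : R) (fun v => Th (pt X v)) ('D_(e_th R) Th (pt X 0)).
  by move=> hX; apply/is_derive_thP/derivableP/(smooth_derivable sTh6); exact: box_pt.
have sz1 := comp _ sz.
have sz6 : smooth (box d6) (fun p => z (Q (P p))).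
  exact: (smooth_comp oB6 P1 sP sz1).
have [d7 [C [Bf [[d70 d71 d76] sC sBf Hz]]]] := malgrange2 d60 sz6.
have oB7 := @open_box R d7.
have d7_6 (X : R) : `|X| < d7 -> `|X| < d6 by move=> h; exact: lt_le_trans d76.
have kerz X : `|X| < d7 -> 'D_(e_th R) (fun p => z (Q (P p))) (pt X 0) = 0.
  move=> /d7_6 hX.
  have Bz : box d1 (pt X (Th (pt X 0))) by rewrite ThX //; apply: d1pt => //; exact: d6_1.
  have H := is_derive_comp2 (is_derive_cst X 0 (1 : R)) (ThD _ hX) (smooth_diff sz1 Bz).
  have : is_derive (pt X 0) (e_th R) (fun p => z (Q (P p))) 0.
    apply/(is_derive_thP (fun p => z (Q (P p)))); rewrite /P.
    have -> : (fun v => z (Q (pt (pt X v 0 t_) (Th (pt X v))))) = (fun v => z (Q (pt X (Th (pt X v))))).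
      by apply/funext => v; rewrite pt_t.
    apply: (@is_derive_eq _ _ _ _ _ _ _ _ H).
    by rewrite mul0r add0r ThX // kerT ?mulr0 //; [by right|exact: d6_1].
  by case.
pose a p := T (P p).
have sa : smooth (box d7) a.
  apply: (smooth_comp oB7 _ (smooth_sub _ sP) sT1).
    by move=> p Bp; apply: P1; exact: box_sub Bp.
  exact: box_sub.
pose K0 p := y (Q (pt (p 0 t_) 0)).
(* The even part of z, as a function of X and V^2: the value at V = 0 plus V^2 times
   [C (X, V^2)]. *)
pose k0 p := z (Q (P (pt (p 0 t_) 0))) + p 0 th_ * C p.
exists d7, a, Th, K0, k0, Bf, sg; split.
- split => //.
  have G1 : diffeo_germ P 0 0.
    have [] := @diffeo_germ_intro _ 2 (fun p => pt (p 0 t_) (Vf p)) P A3 B3 0 oA3 oB3' A30.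
    + by apply: smooth_pt => //; [exact: smooth_coord|exact: smooth_sub AU3 sV].
    + by apply: smooth_pt => //; exact: smooth_coord.
    + by move=> q /AB3 [h1 h2]; split => //; rewrite /P pt_t h2 ptK.
    + by move=> q /BA3 [h1 h2]; split => //; rewrite /P pt_t h2 ptK.
    by rewrite V0 mxE pt00.
  have G2 : diffeo_germ Q 0 0.
    have [] := @diffeo_germ_intro _ 2 (fun p => pt (x p) (p 0 th_)) Q A1 B1 0 oA1 oB1 A10.
    + by apply: smooth_pt => //; [apply: smooth_sub sx; exact: subset_trans sub1|exact: smooth_coord].
    + by apply: smooth_pt => //; exact: smooth_coord.
    + by move=> q /AB1 [h1 h2]; split => //; rewrite /Q pt_th h2 ptK.
    + by move=> q /BA1 [h1 h2]; split => //; rewrite /Q pt_th h2 ptK.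
    by rewrite x0 mxE pt00.
  have := diffeo_germ_comp G1 G2; rewrite /Q /P.
  by have -> : (fun p => pt (T (pt (p 0 t_) (Th p))) (pt (p 0 t_) (Th p) 0 th_)) = (fun p => pt (a p) (Th p));
    [apply/funext => p; rewrite pt_th|].
- split => //.
  + by apply: smooth_sub sTh6; exact: box_sub.
  + apply: (@smooth_ax _ d1 _ (fun=> 0) (fun p => y (Q p))) => //; [exact: comp|exact: smooth_cst|].
    by move=> p [h1 _]; split => //; exact/d6_1/d7_6.
  + apply: smoothD => //; last exact: smoothM.
    apply: (@smooth_ax _ d6 _ (fun=> 0) (fun p => z (Q (P p)))) => //; first exact: smooth_cst.
    by move=> p [h1 _]; split => //; exact: d7_6.
- move=> p /(box_sub d76) /P1 /QU [[]]; rewrite /Q pt_t pt_th => h1 h2 _.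
  by rewrite /a; split => //; rewrite /P pt_th in h2.
- move=> X V hX hV /=.
  have Bp : box d6 (pt X V) by apply: box_pt; exact: d7_6.
  have EQ : pt (a (pt X V)) (Th (pt X V)) = Q (P (pt X V)) by rewrite /Q /P pt_th.
  have EP : P (pt X V) = pt X (Th (pt X V)) by rewrite /P pt_t.
  have [_ ] := BA3 _ (HB3 _ (box_sub d64 Bp)); rewrite pt_t pt_th => EV.
  have B1P := P1 _ Bp.
  have B3P := P3 _ Bp.
  split.
  + by have [_] := BA1 _ (HB1 _ B1P); rewrite /a /P pt_th !pt_t.
  + have [hX3 hTh3] := B3P; rewrite EP pt_t pt_th in hX3 hTh3.
    rewrite EQ EP Hyq ?(lt_le_trans _ d32) // /K0 pt_t; congr (_ + _).
    have := congr1 (fun v => v ^+ 2) EV.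
    rewrite /= /Vf pt_th exprMn sqr_sqrtr; last by rewrite ltW // Hq // -EP.
    by move=> <-; case: sgE => ->; ring.
  + exact: sq2.
  + rewrite EQ Hz // kerz // mul0r addr0 /k0 pt_t pt_th; ring.
- move=> X hX; have hX6 := d7_6 _ hX; have hX1 := d6_1 _ hX6.
  have TX := ThX _ hX6.
  split => //.
    have Bp := P3 _ (box_pt hX6 z6); rewrite /P pt_t TX in Bp.
    have Bp' : box d3 (pt X (Th (pt X 0))) by rewrite TX.
    have H := is_derive_comp2 (is_derive_cst X 0 (1 : R)) (ThD _ hX6) (smooth_diff sV Bp').
    have H2 : is_derive (0 : R) (1 : R) (fun v => Vf (pt X (Th (pt X v)))) 1.
      apply: (@near_is_derive1 _ id).
      have : \forall v \near (0 : R), `|v| < d6.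
        by have /cvgrPdist_lt /(_ _ d60) : (id : R -> R) z @[z --> (0 : R)] --> (0 : R);
          [exact: cvg_id|apply: filterS => v; rewrite sub0r normrN].
      apply: filterS => v hv.
      by have [_] := BA3 _ (HB3 _ (box_sub d64 (box_pt hX6 hv))); rewrite pt_t pt_th.
    have [_ E1] := H; have [_ E2] := H2; move: E1; rewrite E2 mul0r add0r.
    by move=> E; apply: contra_eq_neq E => ->; rewrite mul0r oner_eq0.
  have TdX : is_derive (Th (pt X 0)) (1 : R) (fun v => T (pt X v)) (- kap (T (pt X 0))).
    by rewrite TX; exact: Td.
  have H := @is_derive1_comp _ (fun v => T (pt X v)) (fun v => Th (pt X v)) 0 _ _ TdX (ThD _ hX6).
  have : is_derive (pt X 0) (e_th R) a (- kap (T (pt X 0)) * 'D_(e_th R) Th (pt X 0)).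
    apply/is_derive_thP; rewrite /a /P.
    by have -> : (fun v => T (pt (pt X v 0 t_) (Th (pt X v)))) = (fun v => T (pt X (Th (pt X v))));
      [apply/funext => v; rewrite pt_t|].
  by case=> _ ->; rewrite /a /P pt_t TX.
Unshelve. all: by end_near. Qed.

End NormalForm.

(** * Dual surfaces in a moving frame *)

Section Vanish.
Variable R : realType.
Implicit Types (f g a : R -> R) (x L : R).

(** An order of vanishing with its leading coefficient, which may be 0. Continuity of the cofactor
    at one point is preserved by sums, products, integration and substitution, and replaces Taylor
    expansions of the frame. *)
Definition vanish f x n L := exists M : R -> R,
  [/\ {for x, continuous M}, M x = L & forall t, f t = (t - x) ^+ n * M t].

Lemma vanish0 f x : {for x, continuous f} -> vanish f x 0 (f x).
Proof. by move=> cf; exists f; split => // t; rewrite expr0 mul1r. Qed.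

Lemma vanish_derive f x L : f x = 0 -> is_derive x (1 : R) f L -> vanish f x 1 L.
Proof.
move=> f0 /is_derive1_caratheodory [M [E cM ML]]; exists M; split=> // t.
by have := E t; rewrite f0 subr0 => ->; rewrite expr1 mulrC.
Qed.

Lemma vanishD f g x n L K : vanish f x n L -> vanish g x n K ->
  vanish (fun t => f t + g t) x n (L + K).
Proof.
move=> [M [cM ML EM]] [N [cN NK EN]]; exists (fun t => M t + N t); split.
- exact: (cvgD cM cN).
- by rewrite ML NK.
- by move=> t; rewrite EM EN mulrDr.
Qed.

Lemma vanishM f g x n m L K : vanish f x n L -> vanish g x m K ->
  vanish (fun t => f t * g t) x (n + m) (L * K).
Proof.
move=> [M [cM ML EM]] [N [cN NK EN]]; exists (fun t => M t * N t); split.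
- exact: (cvgM cM cN).
- by rewrite ML NK.
- by move=> t; rewrite EM EN exprD; ring.
Qed.

Lemma vanishW f x n L : vanish f x n.+1 L -> vanish f x n 0.
Proof.
move=> [M [cM ML EM]]; exists (fun t => (t - x) * M t); split.
- have c1 : {for x, continuous (fun t : R => t - x)}.
    by apply: (@is_derive_continuous _ _ _ 1); have := is_deriveB (is_derive_id x (1 : R)) (is_derive_cst x x (1 : R));
      rewrite subr0.
  exact: (cvgM c1 cM).
- by rewrite subrr mul0r.
- by move=> t; rewrite EM exprSr mulrA.
Qed.

(** The mean value theorem is applied to f minus its expected leading term L (t - x)^(n+1) / (n+1),
    whose derivative is (c - x)^n times the small quantity M c - L. *)
Lemma vanish_int f g x n L : f x = 0 -> (\forall t \near x, is_derive t (1 : R) f (g t)) ->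
  vanish g x n L -> vanish f x n.+1 (L / n.+1%:R).
Proof.
move=> f0 Df [M [cM ML EM]].
pose N t := if t == x then L / n.+1%:R else f t / (t - x) ^+ n.+1.
exists N; split; last 2 first.
- by rewrite /N eqxx.
- move=> t; rewrite /N; case: eqP => [->|/eqP tx]; first by rewrite f0 subrr expr0n mul0r.
  by rewrite mulrC divfK // expf_neq0 // subr_eq0.
apply/(@cvgrPdist_le _ _ _ (nbhs x) (nbhs_filter x)) => e e0.
have [d1 /= d10 H1] := Df.
have /cvgrPdist_le /(_ _ e0) [d2 /= d20 H2] := cM.
pose d := Num.min d1 d2.
have d0 : 0 < d by rewrite lt_min d10.
exists d => // t /=; rewrite distrC => td.
rewrite {1}/N eqxx /N; case: eqP => [|/eqP tx]; first by rewrite subrr normr0 ltW.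
have D c : `|c - x| < d -> is_derive c (1 : R) (fun t => f t - (L / n.+1%:R) * (t - x) ^+ n.+1)
   (g c - L * (c - x) ^+ n).
  rewrite lt_min => /andP[h1 _].
  have D1 : is_derive c (1 : R) f (g c) by apply: H1; rewrite /= distrC.
  have D2 : is_derive c (1 : R) (fun t => t - x) 1.
    by have := is_deriveB (is_derive_id c (1 : R)) (is_derive_cst x c (1 : R)); rewrite subr0.
  have D3 := is_deriveZ (L / n.+1%:R) (is_derive1X n.+1 D2).
  apply: (@is_derive_eq _ _ _ _ _ _ _ _ (is_deriveB D1 D3)).
  rewrite /GRing.scale /= mulr1; congr (_ - _).
  by rewrite mulrA divfK // pnatr_eq0.
have xd : `|x - x| < d by rewrite subrr normr0.
have [c [cd ct]] := MVT_ball D xd td.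
rewrite f0 subrr expr0n mulr0 subr0 subr0 => E.
have tn : (t - x) ^+ n.+1 != 0 by rewrite expf_neq0 // subr_eq0.
have -> : L / n.+1%:R - f t / (t - x) ^+ n.+1 =
   - (f t - L / n.+1%:R * (t - x) ^+ n.+1) / (t - x) ^+ n.+1 .
  have n1 : n.+1%:R != 0 :> R by rewrite pnatr_eq0.
  by move: (n.+1%:R : R) ((t - x) ^+ n.+1) n1 tn => ? ? n1 tn; field; rewrite tn n1.
rewrite E EM.
have -> : (c - x) ^+ n * M c - L * (c - x) ^+ n = (c - x) ^+ n * (M c - L) by ring.
rewrite normrM normrN normfV ler_pdivrMr ?normr_gt0 //.
rewrite !normrM !normrX exprS.
have h2 : `|M c - L| <= e.
  rewrite distrC -ML; apply: H2; rewrite /= distrC.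
  by move: cd; rewrite lt_min => /andP[].
have h3 : `|c - x| ^+ n <= `|t - x| ^+ n by rewrite lerXn2r ?nnegrE.
have -> : e * (`|t - x| * `|t - x| ^+ n) = `|t - x| ^+ n * e * `|t - x| by ring.
by rewrite ler_wpM2r // ler_pM // exprn_ge0.
Qed.

Lemma vanish_comp f a x n L k : vanish f x n L -> a 0 = x -> is_derive (0 : R) (1 : R) a k ->
  vanish (fun r => f (a r)) 0 n (k ^+ n * L).
Proof.
move=> [M [cM ML EM]] a0 Da.
have [A [EA cA Ak]] := (is_derive1_caratheodory a 0 k).1 Da.
exists (fun r => A r ^+ n * M (a r)); split.
- have c1 : {for 0, continuous (fun r => M (a r))}.
    apply: (@continuous_comp _ _ _ a M); first exact: is_derive_continuous Da.
    by rewrite a0.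
  have c2 : {for 0, continuous (fun r => A r ^+ n)}.
    apply: (@continuous_comp _ _ _ A (fun z => z ^+ n)) => //; exact: exprn_continuous.
  exact: (cvgM c2 c1).
- by rewrite Ak a0 ML.
- move=> r; rewrite EM; have := EA r; rewrite a0 subr0 => ->.
  by rewrite exprMn ?subr0; ring.
Qed.

Lemma vanish_eq f x n L K : vanish f x n L -> L = K -> vanish f x n K.
Proof. by move=> + <-. Qed.

End Vanish.

Section Lorentz.
Variable R : realType.
Implicit Types (u v w : 'rV[R]_4).

Lemma lorC u v : lor u v = lor v u.
Proof. by rewrite /lor; ring. Qed.
Lemma lorDl u v w : lor (u + v) w = lor u w + lor v w.
Proof. by rewrite /lor !mxE; ring. Qed.
Lemma lorZl k u v : lor (k *: u) v = k * lor u v.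
Proof. by rewrite /lor !mxE; ring. Qed.
Lemma lorDr u v w : lor u (v + w) = lor u v + lor u w.
Proof. by rewrite ![lor u _]lorC lorDl. Qed.
Lemma lorZr k u v : lor u (k *: v) = k * lor u v.
Proof. by rewrite ![lor u _]lorC lorZl. Qed.
Lemma lorNl u v : lor (- u) v = - lor u v.
Proof. by rewrite -scaleN1r lorZl mulN1r. Qed.
Lemma lorNr u v : lor u (- v) = - lor u v.
Proof. by rewrite ![lor u _]lorC lorNl. Qed.
Lemma lor0l v : lor 0 v = 0.
Proof. by rewrite /lor !mxE; ring. Qed.

Lemma is_derive_row n (c : R -> 'rV[R]_n) t (dc : 'rV[R]_n) j : is_derive t (1 : R) c dc ->
  is_derive t (1 : R) (fun t => c t 0 j) (dc 0 j).
Proof.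
move=> [Dc <-]; split; first by move/derivable_mxP: Dc; exact.
by rewrite derive_mx // mxE.
Qed.

Lemma is_derive_row_intro n (c : R -> 'rV[R]_n) t (dc : 'rV[R]_n) :
  (forall j, is_derive t (1 : R) (fun t => c t 0 j) (dc 0 j)) -> is_derive t (1 : R) c dc.
Proof.
move=> H.
have Dc : derivable c t (1 : R) by apply/derivable_mxP => i j; rewrite (ord1 i); have [] := H j.
by split => //; apply/rowP => j; rewrite derive_mx // mxE; have [_] := H j.
Qed.

Lemma is_derive_lor (c c' : R -> 'rV[R]_4) t dc dc' :
  is_derive t (1 : R) c dc -> is_derive t (1 : R) c' dc' ->
  is_derive t (1 : R) (fun t => lor (c t) (c' t)) (lor dc (c' t) + lor (c t) dc').
Proof.
move=> D D'; rewrite /lor.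
have H j := is_deriveM (is_derive_row j D) (is_derive_row j D').
have H0 := is_deriveN (H 0).
have := is_deriveD (is_deriveD (is_deriveD H0 (H o1)) (H o2)) (H o3).
move=> K; rewrite (_ : (fun t => _) =
  (- ((fun t => c t 0 0) * (fun t => c' t 0 0)) + (fun t => c t 0 o1) * (fun t => c' t 0 o1)
   + (fun t => c t 0 o2) * (fun t => c' t 0 o2) + (fun t => c t 0 o3) * (fun t => c' t 0 o3))).
  by apply: (@is_derive_eq _ _ _ _ _ _ _ _ K); rewrite /GRing.scale /=; ring.
by apply/funext => z; rewrite !fctE mulNr.
Qed.

Lemma is_derive_lorl (c : R -> 'rV[R]_4) t dc v : is_derive t (1 : R) c dc ->
  is_derive t (1 : R) (fun t => lor (c t) v) (lor dc v).
Proof.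
move=> D; have := is_derive_lor D (is_derive_cst v t (1 : R)).
by move=> H; apply: (@is_derive_eq _ _ _ _ _ _ _ _ H); rewrite lorC [X in _ + X]lorC lor0l addr0 lorC.
Qed.

End Lorentz.

Section Frame.
Variable R : realType.

(** Curves over [I] are treated as maps on I x R that ignore the second coordinate, so one
    smoothness calculus serves for curves and surfaces. *)
Definition strip (I : set R) := [set p : 'rV[R]_2 | I (p 0 t_)].

Lemma strip_open (I : set R) : open I -> open (strip I).
Proof.
move=> oI; rewrite openE => p Ip; rewrite /interior.
have cj : {for p, continuous (fun z : 'rV[R]_2 => z 0 t_ : R)}.
  by apply: differentiable_continuous; exact: differentiable_coord.
by apply: cj; have := open_nbhs_nbhs (conj oI Ip).
Qed.

(* [E] is the evolute and [dualF mu nu] its dual surface; [w] is the unit normal completing the frame. *)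
Record dual_frame (I : set R) (mu nu w E : R -> 'rV[R]_4) (D s e : R -> R) : Prop := DualFrame {
  df_open : open I;
  df_mu : smooth (strip I) (fun p => mu (p 0 t_));
  df_nu : smooth (strip I) (fun p => nu (p 0 t_));
  df_sq : forall t, I t -> [/\ lor (mu t) (mu t) = 1, lor (nu t) (nu t) = 1,
     lor (w t) (w t) = 1 & lor (E t) (E t) = -1];
  df_ort : forall t, I t -> [/\ [/\ lor (mu t) (nu t) = 0, lor (mu t) (w t) = 0 & lor (mu t) (E t) = 0],
     lor (nu t) (w t) = 0, lor (nu t) (E t) = 0 & lor (w t) (E t) = 0];
  df_dmu : forall t, I t -> is_derive t (1 : R) mu (- D t *: nu t);
  df_dnu : forall t, I t -> is_derive t (1 : R) nu (D t *: mu t + s t *: w t);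
  df_dw : forall t, I t -> is_derive t (1 : R) w (- s t *: nu t + e t *: E t);
  df_dE : forall t, I t -> is_derive t (1 : R) E (e t *: w t);
  df_pos : forall t, I t -> 0 < D t /\ 0 < s t;
  df_cont : forall t, I t -> [/\ {for t, continuous D}, {for t, continuous s} & {for t, continuous e}]
}.

Variables (I : set R) (mu nu w E : R -> 'rV[R]_4) (D s e : R -> R).
Hypothesis fr : dual_frame I mu nu w E D s e.

Definition dualF (p : 'rV[R]_2) : 'rV[R]_4 :=
  cos (p 0 th_) *: mu (p 0 t_) + sin (p 0 th_) *: nu (p 0 t_).

Lemma open_strip : open (strip I).
Proof. exact: (strip_open (df_open fr)). Qed.

Lemma smooth_dualF : smooth (strip I) dualF.
Proof.
have oS := open_strip; apply/smooth_rV => // j.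
have sth : smooth (strip I) (fun p : 'rV[R]_2 => p 0 th_ : R) by exact: smooth_coord.
have /smooth_rV /(_ j) sm := df_mu fr; have /smooth_rV /(_ j) sn := df_nu fr.
apply: (@smooth_ext _ _ _ _ (fun p => cos (p 0 th_) * mu (p 0 t_) 0 j + sin (p 0 th_) * nu (p 0 t_) 0 j)) => //.
  by move=> p _; rewrite /dualF !mxE.
apply: smoothD => //; apply: smoothM => //; [exact: smooth_cos|exact: sm|exact: smooth_sin|exact: sn].
Qed.

Lemma derive_dualF (p v : 'rV[R]_2) : I (p 0 t_) ->
  'D_v dualF p = v 0 t_ *: (cos (p 0 th_) *: (- D (p 0 t_) *: nu (p 0 t_)) +
        sin (p 0 th_) *: (D (p 0 t_) *: mu (p 0 t_) + s (p 0 t_) *: w (p 0 t_)))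
   + v 0 th_ *: (- sin (p 0 th_) *: mu (p 0 t_) + cos (p 0 th_) *: nu (p 0 t_)).
Proof.
move=> Ip; have df := smooth_diff smooth_dualF Ip.
set x := p 0 t_ in Ip *; set y := p 0 th_.
apply/rowP => j; rewrite derive_rV // derive_lin2; last by move/differentiable_rV: df; exact.
have dm := is_derive_row j (df_dmu fr Ip); have dn := is_derive_row j (df_dnu fr Ip).
have Ht : is_derive (pt x y) (e_t R) (fun q => dualF q 0 j)
    (cos y * (- D x *: nu x) 0 j + sin y * (D x *: mu x + s x *: w x) 0 j).
  apply/(is_derive_tP (fun q => dualF q 0 j)).
  have := is_deriveD (is_deriveZ (cos y) dm) (is_deriveZ (sin y) dn).
  have -> : (fun z => dualF (pt z y) 0 j) = (cos y \*: (fun t => mu t 0 j) \+ sin y \*: (fun t => nu t 0 j)).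
    by apply/funext => z; rewrite /dualF pt_t pt_th !mxE.
  by [].
have Hth : is_derive (pt x y) (e_th R) (fun q => dualF q 0 j) (- sin y * mu x 0 j + cos y * nu x 0 j).
  apply/(is_derive_thP (fun q => dualF q 0 j)).
  have := is_deriveD (is_deriveZ (mu x 0 j) (is_derive_cos y)) (is_deriveZ (nu x 0 j) (is_derive_sin y)).
  have -> : (fun z => dualF (pt x z) 0 j) = (mu x 0 j \*: cos \+ nu x 0 j \*: sin).
    by apply/funext => z; rewrite /dualF pt_t pt_th !mxE /GRing.scale /= mulrC [X in _ + X]mulrC.
  by move=> H; apply: (@is_derive_eq _ _ _ _ _ _ _ _ H); rewrite /GRing.scale /= mulrC [X in _ + X]mulrC.
move: Ht Hth; rewrite ptK => -[_ ->] [_ ->].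
by rewrite !mxE.
Qed.

(** Pairing the equation with [w] isolates s sin(th) v_t. Pairing with [mu] and [nu] gives v_th - D
    v_t multiplied by sin and by cos up to sign, and cos^2 + sin^2 = 1 removes both factors. *)
Lemma kernel_dualF (p v : 'rV[R]_2) : I (p 0 t_) -> 'D_v dualF p = 0 ->
  sin (p 0 th_) * v 0 t_ = 0 /\ v 0 th_ = D (p 0 t_) * v 0 t_.
Proof.
move=> Ip; rewrite derive_dualF //; set x := p 0 t_ in Ip *; set y := p 0 th_.
have [mm nn ww EE] := df_sq fr Ip; have [[mn mw mE] nw nE wE] := df_ort fr Ip.
have [D0 s0] := df_pos fr Ip.
move=> H.
have K (u : 'rV[R]_4) := congr1 (fun z => lor z u) H.
have := K (w x); have := K (nu x); have := K (mu x).
rewrite !lor0l !(lorDl, lorZl) mm nn ww mn mw nw [lor (nu x) (mu x)]lorC mn [lor (w x) _]lorC mw [lor (w x) (nu x)]lorC nw.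
have cs := cos2Dsin2 y.
move: (cos y) (sin y) (v 0 t_) (v 0 th_) cs => c si a b cs E1 E2 E3.
split.
  have : s x * (si * a) = 0 by rewrite -E3; ring.
  by move/eqP; rewrite mulf_eq0 gt_eqF //= => /eqP.
have F1 : si * (D x * a - b) = 0 by rewrite -E1; ring.
have F2 : c * (b - D x * a) = 0 by rewrite -E2; ring.
have : (c ^+ 2 + si ^+ 2) * (b - D x * a) = 0.
  have -> : (c ^+ 2 + si ^+ 2) * (b - D x * a) = c * (c * (b - D x * a)) - si * (si * (D x * a - b)) by ring.
  by rewrite F1 F2 !mulr0 subr0.
by rewrite cs mul1r => /eqP; rewrite subr_eq0 => /eqP.
Qed.

Section Curve.
Variables (t1 th1 k : R) (a b : R -> R).
Hypotheses (It : I t1) (sth : sin th1 = 0) (a0 : a 0 = t1) (b0 : b 0 = th1).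
Hypotheses (Da : is_derive (0 : R) (1 : R) a k) (Db : is_derive (0 : R) (1 : R) b (k * D t1)).

Let nearI : \forall t \near t1, I t := open_nbhs_nbhs (conj (df_open fr) It).

Let Dmu u : \forall t \near t1, is_derive t (1 : R) (fun t => lor (mu t) u) (- D t * lor (nu t) u).
Proof.
apply: filterS nearI => t tI; have := is_derive_lorl u (df_dmu fr tI).
by rewrite lorZl.
Qed.
Let Dnu u : \forall t \near t1, is_derive t (1 : R) (fun t => lor (nu t) u) (D t * lor (mu t) u + s t * lor (w t) u).
Proof.
apply: filterS nearI => t tI; have := is_derive_lorl u (df_dnu fr tI).
by rewrite lorDl !lorZl.
Qed.
Let Dw u : is_derive t1 (1 : R) (fun t => lor (w t) u) (- s t1 * lor (nu t1) u + e t1 * lor (E t1) u).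
Proof. by have := is_derive_lorl u (df_dw fr It); rewrite lorDl !lorZl. Qed.

Let vD : vanish D t1 0 (D t1). Proof. by apply: vanish0; have [] := df_cont fr It. Qed.
Let vND : vanish (fun t => - D t) t1 0 (- D t1).
Proof. by apply: (vanish0 (f := fun t => - D t)); have [cD _ _] := df_cont fr It; exact: cvgN. Qed.
Let vs : vanish s t1 0 (s t1). Proof. by apply: vanish0; have [] := df_cont fr It. Qed.

(** Since sin vanishes at [th1], the factor sin (b r) contributes one order with slope k D cos(th1);
    this is why [nu] is asked for one order less than [mu]. *)
Lemma vanish_dualF u n L M : vanish (fun t => lor (mu t) u) t1 n.+1 L ->
  vanish (fun t => lor (nu t) u) t1 n M ->
  vanish (fun r => lor (dualF (pt (a r) (b r))) u) 0 n.+1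
    (cos th1 * k ^+ n * (k * L + k * D t1 * M)).
Proof.
move=> vm vn.
have H1 := vanish_comp vm a0 Da; have H2 := vanish_comp vn a0 Da.
have cb : vanish (fun r => cos (b r)) 0 0 (cos th1).
  have vc : vanish (@cos R) th1 0 (cos th1) by apply: vanish0; exact: continuous_cos.
  by have := vanish_comp vc b0 Db; rewrite expr0 mul1r.
have sb : vanish (fun r => sin (b r)) 0 1 (k * D t1 * cos th1).
  have vc : vanish (@sin R) th1 1 (cos th1) by apply: vanish_derive => //; exact: is_derive_sin.
  by have := vanish_comp vc b0 Db; rewrite expr1.
have H := vanishD (vanishM cb H1) (vanishM sb H2).
have -> : (fun r => lor (dualF (pt (a r) (b r))) u) =
   (fun r => cos (b r) * lor (mu (a r)) u + sin (b r) * lor (nu (a r)) u).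
  by apply/funext => r; rewrite /dualF pt_t pt_th lorDl !lorZl.
by apply: vanish_eq H _; rewrite exprS; ring.
Qed.

(** Against the fixed vector E(t1) the frame equations give w order 1 with coefficient -e, then nu
    order 2 with -s e / 2, then mu order 3 with D s e / 6. The sum D s e / 6 - D s e / 2 produces
    the factor -1/3. *)
Lemma vanish_dualF_E : vanish (fun r => lor (dualF (pt (a r) (b r))) (E t1)) 0 3
  (- (cos th1 * D t1 * s t1 * k ^+ 3 * e t1 / 3)).
Proof.
have [mm nn ww EE] := df_sq fr It; have [[mn mw mE] nw nE wE] := df_ort fr It.
set u := E t1.
have vq : vanish (fun t => lor (w t) u) t1 1 (- e t1).
  by apply: vanish_derive => //; apply: (@is_derive_eq _ _ _ _ _ _ _ _ (Dw u)); rewrite nE EE; ring.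
have dn1 : is_derive t1 (1 : R) (fun t => lor (nu t) u) 0.
  have := nbhs_singleton (Dnu u) => H; apply: (@is_derive_eq _ _ _ _ _ _ _ _ H).
  by rewrite mE wE; ring.
(* A bootstrap breaks the mutual dependence of mu' and nu': a crude order for nu improves mu, which
   improves nu, which improves mu again. *)
have vn1 : vanish (fun t => lor (nu t) u) t1 1 0 by exact: vanish_derive.
have vm2 := @vanish_int R (fun t => lor (mu t) u) _ t1 _ _ mE (Dmu u) (vanishM vND vn1).
have vn2 := @vanish_int R (fun t => lor (nu t) u) _ t1 _ _ nE (Dnu u) (vanishD (vanishW (vanishM vD vm2)) (vanishM vs vq)).
have vm3 := @vanish_int R (fun t => lor (mu t) u) _ t1 _ _ mE (Dmu u) (vanishM vND vn2).
by apply: vanish_eq (vanish_dualF vm3 vn2) _; field.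
Qed.

(** The nonzero coefficient supplies the quadratic nondegeneracy of the second component, through D
    > 0 and s > 0. *)
Lemma vanish_dualF_w : vanish (fun r => lor (dualF (pt (a r) (b r))) (w t1)) 0 2
  (cos th1 * D t1 * s t1 * k ^+ 2 / 2).
Proof.
have [mm nn ww EE] := df_sq fr It; have [[mn mw mE] nw nE wE] := df_ort fr It.
set u := w t1.
have dn1 : is_derive t1 (1 : R) (fun t => lor (nu t) u) (s t1).
  have := nbhs_singleton (Dnu u) => H; apply: (@is_derive_eq _ _ _ _ _ _ _ _ H).
  by rewrite mw ww; ring.
have vn1 := @vanish_derive R (fun t => lor (nu t) u) _ _ nw dn1.
have vm2 := @vanish_int R (fun t => lor (mu t) u) _ t1 _ _ mw (Dmu u) (vanishM vND vn1).
by apply: vanish_eq (vanish_dualF vm2 vn1) _; field.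
Qed.

End Curve.
End Frame.

(** * Pseudo-orthonormal frames of Minkowski space *)

Section Coordinates4.
Variable R : realType.
Implicit Types (u v : 'rV[R]_4).

Definition row4 (x y z q : R) : 'rV[R]_4 := \row_(j < 4) nth 0 [:: x; y; z; q] j.

Lemma ord4P (P : 'I_4 -> Prop) : P 0 -> P o1 -> P o2 -> P o3 -> forall i, P i.
Proof.
move=> P0 P1 P2 P3 [[|[|[|[|i]]]] Hi] //.
- by have -> : Ordinal Hi = 0 by exact: val_inj.
- by have -> : Ordinal Hi = o1 by exact: val_inj.
- by have -> : Ordinal Hi = o2 by exact: val_inj.
- by have -> : Ordinal Hi = o3 by exact: val_inj.
Qed.

Lemma row4E x y z q : (row4 x y z q 0 0 = x) * (row4 x y z q 0 o1 = y) *
  (row4 x y z q 0 o2 = z) * (row4 x y z q 0 o3 = q).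
Proof. by rewrite !mxE. Qed.

Lemma row4K v : row4 (v 0 0) (v 0 o1) (v 0 o2) (v 0 o3) = v.
Proof. by apply/rowP; apply: ord4P; rewrite row4E. Qed.

Lemma row4_0 : row4 0 0 0 0 = 0.
Proof. by apply/rowP; apply: ord4P; rewrite row4E mxE. Qed.

Lemma smooth_row4 n (U : set 'rV[R]_n) (x y z q : 'rV[R]_n -> R) : open U ->
  smooth U x -> smooth U y -> smooth U z -> smooth U q ->
  smooth U (fun p => row4 (x p) (y p) (z p) (q p)).
Proof.
move=> oU sx sy sz sq; apply/smooth_rV => //; apply: ord4P.
- by apply: smooth_ext sx => // p _; rewrite row4E.
- by apply: smooth_ext sy => // p _; rewrite row4E.
- by apply: smooth_ext sz => // p _; rewrite row4E.
- by apply: smooth_ext sq => // p _; rewrite row4E.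
Qed.

Lemma smooth_lor n (U : set 'rV[R]_n) (c c' : 'rV[R]_n -> 'rV[R]_4) : open U ->
  smooth U c -> smooth U c' -> smooth U (fun p => lor (c p) (c' p)).
Proof.
move=> oU /smooth_rV - /(_ oU) sc /smooth_rV - /(_ oU) sc'.
have H j : smooth U (fun p => c p 0 j * c' p 0 j) by apply: smoothM.
have H0 := smoothN oU (H 0).
have := smoothD oU (smoothD oU (smoothD oU H0 (H o1)) (H o2)) (H o3).
by apply: smooth_ext => // p _; rewrite /lor mulNr.
Qed.

Lemma smooth_id n (U : set 'rV[R]_n) : open U -> smooth U (fun p => p).
Proof. by move=> oU; apply/smooth_rV => // j; exact: smooth_coord. Qed.

Lemma smooth_cst_rV n m (U : set 'rV[R]_n) (u : 'rV[R]_m) : open U -> smooth U (fun=> u).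
Proof. by move=> oU; apply/smooth_rV => // j; exact: smooth_cst. Qed.

Lemma derive_lor n (c : 'rV[R]_n -> 'rV[R]_4) u (p v : 'rV[R]_n) : differentiable c p ->
  'D_v (fun q => lor (c q) u) p = lor ('D_v c p) u.
Proof.
move=> dc; pose L (x : 'rV[R]_4) : R := lor x u.
have linL : linear L by move=> k x y; rewrite /L lorDl lorZl.
pose LM := GRing.isLinear.Build _ _ _ _ _ linL.
pose LL : {linear 'rV[R]_4 -> R} := HB.pack L LM.
have dL x : differentiable L x.
  have := @smooth_lor _ setT (fun p => p) (fun=> u) openT (smooth_id openT) (smooth_cst_rV u openT).
  by move=> H; exact: smooth_diff H I.
have cL : continuous LL by move=> x; apply: differentiable_continuous; exact: dL.
rewrite (deriveE _ (differentiable_comp dc (dL _))) diff_comp //= -(deriveE _ dc).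
by rewrite -[L]/(LL : _ -> _) diff_lin.
Qed.

Section Expand.
Variables (u1 u2 u3 u4 : 'rV[R]_4).
Hypotheses (sq : [/\ lor u1 u1 = 1, lor u2 u2 = 1, lor u3 u3 = 1 & lor u4 u4 = -1])
  (ort : [/\ [/\ lor u1 u2 = 0, lor u1 u3 = 0 & lor u1 u4 = 0], lor u2 u3 = 0, lor u2 u4 = 0 & lor u3 u4 = 0]).

Let N : 'M[R]_4 := rows4 u1 u2 u3 u4.
Let G : 'M[R]_4 := diag_mx (row4 (-1) 1 1 1).

Let sum4 (f : 'I_4 -> R) : \sum_i f i = f 0 + f o1 + f o2 + f o3.
Proof.
rewrite !big_ord_recl big_ord0 addr0 !addrA.
by congr (f _ + f _ + f _ + f _); exact: val_inj.
Qed.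

Let lorE u v : (u *m G *m v^T) 0 0 = lor u v.
Proof.
rewrite mxE sum4 mul_mx_diag !mxE /= /lor; ring.
Qed.

(** The product is the Gram matrix of the frame. Its invertibility passes to each factor, which
    yields independence of the frame and nondegeneracy of pairing with it. *)
Let NGN : N *m G *m N^T = diag_mx (row4 1 1 1 (-1)).
Proof.
have [s1 s2 s3 s4] := sq; have [[a12 a13 a14] a23 a24 a34] := ort.
have H i j : (N *m G *m N^T) i j = lor (row i N) (row j N).
  by rewrite -lorE -row_mul !mxE; apply: eq_bigr => k _; rewrite !mxE.
have r0 : row 0 N = u1 by apply/rowP => k; rewrite !mxE.
have r1 : row o1 N = u2 by apply/rowP => k; rewrite !mxE.
have r2 : row o2 N = u3 by apply/rowP => k; rewrite !mxE.
have r3 : row o3 N = u4 by apply/rowP => k; rewrite !mxE.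
apply/matrixP => i j; rewrite H !mxE; move: i j.
apply: ord4P; apply: ord4P; rewrite ?(r0, r1, r2, r3) ?(s1, s2, s3, s4, a12, a13, a14, a23, a24, a34) //=;
  by rewrite lorC ?(a12, a13, a14, a23, a24, a34).
Qed.

Let Dunit : diag_mx (row4 1 1 1 (-1)) \in unitmx.
Proof.
rewrite unitmxE det_diag !big_ord_recl big_ord0 unitfE !mxE /= !mul1r mulr1.
by rewrite oppr_eq0 oner_eq0.
Qed.

Lemma frame_unit : rows4 u1 u2 u3 u4 \in unitmx.
Proof.
have := Dunit; rewrite -NGN.
by rewrite unitmx_mul unitmx_mul => /andP[/andP[]].
Qed.

Lemma frame_lor0 v : lor v u1 = 0 -> lor v u2 = 0 -> lor v u3 = 0 -> lor v u4 = 0 -> v = 0.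
Proof.
move=> h1 h2 h3 h4.
have E : v *m (G *m N^T) = 0.
  apply/rowP; apply: ord4P; rewrite mulmxA mxE sum4 mul_mx_diag !mxE /=;
  [rewrite -[RHS]h1|rewrite -[RHS]h2|rewrite -[RHS]h3|rewrite -[RHS]h4]; rewrite /lor; ring.
have uGN : G *m N^T \in unitmx.
  have := Dunit; rewrite -NGN -mulmxA unitmx_mul => /andP[_].
  by [].
by rewrite -[v]mulmx1 -(mulmxV uGN) mulmxA E mul0mx.
Qed.

Lemma frame_expand v : v = lor v u1 *: u1 + lor v u2 *: u2 + lor v u3 *: u3 - lor v u4 *: u4.
Proof.
have [s1 s2 s3 s4] := sq; have [[a12 a13 a14] a23 a24 a34] := ort.
apply/eqP; rewrite -subr_eq0; apply/eqP; apply: frame_lor0;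
rewrite !(lorDl, lorNl, lorZl) ?(s1, s2, s3, s4, a12, a13, a14, a23, a24, a34).
- by rewrite ![lor _ u1]lorC a12 a13 a14; rewrite ?s1; ring.
- by rewrite [lor u3 u2]lorC [lor u4 u2]lorC a23 a24; ring.
- by rewrite [lor u4 u3]lorC a34; ring.
- by ring.
Qed.

Lemma frame_lor_self v : lor v v = lor v u1 ^+ 2 + lor v u2 ^+ 2 + lor v u3 ^+ 2 - lor v u4 ^+ 2.
Proof.
rewrite {2}(frame_expand v) !(lorDr, lorNr, lorZr); ring.
Qed.

End Expand.

End Coordinates4.

Section Shift.
Variable R : realType.

Definition shift2 (t0 th0 : R) (p : 'rV[R]_2) := pt (t0 + p 0 t_) (th0 + p 0 th_).

Lemma derive_shift2 (f : 'rV[R]_2 -> R) t0 th0 p : differentiable f (shift2 t0 th0 p) ->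
  'D_(e_t R) (fun q => f (shift2 t0 th0 q)) p = 'D_(e_t R) f (shift2 t0 th0 p) /\
  'D_(e_th R) (fun q => f (shift2 t0 th0 q)) p = 'D_(e_th R) f (shift2 t0 th0 p).
Proof.
move=> df.
have Dc (c x : R) : is_derive x (1 : R) (fun z => c + z) 1.
  by have := is_deriveD (is_derive_cst c x (1 : R)) (is_derive_id x (1 : R)); rewrite add0r.
have H1 := is_derive_comp2 (Dc t0 (p 0 t_)) (is_derive_cst (th0 + p 0 th_) (p 0 t_) (1 : R)) df.
have H2 := is_derive_comp2 (is_derive_cst (t0 + p 0 t_) (p 0 th_) (1 : R)) (Dc th0 (p 0 th_)) df.
split.
  have : is_derive (pt (p 0 t_) (p 0 th_)) (e_t R) (fun q => f (shift2 t0 th0 q)) ('D_(e_t R) f (shift2 t0 th0 p)).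
    apply/(is_derive_tP (fun q => f (shift2 t0 th0 q))).
    have -> : (fun z => f (shift2 t0 th0 (pt z (p 0 th_)))) = (fun z => f (pt (t0 + z) (th0 + p 0 th_))).
      by apply/funext => z; rewrite /shift2 pt_t pt_th.
    by apply: (@is_derive_eq _ _ _ _ _ _ _ _ H1); rewrite mul1r mul0r addr0.
  by rewrite ptK => -[].
have : is_derive (pt (p 0 t_) (p 0 th_)) (e_th R) (fun q => f (shift2 t0 th0 q)) ('D_(e_th R) f (shift2 t0 th0 p)).
  apply/(is_derive_thP (fun q => f (shift2 t0 th0 q))).
  have -> : (fun z => f (shift2 t0 th0 (pt (p 0 t_) z))) = (fun z => f (pt (t0 + p 0 t_) (th0 + z))).
    by apply/funext => z; rewrite /shift2 pt_t pt_th.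
  by apply: (@is_derive_eq _ _ _ _ _ _ _ _ H2); rewrite mul1r mul0r add0r.
by rewrite ptK => -[].
Qed.

Lemma smooth_shift2 t0 th0 (U : set 'rV[R]_2) : open U -> smooth U (shift2 t0 th0).
Proof.
move=> oU; apply: smooth_pt => //; apply: smoothD => //; try exact: smooth_cst; exact: smooth_coord.
Qed.

Lemma shift2_0 t0 th0 : shift2 t0 th0 0 = pt t0 th0.
Proof. by rewrite /shift2 !mxE !addr0. Qed.

Lemma diffeo_germ_shift2 t0 th0 : diffeo_germ (shift2 t0 th0) 0 (pt t0 th0).
Proof.
have [] := @diffeo_germ_intro _ 2 (shift2 t0 th0) (shift2 (- t0) (- th0)) setT setT 0 openT openT I.
- exact: smooth_shift2 openT.
- exact: smooth_shift2 openT.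
- by move=> p _; split => //; apply: eq_pt; rewrite /shift2 !(pt_t, pt_th) addKr.
- by move=> p _; split => //; apply: eq_pt; rewrite /shift2 !(pt_t, pt_th) addNKr.
by rewrite shift2_0.
Qed.

End Shift.

(** * The dual surface in coordinates X and V *)

Section Adapted.
Variable R : realType.

Lemma continuous_eq_at (f g : R -> R) (x : R) : {for x, continuous f} -> {for x, continuous g} ->
  (\forall r \near x^', f r = g r) -> f x = g x.
Proof.
move=> cf cg E.
have L1 : f r @[r --> x^'] --> f x by apply: cvg_within_filter; exact: cf.
have L2 : g r @[r --> x^'] --> g x by apply: cvg_within_filter; exact: cg.
have L3 : f r @[r --> x^'] --> g x.
  by apply: cvg_trans L2; apply: near_eq_cvg; apply: filterS E => r ->.
exact: (cvg_unique _ L1 L3).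
Qed.

Lemma vanish_uniq (f g : R -> R) x n L K : vanish f x n L -> vanish g x n K ->
  (\forall t \near x, f t = g t) -> L = K.
Proof.
move=> [M [cM <- EM]] [N [cN <- EN]] E; apply: continuous_eq_at => //.
near=> t.
have tx : t != x by near: t; exact: nbhs_dnbhs_neq.
have : f t = g t by near: t; exact: nbhs_dnbhs.
by rewrite EM EN => /mulfI; apply; rewrite expf_neq0 // subr_eq0.
Unshelve. all: by end_near. Qed.

Lemma smooth_continuous_th (U : set 'rV[R]_2) (f : 'rV[R]_2 -> R) X V : smooth U f -> U (pt X V) ->
  {for V, continuous (fun r => f (pt X r))}.
Proof.
move=> sf Up; apply: (is_derive_continuous (du := 'D_(e_th R) f (pt X V))).
by apply/is_derive_thP/derivableP/(smooth_derivable sf).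
Qed.

Lemma smooth_continuous_t (U : set 'rV[R]_2) (f : 'rV[R]_2 -> R) X V : smooth U f -> U (pt X V) ->
  {for X, continuous (fun r => f (pt r V))}.
Proof.
move=> sf Up; apply: (is_derive_continuous (du := 'D_(e_t R) f (pt X V))).
by apply/is_derive_tP/derivableP/(smooth_derivable sf).
Qed.

Lemma continuous_compR (f g : R -> R) x : {for x, continuous f} -> {for f x, continuous g} ->
  {for x, continuous (fun r => g (f r))}.
Proof. exact: continuous_comp. Qed.

Lemma near0_lt (d : R) : 0 < d -> \forall r \near (0 : R), `|r| < d.
Proof.
move=> d0; have /cvgrPdist_lt /(_ _ d0) : (id : R -> R) z @[z --> (0 : R)] --> (0 : R) by exact: cvg_id.
by apply: filterS => v; rewrite sub0r normrN.
Qed.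

Lemma continuous_opp0 (f : R -> R) : {for 0, continuous f} -> {for 0, continuous (fun r => f (- r))}.
Proof.
move=> cf; apply: (@continuous_compR (fun r : R => - r) f); first exact: opp_continuous.
by rewrite oppr0.
Qed.

Variables (I : set R) (mu nu w E : R -> 'rV[R]_4) (D s e : R -> R).
Hypothesis fr : dual_frame I mu nu w E D s e.

Let F := dualF mu nu.

Lemma lor_dualF_self (p : 'rV[R]_2) : I (p 0 t_) -> lor (F p) (F p) = 1.
Proof.
move=> Ip; have [mm nn _ _] := df_sq fr Ip; have [[mn _ _] _ _ _] := df_ort fr Ip.
rewrite /F /dualF !(lorDl, lorDr, lorZl, lorZr) mm nn mn lorC mn.
by rewrite -[RHS](cos2Dsin2 (p 0 th_)); ring.
Qed.

Variables (t0 th0 : R).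
Hypotheses (It0 : I t0) (sth : sin th0 = 0).

Let c0 := cos th0.
Lemma cos_sq1 : cos th0 * cos th0 = 1.
Proof. by have := cos2Dsin2 th0; rewrite sth expr0n addr0 expr2. Qed.

Let expand v : v = lor v (mu t0) *: mu t0 + lor v (nu t0) *: nu t0 + lor v (w t0) *: w t0 - lor v (E t0) *: E t0.
Proof. exact: (frame_expand (df_sq fr It0) (df_ort fr It0)). Qed.

Let self v : lor v v = lor v (mu t0) ^+ 2 + lor v (nu t0) ^+ 2 + lor v (w t0) ^+ 2 - lor v (E t0) ^+ 2.
Proof. exact: (frame_lor_self (df_sq fr It0) (df_ort fr It0)). Qed.

(** The two points differ only in their mu and E components, and equality of the norms ties these:
    (ra - rb)(ra + rb) = (za - zb)(za + zb). The difference in any direction is thus governed by the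
    one along E. It is used for the points with parameters V and -V. *)
Lemma odd_difference u v1 v2 : lor v1 (nu t0) = lor v2 (nu t0) -> lor v1 (w t0) = lor v2 (w t0) ->
  lor v1 v1 = lor v2 v2 ->
  (lor v1 u - lor v2 u) * (lor v1 (mu t0) + lor v2 (mu t0)) =
  (lor v1 (E t0) - lor v2 (E t0)) * ((lor v1 (E t0) + lor v2 (E t0)) * lor (mu t0) u -
     (lor v1 (mu t0) + lor v2 (mu t0)) * lor (E t0) u).
Proof.
move=> h1 h2; rewrite !self h1 h2.
have -> : lor v1 u = lor v1 (mu t0) * lor (mu t0) u + lor v2 (nu t0) * lor (nu t0) u +
   lor v2 (w t0) * lor (w t0) u - lor v1 (E t0) * lor (E t0) u.
  by rewrite {1}(expand v1) !(lorDl, lorNl, lorZl) h1 h2.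
have -> : lor v2 u = lor v2 (mu t0) * lor (mu t0) u + lor v2 (nu t0) * lor (nu t0) u +
   lor v2 (w t0) * lor (w t0) u - lor v2 (E t0) * lor (E t0) u.
  by rewrite {1}(expand v2) !(lorDl, lorNl, lorZl).
move: (lor v1 (E t0)) (lor v2 (E t0)) (lor v1 (mu t0)) (lor v2 (mu t0)) => za zb ra rb H.
have rr : (ra - rb) * (ra + rb) = (za - zb) * (za + zb).
  move: H; move: (lor v2 (nu t0)) (lor v2 (w t0)) => x y H.
  have -> : (ra - rb) * (ra + rb) = (ra ^+ 2 + x ^+ 2 + y ^+ 2 - za ^+ 2) - (rb ^+ 2 + x ^+ 2 + y ^+ 2 - zb ^+ 2) + (za ^+ 2 - zb ^+ 2) by ring.
  rewrite subr_sqr; have -> : ra ^+ 2 + x ^+ 2 + y ^+ 2 - za ^+ 2 = rb ^+ 2 + x ^+ 2 + y ^+ 2 - zb ^+ 2 by [].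
  by rewrite subrr add0r.
move: (lor (mu t0) u) (lor (nu t0) u) (lor (w t0) u) (lor (E t0) u) (lor v2 (nu t0)) (lor v2 (w t0)) => m n q p x y.
have -> : (ra * m + x * n + y * q - za * p - (rb * m + x * n + y * q - zb * p)) * (ra + rb) =
  (ra - rb) * (ra + rb) * m - (za - zb) * (ra + rb) * p by ring.
by rewrite rr; ring.
Qed.

Let F0 : F (pt t0 th0) = c0 *: mu t0.
Proof. by rewrite /F /dualF pt_t pt_th sth scale0r addr0. Qed.

(** The nonzero constants [kp1] and [kp2] transfer the zero of [e] and its simplicity to the
    coefficient [B] of V^3. *)
Theorem adapted_normal_form : exists d (phi : 'rV[R]_2 -> 'rV[R]_2) (K0 k0 B : 'rV[R]_2 -> R) (sg kp1 kp2 : R),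
  [/\ [/\ 0 < d, sg = 1 \/ sg = -1 & diffeo_germ phi 0 (pt t0 th0)],
      [/\ smooth (box d) K0, smooth (box d) k0 & smooth (box d) B],
      (forall X V, `|X| < d -> `|V| < d -> let v := F (phi (pt X V)) in
         [/\ I (phi (pt X V) 0 t_), lor v (nu t0) = X, lor v (w t0) = K0 (pt X 0) + sg * V ^+ 2, `|V ^+ 2| < d &
             lor v (E t0) = k0 (pt X (V ^+ 2)) + V ^+ 3 * B (pt X (V ^+ 2))]),
      (kp1 != 0 /\ B 0 = kp1 * e t0) &
      (kp2 != 0 /\ (e t0 = 0 -> forall e1, is_derive t0 (1 : R) e e1 -> 'D_(e_t R) B 0 = kp2 * e1))].
Proof.
have [D0 s0] := df_pos fr It0.
have oS := open_strip fr.
have sF := smooth_dualF fr.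
have [d0 d00 HI] : exists2 d0, 0 < d0 & forall t, `|t| < d0 -> I (t0 + t).
  have : \forall t \near t0, I t := open_nbhs_nbhs (conj (df_open fr) It0).
  move=> [d0 /= d00 H]; exists d0 => // t ht; apply: H.
  by rewrite /= opprD addrA subrr sub0r normrN.
have oB := @open_box R d0.
pose Fs (u : 'rV[R]_4) p := lor (F (shift2 t0 th0 p)) u.
have sub (p : 'rV[R]_2) : box d0 p -> strip I (shift2 t0 th0 p).
  by move=> [h1 _]; rewrite /strip /= /shift2 pt_t; exact: HI.
have sFu u : smooth (strip I) (fun p => lor (F p) u).
  by apply: smooth_lor => //; exact: smooth_cst_rV.
have sFs u : smooth (box d0) (Fs u).
  exact: (smooth_comp oB sub (smooth_shift2 _ _ oB) (sFu u)).
have dFs u p : box d0 p ->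
   'D_(e_t R) (Fs u) p = lor ('D_(e_t R) F (shift2 t0 th0 p)) u /\
   'D_(e_th R) (Fs u) p = lor ('D_(e_th R) F (shift2 t0 th0 p)) u.
  move=> Bp; have Sp := sub _ Bp.
  have [-> ->] := derive_shift2 (smooth_diff (sFu u) Sp).
  by have dF := smooth_diff sF Sp; rewrite !(@derive_lor _ _ _ _ _ _ dF).
have dFs0 u t : `|t| < d0 ->
   'D_(e_t R) (Fs u) (pt t 0) = - (c0 * D (t0 + t) * lor (nu (t0 + t)) u) /\
   'D_(e_th R) (Fs u) (pt t 0) = c0 * lor (nu (t0 + t)) u.
  move=> ht; have Bp : box d0 (pt t 0) by apply: box_pt => //; rewrite normr0.
  have [-> ->] := dFs u _ Bp.
  have Ip : I (shift2 t0 th0 (pt t 0) 0 t_) by rewrite /shift2 !pt_t; exact: HI.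
  rewrite !(derive_dualF fr) // e_t_t e_t_th e_th_t e_th_th /shift2 !(pt_t, pt_th) addr0 sth.
  by rewrite !(lorDl, lorZl) -/c0; split; ring.
have [mm nn ww EE] := df_sq fr It0; have [[mn mw mE] nw nE wE] := df_ort fr It0.
have cc := cos_sq1; rewrite -/c0 in cc.
have c00 : c0 != 0 by apply: contra_eq_neq cc => ->; rewrite mul0r eq_sym oner_eq0.
have z00 : `|0 : R| < d0 by rewrite normr0.
have x0 : Fs (nu t0) 0 = 0 by rewrite /Fs shift2_0 F0 lorZl mn mulr0.
have xt0 : 'D_(e_t R) (Fs (nu t0)) 0 != 0.
  rewrite -pt00; have [-> _] := dFs0 (nu t0) 0 z00.
  by rewrite addr0 nn mulr1 oppr_eq0 mulf_neq0 // gt_eqF.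
have ker t : `|t| < d0 -> forall f, f = Fs (nu t0) \/ f = Fs (w t0) \/ f = Fs (E t0) ->
      'D_(e_th R) f (pt t 0) = (- (D (t0 + t))^-1) * 'D_(e_t R) f (pt t 0).
  move=> ht; have [Dp _] := df_pos fr (HI _ ht).
  have main u : 'D_(e_th R) (Fs u) (pt t 0) = (- (D (t0 + t))^-1) * 'D_(e_t R) (Fs u) (pt t 0).
    by have [-> ->] := dFs0 u _ ht; field; rewrite gt_eqF.
  by move=> f [->|[->|->]]; exact: main.
have Dsh (c x : R) (u : R -> R) du : is_derive x (1 : R) u du -> is_derive x (1 : R) (fun z => c + u z) du.
  by move=> H; have := is_deriveD (is_derive_cst c x (1 : R)) H; rewrite add0r.
have deg (a : R -> R) : a 0 = 0 -> is_derive (0 : R) (1 : R) a (- (- (D (t0 + 0))^-1)) ->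
     exists G : R -> R, [/\ {for 0, continuous G}, G 0 != 0 & forall r, Fs (w t0) (pt (a r) r) = r ^+ 2 * G r].
  rewrite opprK addr0 => a0 Da.
  have Da' : is_derive (0 : R) (1 : R) (fun r => t0 + a r) (D t0)^-1 by exact: Dsh.
  have Db' : is_derive (0 : R) (1 : R) (fun r => th0 + r) ((D t0)^-1 * D t0).
    by rewrite mulVf ?gt_eqF //; apply: Dsh; exact: is_derive_id.
  have a0' : t0 + a 0 = t0 by rewrite a0 addr0.
  have [G [cG G0 EG]] := vanish_dualF_w fr It0 sth a0' (addr0 th0) Da' Db'.
  exists G; split => //.
    by rewrite G0 !mulf_neq0 // ?invr_eq0 ?expf_neq0 ?invr_eq0 // ?gt_eqF // pnatr_eq0.
  by move=> r; have := EG r; rewrite subr0 => <-; rewrite /Fs /shift2 !(pt_t, pt_th).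
have [d [a [b [K0 [k0 [B [sg [[dp sgE G] [sa sb sK sk sB] Hab HN HX]]]]]]]] :=
  cuspidal_normal_form d00 (sFs (nu t0)) (sFs (w t0)) (sFs (E t0)) x0 xt0 ker deg.
pose phi p := shift2 t0 th0 (pt (a p) (b p)).
have oBd := @open_box R d.
have phiI p : box d p -> strip I (phi p).
  by move=> /Hab [h1 h2]; apply: sub; exact: box_pt.
have sphi : smooth (box d) phi.
  apply: smooth_pt => //; apply: smoothD => //; try exact: smooth_cst.
    by apply: smooth_ext sa => // p _; rewrite pt_t.
  by apply: smooth_ext sb => // p _; rewrite pt_th.
have sFphi u : smooth (box d) (fun p => lor (F (phi p)) u).
  exact: (smooth_comp oBd phiI sphi (sFu u)).
have zd : `|0 : R| < d by rewrite normr0.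
have phi0 : phi 0 = pt t0 th0.
  rewrite /phi -[RHS]shift2_0; congr shift2.
  by have [U [V [psi [_ [_ ->] _ _ _]]]] := G.
(* The singular curve is V = 0: [tX] is its t-parameter and [kX] the t-velocity of the V-curves
   crossing it. Components are taken in the frame at [t0], while third order is known against E at
   [tX X]; [n3] and [n4] convert between the two. *)
pose tX X := t0 + a (pt X 0).
pose kX X := 'D_(e_th R) a (pt X 0).
pose z X := lor (F (phi (pt X 0))) (E t0).
pose rho X := lor (F (phi (pt X 0))) (mu t0).
pose n3 X := lor (E t0) (E (tX X)).
pose n4 X := lor (mu t0) (E (tX X)).
pose J X := z X * n4 X - rho X * n3 X.
pose K X := rho X * - (c0 * D (tX X) * s (tX X) * kX X ^+ 3 / 3).
have tXI X : `|X| < d -> I (tX X).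
  by move=> hX; have := phiI _ (box_pt hX zd); rewrite /strip /= /phi /shift2 !pt_t.
(* Both sides come from the odd third-order term in V of the pairing of F with E at [tX X]: once
   through [B], once through the frame equations. *)
have rel X : `|X| < d -> B (pt X 0) * J X = K X * e (tX X).
  move=> hX; have [bX bth ath] := HX _ hX.
  have BX := box_pt hX zd.
  have [DX sX] := df_pos fr (tXI _ hX).
  have da : is_derive (0 : R) (1 : R) (fun r => t0 + a (pt X r)) (kX X).
    by apply: Dsh; apply/is_derive_thP/derivableP/(smooth_derivable sa).
  have db : is_derive (0 : R) (1 : R) (fun r => th0 + b (pt X r)) (kX X * D (tX X)).
    apply: Dsh; have -> : kX X * D (tX X) = 'D_(e_th R) b (pt X 0).
      by rewrite /kX ath opprK /tX; field; rewrite gt_eqF.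
    by apply/is_derive_thP/derivableP/(smooth_derivable sb).
  have [||M [cM M0 EM]] := vanish_dualF_E fr (tXI _ hX) sth _ _ da db.
  - by [].
  - by rewrite bX addr0.
  pose v r := F (phi (pt X r)).
  have EMv r : lor (v r) (E (tX X)) = r ^+ 3 * M r.
    by have := EM r; rewrite subr0 => <-; rewrite /v /phi /shift2 !(pt_t, pt_th).
  have cv u : {for 0, continuous (fun r => lor (v r) u)}.
    exact: (smooth_continuous_th (sFphi u) BX).
  have cBr : {for 0, continuous (fun r : R => B (pt X (r ^+ 2)))}.
    apply: (@continuous_compR (fun r : R => r ^+ 2) (fun y => B (pt X y))).
      exact: exprn_continuous.
    by rewrite expr0n /=; exact: smooth_continuous_th sB BX.
  pose S r := lor (v r) (mu t0) + lor (v (- r)) (mu t0).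
  pose Z r := lor (v r) (E t0) + lor (v (- r)) (E t0).
  have cS : {for 0, continuous S} by apply: cvgD; [exact: cv|exact: continuous_opp0 (cv _)].
  have cZ : {for 0, continuous Z} by apply: cvgD; [exact: cv|exact: continuous_opp0 (cv _)].
  (* For r different from 0 the identity of [odd_difference] at V = r and V = -r can be divided by
     r^3; continuity carries the quotient identity to r = 0. *)
  have : 2 * B (pt X (0 ^+ 2)) * (Z 0 * n4 X - S 0 * n3 X) = S 0 * (M 0 + M (- 0)).
    apply: (@continuous_eq_at (fun r => 2 * B (pt X (r ^+ 2)) * (Z r * n4 X - S r * n3 X))
              (fun r => S r * (M r + M (- r)))).
    - apply: cvgM; first by apply: cvgM => //; exact: cvg_cst.
      by apply: cvgB; apply: cvgM => //; exact: cvg_cst.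
    - by apply: cvgM => //; apply: cvgD => //; exact: continuous_opp0.
    near=> r.
    have r0 : r != 0 by near: r; exact: nbhs_dnbhs_neq.
    have rd : `|r| < d by near: r; exact: dnbhs0_lt.
    have rdN : `|- r| < d by rewrite normrN.
    have HNr q : `|q| < d -> [/\ lor (v q) (nu t0) = X, lor (v q) (w t0) = K0 (pt X 0) + sg * q ^+ 2,
       lor (v q) (E t0) = k0 (pt X (q ^+ 2)) + q ^+ 3 * B (pt X (q ^+ 2)) & lor (v q) (v q) = 1].
      move=> hq; have [h1 h2 _ h3] := HN X q hX hq; split => //.
      by apply: lor_dualF_self; have := phiI _ (box_pt hX hq).
    have [x1 y1 z1 l1] := HNr _ rd; have [x2 y2 z2 l2] := HNr _ rdN.
    have r2 : (- r) ^+ 2 = r ^+ 2 by ring.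
    have r3 : (- r) ^+ 3 = - r ^+ 3 by ring.
    rewrite r2 in y2 z2; rewrite r3 in z2.
    have := @odd_difference (E (tX X)) (v r) (v (- r)).
    rewrite x1 x2 y1 y2 l1 l2 => /(_ erefl erefl erefl).
    rewrite (EMv r) (EMv (- r)) r3 -/(S r) -/(Z r) -/(n3 X) -/(n4 X) z1 z2.
    move: (M r) (M (- r)) (S r) (Z r) (n3 X) (n4 X) (B _) (k0 _) (r ^+ 3) (expf_neq0 3 r0) =>
      m1 m2 S1 Z1 p3 p4 b1 k1 q q0 H.
    apply: (@mulfI _ q) => //.
    have -> : q * (S1 * (m1 + m2)) = (q * m1 - - q * m2) * S1 by ring.
    by rewrite H; ring.
  rewrite expr0n /= oppr0 M0 /S /Z oppr0.
  rewrite /v -/(z X) -/(rho X) /J /K -/c0 => H.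
  apply: (@mulfI _ 4); first by rewrite pnatr_eq0.
  have -> : 4 * (B (pt X 0) * (z X * n4 X - rho X * n3 X)) =
    2 * B (pt X 0) * ((z X + z X) * n4 X - (rho X + rho X) * n3 X) by ring.
  by rewrite H; field.
have a00 : a (pt 0 0) = 0 by have := congr1 (fun q : 'rV[R]_2 => q 0 t_) phi0; rewrite /phi /shift2 !pt_t pt00 => /(canRL (addKr _)) ->; rewrite addNr.
have tX0 : tX 0 = t0 by rewrite /tX a00 addr0.
have z0 : z 0 = 0 by rewrite /z pt00 phi0 F0 lorZl mE mulr0.
have rho0 : rho 0 = c0 by rewrite /rho pt00 phi0 F0 lorZl mm mulr1.
have J0 : J 0 = c0 by rewrite /J z0 rho0 /n3 tX0 EE; ring.
have [bX0 bth0 ath0] := HX _ zd.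
have kX0 : kX 0 != 0.
  by rewrite /kX ath0 opprK mulf_neq0 // invr_eq0 a00 addr0 gt_eqF.
have K00 : K 0 != 0.
  rewrite /K rho0 tX0 mulf_neq0 // oppr_eq0 !mulf_neq0 // ?gt_eqF ?invr_gt0 ?expf_neq0 //.
have rel0 := rel _ zd.
rewrite J0 tX0 pt00 in rel0.
have Da : is_derive (0 : R) (1 : R) tX ('D_(e_t R) a 0).
  apply: Dsh; rewrite -pt00; apply/is_derive_tP/derivableP/(smooth_derivable sa).
  exact: box_pt.
(* On the singular curve X is the nu-component of F, a function of t whose composite with [tX] has
   derivative 1. So t is a regular parameter in X and a simple zero of [e] stays simple. *)
have al0 : 'D_(e_t R) a 0 != 0.
  have Db : is_derive (0 : R) (1 : R) (fun X => th0 + b (pt X 0)) 0.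
    apply: Dsh; apply: (@near_is_derive1 _ (cst 0)).
    by apply: filterS (near0_lt dp) => X hX; have [-> _ _] := HX _ hX.
  have Sp : strip I (pt (tX 0) (th0 + b (pt 0 0))) by rewrite /strip /= pt_t tX0.
  have H := is_derive_comp2 Da Db (smooth_diff (sFu (nu t0)) Sp).
  have H2 : is_derive (0 : R) (1 : R) (fun X => lor (F (pt (tX X) (th0 + b (pt X 0)))) (nu t0)) 1.
    apply: (@near_is_derive1 _ id).
    apply: filterS (near0_lt dp) => X hX; have [h _ _ _] := HN _ _ hX zd.
    by rewrite -{1}h /Fs /shift2 !(pt_t, pt_th).
  have [_ E1] := H; have [_ E2] := H2; move: E1; rewrite E2 mul0r addr0 => E3.
  by apply: contra_eq_neq E3 => ->; rewrite mul0r oner_eq0.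
have ctX : {for 0, continuous tX} by exact: is_derive_continuous Da.
have cE u : {for 0, continuous (fun X => lor u (E (tX X)))}.
  apply: (@continuous_compR tX (fun t => lor u (E t))) => //; rewrite tX0.
  have := is_derive_lorl u (df_dE fr It0) => H.
  have -> : (fun t => lor u (E t)) = (fun t => lor (E t) u) by apply/funext => t; rewrite lorC.
  exact: is_derive_continuous H.
have cz u : {for 0, continuous (fun X => lor (F (phi (pt X 0))) u)}.
  by apply: (smooth_continuous_t (sFphi u)); exact: box_pt.
have cJ : {for 0, continuous J}.
  by apply: cvgB; apply: cvgM; [exact: cz|exact: cE|exact: cz|exact: cE].
have [cD cs ce] := df_cont fr It0.
have cK : {for 0, continuous K}.
  apply: cvgM; first exact: cz.
  apply: cvgN; apply: cvgM; last exact: cvg_cst.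
  apply: cvgM; last first.
    apply: (@continuous_compR kX (fun q => q ^+ 3)); last exact: exprn_continuous.
    by apply: (smooth_continuous_t (smooth_derive (e_th R) sa)); exact: box_pt.
  apply: cvgM; last by apply: (@continuous_compR tX s) => //; rewrite tX0.
  apply: cvgM; first exact: cvg_cst.
  by apply: (@continuous_compR tX D) => //; rewrite tX0.
exists d, phi, K0, k0, B, sg, (K 0 / c0), (K 0 * 'D_(e_t R) a 0 / c0); split.
- split => //; have := diffeo_germ_comp G (diffeo_germ_shift2 t0 th0).
  by [].
- by [].
- move=> X V hX hV /=; have [h1 h2 h3 h4] := HN X V hX hV.
  by split => //; have := phiI _ (box_pt hX hV).
- split; first exact: mulf_neq0 K00 (invr_neq0 c00).
  by apply: (mulIf c00); rewrite rel0; field.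
split; first exact: mulf_neq0 (mulf_neq0 K00 al0) (invr_neq0 c00).
move=> e0 e1 De.
(* When [e t0 = 0] both sides of [rel] vanish to first order in X, and their leading coefficients
   give [kp2]. *)
have vB : vanish (fun X => B (pt X 0)) 0 1 ('D_(e_t R) B 0).
  apply: vanish_derive; first by rewrite pt00; apply: (mulIf c00); rewrite rel0 e0 mul0r mulr0.
  by rewrite -pt00; apply/is_derive_tP/derivableP/(smooth_derivable sB); exact: box_pt.
have vJ := vanish0 cJ; have vK := vanish0 cK.
have ve := vanish_comp (vanish_derive e0 De) tX0 Da.
have := vanish_uniq (vanishM vB vJ) (vanishM vK ve) _.
rewrite J0 expr1 => H; apply: (mulIf c00); rewrite H; first by field.
by apply: filterS (near0_lt dp) => X hX; rewrite rel.
Unshelve. all: by end_near. Qed.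

End Adapted.

(** * Sufficiency of the criteria *)

Section LeftGerms.
Variable R : realType.
Implicit Types (v : 'rV[R]_4).

Definition proj2 (v : 'rV[R]_4) : 'rV[R]_2 := pt (v 0 0) (v 0 o1).

Lemma smooth_proj2 U : open U -> smooth U proj2.
Proof. by move=> oU; apply: smooth_pt => //; exact: smooth_coord. Qed.

(** The fourth coordinate measures the distance from the hyperquadric, so the surface lands in the
    first three. On the half-space where [c * lor v m] is positive, the missing m-component is
    recovered from the norm as c times a square root, hence smoothly. *)
Lemma frame_germ (m n w E : 'rV[R]_4) (c : R) :
  [/\ lor m m = 1, lor n n = 1, lor w w = 1 & lor E E = -1] ->
  [/\ [/\ lor m n = 0, lor m w = 0 & lor m E = 0], lor n w = 0, lor n E = 0 & lor w E = 0] ->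
  c * c = 1 ->
  diffeo_germ (fun v => row4 (lor v n) (lor v w) (lor v E) (lor v v - 1)) (c *: m) 0.
Proof.
move=> sq ort cc; have [mm nn ww EE] := sq; have [[mn mw mE] nw nE wE] := ort.
have oT : open (setT : set 'rV[R]_4) by exact: openT.
have slor u (U : set 'rV[R]_4) : open U -> smooth U (fun v => lor v u).
  by move=> oU; apply: smooth_lor => //; [exact: smooth_id|exact: smooth_cst_rV].
have oneside (f : 'rV[R]_4 -> R) : smooth setT f -> open [set v | 0 < f v].
  move=> sf; rewrite openE => v /= v0; rewrite /interior.
  have cf := smooth_continuous sf (x := v) I.
  have /cvgrPdist_lt /(_ _ v0) := cf; apply: filterS => z.
  by rewrite ltr_norml => /andP[h1 h2]; clear -h1 h2 v0; rewrite /=; lra.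
pose U := [set v | 0 < c * lor v m].
pose q (r : 'rV[R]_4) := 1 + r 0 o3 - r 0 0 ^+ 2 - r 0 o1 ^+ 2 + r 0 o2 ^+ 2.
pose V := [set r | 0 < q r].
have sq' W : open W -> smooth W q.
  move=> oW; have sc (j : 'I_4) : smooth W (fun v : 'rV[R]_4 => v 0 j : R) by exact: smooth_coord.
  have sx (j : 'I_4) : smooth W (fun v : 'rV[R]_4 => v 0 j ^+ 2 : R) by exact: smoothX.
  apply: smoothD => //; apply: smoothB => //; apply: smoothB => //; apply: smoothD => //.
  exact: smooth_cst.
have oU : open U.
  by apply: oneside; apply: smoothM => //; [exact: smooth_cst|exact: slor].
have oV : open V by apply: oneside; exact: sq'.
pose psi (r : 'rV[R]_4) := r 0 0 *: n + r 0 o1 *: w - r 0 o2 *: E + (c * Num.sqrt (q r)) *: m.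
have [] := @diffeo_germ_intro _ 4 (fun v => row4 (lor v n) (lor v w) (lor v E) (lor v v - 1)) psi U V (c *: m) oU oV.
- by rewrite /U /= lorZl mm mulr1 cc.
- apply: smooth_row4 => //; [exact: slor|exact: slor|exact: slor|].
  by apply: smoothB => //; [apply: smooth_lor => //; exact: smooth_id|exact: smooth_cst].
- apply/smooth_rV => // j.
  have sc (i : 'I_4) : smooth V (fun v : 'rV[R]_4 => v 0 i : R) by exact: smooth_coord.
  have sk (u : R) : smooth V (fun _ : 'rV[R]_4 => u) by exact: smooth_cst.
  apply: (@smooth_ext _ _ _ _ (fun r => r 0 0 * n 0 j + r 0 o1 * w 0 j - r 0 o2 * E 0 j + (c * Num.sqrt (q r)) * m 0 j)) => //.
    by move=> r _; rewrite /psi !mxE.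
  apply: smoothD => //; first apply: smoothB => //; first apply: smoothD => //.
  + exact: smoothM.
  + exact: smoothM.
  + exact: smoothM.
  + apply: smoothM => //; apply: smoothM => //; apply: smooth_sqrt => //; exact: sq'.
- move=> v Uv.
  have qE : q (row4 (lor v n) (lor v w) (lor v E) (lor v v - 1)) = lor v m ^+ 2.
    rewrite /q !row4E (frame_lor_self sq ort v); ring.
  have m0 : lor v m != 0 by apply: contraTneq Uv => h; rewrite /U /= h mulr0 ltxx.
  split; first by rewrite /V /= qE lt_def sqrf_eq0 m0 sqr_ge0.
  rewrite /psi qE !row4E sqrtr_sqr {5}(frame_expand sq ort v).
  have -> : c * `|lor v m| = lor v m.
    have Uv' : 0 < c * lor v m := Uv.
    have c1 : `|c| = 1.
      have : `|c| ^+ 2 = 1 by rewrite real_normK ?num_real // expr2.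
      by move/eqP; rewrite sqrf_eq1 => /orP[/eqP //|/eqP h]; have := normr_ge0 c; rewrite h; lra.
    have := gtr0_norm Uv'; rewrite normrM c1 mul1r => ->.
    by rewrite mulrA cc mul1r.
  by rewrite addrC !addrA.
- move=> r Vr; have Vr' : 0 < q r := Vr.
  have e1 : lor (psi r) m = c * Num.sqrt (q r).
    by rewrite /psi !(lorDl, lorNl, lorZl) mm [lor n m]lorC [lor w m]lorC [lor E m]lorC mn mw mE; ring.
  have e2 : lor (psi r) n = r 0 0.
    by rewrite /psi !(lorDl, lorNl, lorZl) nn [lor w n]lorC [lor E n]lorC mn nw nE; ring.
  have e3 : lor (psi r) w = r 0 o1.
    by rewrite /psi !(lorDl, lorNl, lorZl) ww [lor E w]lorC mw nw wE; ring.
  have e4 : lor (psi r) E = r 0 o2.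
    by rewrite /psi !(lorDl, lorNl, lorZl) EE mE nE wE; ring.
  split.
    by rewrite /U /= e1 mulrA cc mul1r sqrtr_gt0.
  rewrite e2 e3 e4 (frame_lor_self sq ort (psi r)) e1 e2 e3 e4 exprMn sqr_sqrtr ?(ltW Vr') //.
  have -> : c ^+ 2 * q r + r 0 0 ^+ 2 + r 0 o1 ^+ 2 - r 0 o2 ^+ 2 - 1 = r 0 o3.
    by rewrite expr2 cc mul1r /q; ring.
  exact: row4K.
rewrite !lorZl mn mw mE lorZr mm !mulr0 mulr1 cc subrr row4_0.
by [].
Qed.

Lemma open_proj_box d (U : set 'rV[R]_4) (h : 'rV[R]_4 -> 'rV[R]_2) : open U -> smooth U h ->
  open (U `&` h @^-1` box d).
Proof. by move=> oU sh; apply: open_preimage => //; exact: open_box. Qed.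

(** On the surface, sg (v_1 - K0(X)) equals V^2. Thus X and V^2 are available in the target, and the
    even part k0(X, V^2) of the third component can be subtracted there. *)
Lemma shear_germ d (K0 k0 : 'rV[R]_2 -> R) (sg : R) : 0 < d -> sg * sg = 1 ->
  smooth (box d) K0 -> smooth (box d) k0 -> K0 0 = 0 -> k0 0 = 0 ->
  diffeo_germ (fun v => row4 (v 0 0) (sg * (v 0 o1 - K0 (pt (v 0 0) 0)))
     (v 0 o2 - k0 (pt (v 0 0) (sg * (v 0 o1 - K0 (pt (v 0 0) 0))))) (v 0 o3)) 0 0.
Proof.
move=> d0 sg2 sK sk K00 k00.
have oT : open (setT : set 'rV[R]_4) by exact: openT.
pose U1 := [set v : 'rV[R]_4 | `|v 0 0| < d].
have oB := @open_box R d.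
have oU1 : open U1.
  have -> : U1 = (fun v : 'rV[R]_4 => pt (v 0 0) 0) @^-1` box d.
    apply/seteqP; split=> v /=; first by move=> h; apply: box_pt => //; rewrite normr0.
    by move=> [h _]; rewrite pt_t in h.
  by apply: open_preimageT => //; apply: smooth_pt => //; [exact: smooth_coord|exact: smooth_cst].
have sc (W : set 'rV[R]_4) (i : 'I_4) : open W -> smooth W (fun v : 'rV[R]_4 => v 0 i : R).
  by move=> oW; exact: smooth_coord.
have sK1 : smooth U1 (fun v => K0 (pt (v 0 0) 0)).
  apply: (smooth_comp oU1 _ _ sK) => //.
    by move=> v hv; apply: box_pt => //; rewrite normr0.
  by apply: smooth_pt => //; [exact: sc|exact: smooth_cst].
pose Y (v : 'rV[R]_4) := sg * (v 0 o1 - K0 (pt (v 0 0) 0)).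
have sY : smooth U1 Y.
  by apply: smoothM => //; [exact: smooth_cst|apply: smoothB => //; exact: sc].
pose U := U1 `&` (fun v => pt (v 0 0) (Y v)) @^-1` box d.
have oU : open U by apply: open_proj_box => //; apply: smooth_pt => //; exact: sc.
pose V := proj2 @^-1` box d.
have oV : open V by apply: open_preimageT => //; exact: smooth_proj2.
have UU1 : U `<=` U1 by move=> v [].
have VU1 : V `<=` U1 by move=> v [h _]; rewrite pt_t in h.
pose psi (r : 'rV[R]_4) := row4 (r 0 0) (K0 (pt (r 0 0) 0) + sg * r 0 o1) (r 0 o2 + k0 (proj2 r)) (r 0 o3).
have Y0 : Y 0 = 0 by rewrite /Y !mxE pt00 K00 subrr mulr0.
have [] := @diffeo_germ_intro _ 4 (fun v => row4 (v 0 0) (Y v) (v 0 o2 - k0 (pt (v 0 0) (Y v))) (v 0 o3))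
   psi U V 0 oU oV.
- split; first by rewrite /U1 /= mxE normr0.
  by rewrite /= Y0; apply: box_pt; rewrite ?mxE normr0.
- have sYU := smooth_sub UU1 sY.
  apply: smooth_row4 => //; [exact: sc|apply: smoothB => //; [exact: sc|]|exact: sc].
  apply: (smooth_comp oU _ _ sk) => //; first by move=> v [].
  by apply: smooth_pt => //; exact: sc.
- apply: smooth_row4 => //; [exact: sc| | |exact: sc].
    apply: smoothD => //; first exact: smooth_sub VU1 sK1.
    by apply: smoothM => //; [exact: smooth_cst|exact: sc].
  apply: smoothD => //; first exact: sc.
  by apply: (smooth_comp oV _ _ sk) => //; exact: smooth_proj2.
- move=> v [v1 v2]; split; first by rewrite /V /= /proj2 !row4E.
  rewrite /psi /proj2 !row4E /Y mulrA sg2 mul1r subrKC subrK.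
  exact: row4K.
- move=> r Vr; have YE : Y (psi r) = r 0 o1.
    by rewrite /Y /psi !row4E addrC addKr mulrA sg2 mul1r.
  have pE : psi r 0 0 = r 0 0 by rewrite /psi row4E.
  split; first split.
  + by rewrite /U1 /= pE; exact: VU1.
  + by rewrite /= pE YE.
  + rewrite YE pE /psi !row4E /proj2 addrK; exact: row4K.
have -> : row4 ((0 : 'rV[R]_4) 0 0) (Y 0) ((0 : 'rV[R]_4) 0 o2 - k0 (pt ((0 : 'rV[R]_4) 0 0) (Y 0))) ((0 : 'rV[R]_4) 0 o3) = 0.
  by rewrite Y0 !mxE pt00 k00 subrr row4_0.
by [].
Qed.

(** Serves the cuspidal edge: B depends on X and V^2, which are the first two target coordinates, so
    V^3 B becomes V^3 by a division in the target. *)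
Lemma scale_germ d (B : 'rV[R]_2 -> R) : 0 < d -> smooth (box d) B -> (forall p, box d p -> B p != 0) ->
  diffeo_germ (fun v => row4 (v 0 0) (v 0 o1) (v 0 o2 / B (proj2 v)) (v 0 o3)) 0 0.
Proof.
move=> d0 sB B0.
have oB := @open_box R d.
pose V := proj2 @^-1` box d.
have oV : open V by apply: open_preimageT => //; exact: smooth_proj2 openT.
have sc (i : 'I_4) : smooth V (fun v : 'rV[R]_4 => v 0 i : R) by exact: smooth_coord.
have sBV : smooth V (fun v => B (proj2 v)).
  by apply: (smooth_comp oV _ _ sB) => //; exact: smooth_proj2.
have [] := @diffeo_germ_intro _ 4 (fun v => row4 (v 0 0) (v 0 o1) (v 0 o2 / B (proj2 v)) (v 0 o3))
  (fun v => row4 (v 0 0) (v 0 o1) (v 0 o2 * B (proj2 v)) (v 0 o3)) V V 0 oV oV.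
- by rewrite /V /= /proj2 !mxE; apply: box_pt; rewrite normr0.
- apply: smooth_row4 => //; apply: smooth_div => // v Vv; exact: B0.
- by apply: smooth_row4 => //; exact: smoothM.
- move=> v Vv; rewrite /V /= /proj2 !row4E divfK; last exact: B0.
  by split => //; exact: row4K.
- move=> v Vv; rewrite /V /= /proj2 !row4E mulfK; last exact: B0.
  by split => //; exact: row4K.
by rewrite !mxE mul0r row4_0.
Qed.

(** Serves the cross cap: B becomes the first coordinate both in the target, as a function of the
    first two coordinates, and in the source, where [k] solves B(k, V^2) = u without moving V. *)
Lemma straighten_germs d (B : 'rV[R]_2 -> R) : 0 < d -> smooth (box d) B -> B 0 = 0 ->
  'D_(e_t R) B 0 != 0 -> exists k : 'rV[R]_2 -> R,
  [/\ diffeo_germ (fun v => row4 (B (proj2 v)) (v 0 o1) (v 0 o2) (v 0 o3)) 0 0,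
      diffeo_germ (fun p => pt (k (pt (p 0 t_) (p 0 th_ ^+ 2))) (p 0 th_)) 0 0 &
      \forall p \near (0 : 'rV[R]_2), B (pt (k (pt ((p : 'rV[R]_2) 0 t_) (p 0 th_ ^+ 2))) (p 0 th_ ^+ 2)) = p 0 t_].
Proof.
move=> d0 sB B00 Bt; have oB := @open_box R d.
have [A1 [B1 [k [[oA1 oB1 AB sk] A10 AB1 BA1]]]] := implicit_t oB sB (box00 d0) Bt.
have B10 : B1 0 by have [] := AB1 _ A10; rewrite B00 mxE pt00.
have k00 : k 0 = 0 by have [_] := AB1 _ A10; rewrite B00 !mxE pt00.
exists k; split.
- pose U := proj2 @^-1` A1; pose V := proj2 @^-1` B1.
  have oU : open U by apply: open_preimageT => //; exact: smooth_proj2 openT.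
  have oV : open V by apply: open_preimageT => //; exact: smooth_proj2 openT.
  have sc (W : set 'rV[R]_4) (i : 'I_4) : open W -> smooth W (fun v : 'rV[R]_4 => v 0 i : R).
    by move=> oW; exact: smooth_coord.
  have P0 : proj2 0 = 0 by rewrite /proj2 !mxE pt00.
  have [] := @diffeo_germ_intro _ 4 (fun v => row4 (B (proj2 v)) (v 0 o1) (v 0 o2) (v 0 o3))
    (fun v => row4 (k (proj2 v)) (v 0 o1) (v 0 o2) (v 0 o3)) U V 0 oU oV.
  + by rewrite /U /= P0.
  + apply: smooth_row4 => //; try exact: sc.
    by apply: (smooth_comp oU _ _ (smooth_sub AB sB)) => //; exact: smooth_proj2.
  + apply: smooth_row4 => //; try exact: sc.
    by apply: (smooth_comp oV _ _ sk) => //; exact: smooth_proj2.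
  + move=> v Uv; have [h1 h2] := AB1 _ Uv; rewrite pt_t pt_th in h2; rewrite pt_th in h1 h2.
    by rewrite /V /= /proj2 !row4E; split => //; rewrite h2; exact: row4K.
  + move=> v Vv; have [h1 h2] := BA1 _ Vv; rewrite pt_t in h2; rewrite pt_th in h1 h2.
    by rewrite /U /= /proj2 !row4E; split => //; rewrite h2; exact: row4K.
  by rewrite P0 B00 !mxE row4_0.
- pose sqm (p : 'rV[R]_2) := pt (p 0 t_) (p 0 th_ ^+ 2).
  have ssq W : open W -> smooth W sqm.
    by move=> oW; apply: smooth_pt => //; [exact: smooth_coord|apply: smoothX => //; exact: smooth_coord].
  pose U := sqm @^-1` B1; pose V := sqm @^-1` A1.
  have oU : open U by apply: open_preimageT => //; exact: ssq openT.
  have oV : open V by apply: open_preimageT => //; exact: ssq openT.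
  have sq0 : sqm 0 = 0 by rewrite /sqm !mxE expr0n pt00.
  have [] := @diffeo_germ_intro _ 2 (fun p => pt (k (sqm p)) (p 0 th_))
    (fun p => pt (B (sqm p)) (p 0 th_)) U V 0 oU oV.
  + by rewrite /U /= sq0.
  + apply: smooth_pt => //; last exact: smooth_coord.
    by apply: (smooth_comp oU _ _ sk) => //; exact: ssq.
  + apply: smooth_pt => //; last exact: smooth_coord.
    by apply: (smooth_comp oV _ _ (smooth_sub AB sB)) => //; exact: ssq.
  + move=> p Up; have [h1 h2] := BA1 _ Up; rewrite pt_t in h2; rewrite pt_th in h1 h2.
    by rewrite /V /= /sqm !(pt_t, pt_th); split => //; rewrite h2 ptK.
  + move=> p Vp; have [h1 h2] := AB1 _ Vp; rewrite pt_t pt_th in h2; rewrite pt_th in h1 h2.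
    by rewrite /U /= /sqm !(pt_t, pt_th); split => //; rewrite h2 ptK.
  by rewrite sq0 k00 mxE pt00.
have sm : smooth setT (fun p : 'rV[R]_2 => pt (p 0 t_) (p 0 th_ ^+ 2)).
  by apply: smooth_pt => //; [exact: openT|exact: smooth_coord|apply: smoothX; [exact: openT|exact: smooth_coord]].
have oW := open_preimageT oB1 sm.
have W0 : ((fun p : 'rV[R]_2 => pt (p 0 t_) (p 0 th_ ^+ 2)) @^-1` B1) 0.
  by rewrite /= !mxE expr0n pt00.
apply: near_open oW W0 _ => p /= /BA1 [_].
by rewrite pt_t pt_th.
Qed.

End LeftGerms.

Section Sufficiency.
Variables (R : realType) (I : set R) (mu nu w E : R -> 'rV[R]_4) (D s e : R -> R).
Hypothesis fr : dual_frame I mu nu w E D s e.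
Variables (t0 th0 : R).
Hypotheses (It0 : I t0) (sth : sin th0 = 0).
Let F := dualF mu nu.

Lemma cuspidal_prenormal_form : exists d (phi : 'rV[R]_2 -> 'rV[R]_2) (Phi : 'rV[R]_4 -> 'rV[R]_4)
    (B : 'rV[R]_2 -> R) (kp1 kp2 : R),
  [/\ [/\ 0 < d, diffeo_germ phi 0 (pt t0 th0), diffeo_germ Phi (F (pt t0 th0)) 0 & smooth (box d) B],
      (forall X V, `|X| < d -> `|V| < d -> `|V ^+ 2| < d /\
         Phi (F (phi (pt X V))) = row4 X (V ^+ 2) (V ^+ 3 * B (pt X (V ^+ 2))) 0),
      (kp1 != 0 /\ B 0 = kp1 * e t0) &
      (kp2 != 0 /\ (e t0 = 0 -> forall e1, is_derive t0 (1 : R) e e1 -> 'D_(e_t R) B 0 = kp2 * e1))].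
Proof.
have [d [phi [K0 [k0 [B [sg [kp1 [kp2 [[d0 sgE G] [sK sk sB] HN H1 H2]]]]]]]]] := adapted_normal_form fr It0 sth.
have sg2 : sg * sg = 1 by case: sgE => ->; ring.
have z0 : `|0 : R| < d by rewrite normr0.
have F0 : F (pt t0 th0) = cos th0 *: mu t0 by rewrite /F /dualF pt_t pt_th sth scale0r addr0.
have [[mn mw mE] nw nE wE] := df_ort fr It0.
have phi0 : phi 0 = pt t0 th0 by have [U [V [psi [_ [_ ->] _ _ _]]]] := G.
have [_ _ w0 _ E0] := HN 0 0 z0 z0.
rewrite expr0n /= pt00 phi0 mulr0 addr0 -/F F0 lorZl mw mulr0 in w0.
rewrite !expr0n /= pt00 phi0 mul0r addr0 -/F F0 lorZl mE mulr0 in E0.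
have G1 := frame_germ (df_sq fr It0) (df_ort fr It0) (cos_sq1 sth).
have G2 := shear_germ d0 sg2 sK sk (esym w0) (esym E0).
rewrite -F0 in G1.
pose Phi0 v := row4 (lor v (nu t0)) (lor v (w t0)) (lor v (E t0)) (lor v v - 1).
pose Phi1 (v : 'rV[R]_4) := row4 (v 0 0) (sg * (v 0 o1 - K0 (pt (v 0 0) 0)))
     (v 0 o2 - k0 (pt (v 0 0) (sg * (v 0 o1 - K0 (pt (v 0 0) 0))))) (v 0 o3).
exists d, phi, (fun v => Phi1 (Phi0 v)), B, kp1, kp2; split => //.
  by split => //; exact: (diffeo_germ_comp G1 G2).
move=> X V hX hV; have [Ip x1 y1 hV2 z1] := HN X V hX hV; split => //.
rewrite /Phi1 /Phi0 !row4E x1 y1 z1 (lor_dualF_self fr Ip) subrr.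
have -> : sg * (K0 (pt X 0) + sg * V ^+ 2 - K0 (pt X 0)) = V ^+ 2.
  by rewrite addrC addKr mulrA sg2 mul1r.
by rewrite addrC addKr.
Qed.

Theorem dualF_cuspidal_edge : e t0 != 0 -> cuspidal_edge F (pt t0 th0).
Proof.
move=> e0.
have [d [phi [Phi [B [kp1 [kp2 [[d0 G1 G2 sB] HN [k1 EB] _]]]]]]] := cuspidal_prenormal_form.
have B0 : B 0 != 0 by rewrite EB mulf_neq0.
have [d1 d10 H1] : exists2 d1, 0 < d1 & forall p, box d1 p -> B p != 0.
  have cB := smooth_continuous sB (box00 d0).
  have n0 : 0 < `|B 0| by rewrite normr_gt0.
  have /cvgrPdist_lt /(_ _ n0) /box_of_near[d1 d10 H] := cB.
  by exists d1 => // p /H h; apply: contraTneq h => ->; rewrite subr0 ltxx.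
pose m := Num.min d d1.
have m0 : 0 < m by rewrite lt_min d0.
have md : m <= d by rewrite ge_min lexx.
have md1 : m <= d1 by rewrite ge_min lexx orbT.
have G3 := scale_germ m0 (smooth_sub (box_sub md) sB) (fun p Bp => H1 p (box_sub md1 Bp)).
exists phi, (fun v => row4 (Phi v 0 0) (Phi v 0 o1) (Phi v 0 o2 / B (proj2 (Phi v))) (Phi v 0 o3)); split => //.
  have -> : cusp_edge 0 = 0 :> 'rV[R]_4.
    by apply/rowP; apply: ord4P; rewrite !mxE //= expr0n.
  exact: (diffeo_germ_comp G2 G3).
pose U : set 'rV[R]_2 := (fun p => pt (p 0 t_) (p 0 th_ ^+ 2)) @^-1` box m.
have sm : smooth setT (fun p : 'rV[R]_2 => pt (p 0 t_) (p 0 th_ ^+ 2)).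
  by apply: smooth_pt => //; [exact: openT|exact: smooth_coord|apply: smoothX; [exact: openT|exact: smooth_coord]].
have oU : open U by apply: open_preimageT => //; exact: open_box.
have nU : \forall p \near (0 : 'rV[R]_2), U p.
  by apply: near_open oU _ _ => //; rewrite /U /= !mxE expr0n pt00; exact: box00.
have nB : \forall p \near (0 : 'rV[R]_2), box m p.
  by apply: near_open (@open_box R m) _ _ => //; exact: box00.
apply: (@filterS2 _ (nbhs (0 : 'rV[R]_2)) (nbhs_filter _) _ _ _ _ nU nB) => p Up [b1 b2].
have [hV EP] := HN (p 0 t_) (p 0 th_) (lt_le_trans b1 md) (lt_le_trans b2 md).
rewrite -{1 2 3 4 5}[p]ptK EP !row4E /proj2 !row4E mulfK; last exact: H1 _ (box_sub md1 Up).
by [].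
Qed.

Theorem dualF_cuspidal_crosscap e1 : e t0 = 0 -> is_derive t0 (1 : R) e e1 -> e1 != 0 ->
  cuspidal_crosscap F (pt t0 th0).
Proof.
move=> e0 De e10.
have [d [phi [Phi [B [kp1 [kp2 [[d0 G1 G2 sB] HN [k1 EB] [k2 EB']]]]]]]] := cuspidal_prenormal_form.
have B0 : B 0 = 0 by rewrite EB e0 mulr0.
have Bt : 'D_(e_t R) B 0 != 0 by rewrite (EB' e0 _ De) mulf_neq0.
have [k [G3 G4 Hk]] := straighten_germs d0 sB B0 Bt.
(* After this substitution B(X, V^2) equals the new first coordinate u, so the third component V^3 B
   reads u V^3. *)
pose psi (p : 'rV[R]_2) := pt (k (pt (p 0 t_) (p 0 th_ ^+ 2))) (p 0 th_).
exists (fun p => phi (psi p)),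
  (fun v => row4 (B (proj2 (Phi v))) (Phi v 0 o1) (Phi v 0 o2) (Phi v 0 o3)); split => //.
- exact: (diffeo_germ_comp G4 G1).
- have -> : cusp_crosscap 0 = 0 :> 'rV[R]_4.
    by apply/rowP; apply: ord4P; rewrite !mxE //= ?expr0n ?mul0r.
  exact: (diffeo_germ_comp G2 G3).
have npsi : \forall p \near (0 : 'rV[R]_2), box d (psi p).
  have [U [V [psi' [[oU oV] [U0 E0] [/smooth_onP sU _] _ _]]]] := G4.
  have cU := smooth_continuous sU U0.
  have E0' : psi 0 = 0 := E0.
  have : nbhs (psi 0) (box d).
    by rewrite E0'; apply: near_open (@open_box R d) _ _ => //; exact: box00.
  exact: cU.
apply: (@filterS2 _ (nbhs (0 : 'rV[R]_2)) (nbhs_filter _) _ _ _ _ npsi Hk) => p [b1 b2] Bk.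
rewrite pt_t in b1; rewrite pt_th in b2.
have [hV EP] := HN _ _ b1 b2.
rewrite /psi EP !row4E /proj2 !row4E Bk.
by rewrite mulrC.
Qed.

End Sufficiency.

(** * Necessity of the criteria *)

Section VanishCusp.
Variable R : realType.

Lemma vanish_near (f : R -> R) n L : f 0 = 0 ->
  (forall eps, 0 < eps -> \forall r \near (0 : R), `|f r - r ^+ n.+1 * L| <= eps * `|r| ^+ n.+1) ->
  vanish f 0 n.+1 L.
Proof.
move=> f0 H; exists (fun r => if r == 0 then L else f r / r ^+ n.+1); split; last 2 first.
- by rewrite eqxx.
- move=> r; rewrite subr0; case: eqP => [->|/eqP r0]; first by rewrite f0 expr0n mul0r.
  by rewrite mulrC divfK // expf_neq0.
apply/(@cvgrPdist_le _ _ _ (nbhs (0 : R)) (nbhs_filter _)) => eps eps0; rewrite eqxx.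
apply: filterS (H _ eps0) => r hr; case: eqP => [_|/eqP r0]; first by rewrite subrr normr0 ltW.
have rn : r ^+ n.+1 != 0 by rewrite expf_neq0.
have -> : L - f r / r ^+ n.+1 = - (f r - r ^+ n.+1 * L) / r ^+ n.+1 by field.
by rewrite normrM normrN normfV ler_pdivrMr ?normr_gt0 // normrX.
Qed.

Lemma vanish_unique (f : R -> R) x n L K : vanish f x n L -> vanish f x n K -> L = K.
Proof. by move=> v1 v2; apply: (vanish_uniq v1 v2); exact: filterE. Qed.

Lemma vanish_cst (x c : R) : vanish (fun=> c) x 0 c.
Proof. by apply: (@vanish0 R (fun=> c)); exact: cvg_cst. Qed.

Lemma sub_eq_eq (x y c : R) : x = c -> y = c -> x - y = 0.
Proof. by move=> -> ->; rewrite subrr. Qed.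

Lemma near_mono (k d : R) n : 0 < d -> \forall r \near (0 : R), `|k * r ^+ n.+1| < d.
Proof.
move=> d0; have D : is_derive (0 : R) (1 : R) (fun r : R => k * r ^+ n.+1) (k * (n.+1%:R * 0 ^+ n * 1)).
  exact: (is_deriveZ k (is_derive1X n.+1 (is_derive_id (0 : R) (1 : R)))).
have /cvgrPdist_lt /(_ _ d0) := is_derive_continuous D.
by rewrite expr0n mulr0; apply: filterS => r; rewrite sub0r normrN.
Qed.

Variables (f : 'rV[R]_2 -> R) (d : R).
Hypotheses (d0 : 0 < d) (sf : smooth (box d) f).

(** The points have equal first coordinates, so one mean value theorem in the second variable
    suffices. With k2 = -k1 this isolates the part odd in r along a cusp. *)
Lemma vanish_cubic k1 k2 : vanish (fun r => f (pt (r ^+ 2) (k1 * r ^+ 3)) - f (pt (r ^+ 2) (k2 * r ^+ 3)))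
   0 3 ((k1 - k2) * 'D_(e_th R) f 0).
Proof.
apply: vanish_near; first by rewrite !expr0n /= !mulr0 subrr.
move=> eps eps0.
pose eps' := eps / (`|k1 - k2| + 1).
have kp : 0 < `|k1 - k2| + 1 by rewrite ltr_wpDl.
have eps'0 : 0 < eps' by rewrite divr_gt0.
have cD := smooth_continuous (smooth_derive (e_th R) sf) (box00 d0).
have /cvgrPdist_le /(_ _ eps'0) /box_of_near[d1 d10 H1] := cD.
pose m := Num.min d d1.
have m0 : 0 < m by rewrite lt_min d0.
have n1 := near_mono k1 2 m0; have n2 := near_mono k2 2 m0; have n3 := near_mono 1 1 m0.
apply: filterS3 n1 n2 n3 => r r1 r2; rewrite mul1r => r3.
have [||||c [Jc _ ->]] := @MVT_interval _ [set z | `|z - 0| < m] (fun y => f (pt (r ^+ 2) y))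
  (fun y => 'D_(e_th R) f (pt (r ^+ 2) y)) (k2 * r ^+ 3) (k1 * r ^+ 3).
- exact: is_interval_dist.
- move=> y /=; rewrite subr0 => hy; apply/is_derive_thP/derivableP/(smooth_derivable sf).
  by apply: (@box_sub _ _ m); [rewrite ge_min lexx|exact: box_pt].
- by rewrite /= subr0.
- by rewrite /= subr0.
rewrite /= subr0 in Jc.
have -> : 'D_(e_th R) f (pt (r ^+ 2) c) * (k1 * r ^+ 3 - k2 * r ^+ 3) - r ^+ 3 * ((k1 - k2) * 'D_(e_th R) f 0)
  = r ^+ 3 * ((k1 - k2) * ('D_(e_th R) f (pt (r ^+ 2) c) - 'D_(e_th R) f 0)) by ring.
rewrite normrM normrX (normrM (k1 - k2)) mulrC ler_wpM2r ?exprn_ge0 //.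
have B : `|'D_(e_th R) f (pt (r ^+ 2) c) - 'D_(e_th R) f 0| <= eps'.
  rewrite distrC; apply: H1; apply: (@box_sub _ _ m); first by rewrite ge_min lexx orbT.
  exact: box_pt.
apply: (@le_trans _ _ ((`|k1 - k2| + 1) * eps')).
  by apply: ler_pM => //; rewrite lerDl.
by rewrite /eps' mulrC divfK // gt_eqF.
Qed.

Lemma vanish_quadratic k : vanish (fun r => f (pt (r ^+ 2) (k * r ^+ 3)) - f 0) 0 2 ('D_(e_t R) f 0).
Proof.
have D : is_derive (0 : R) (1 : R) (fun x => f (pt x 0)) ('D_(e_t R) f 0).
  have -> : 'D_(e_t R) f 0 = 'D_(e_t R) f (pt 0 0) by rewrite pt00.
  by apply/is_derive_tP/derivableP/(smooth_derivable sf); apply: box_pt; rewrite normr0.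
have [A [EA cA A0]] := (is_derive1_caratheodory _ _ _).1 D.
have v1 := vanishW (vanish_cubic k 0).
have v2 : vanish (fun r => f (pt (r ^+ 2) 0) - f 0) 0 2 ('D_(e_t R) f 0).
  exists (fun r => A (r ^+ 2)); split.
  - apply: (@continuous_compR _ (fun r : R => r ^+ 2) A); first exact: exprn_continuous.
    by rewrite expr0n.
  - by rewrite expr0n.
  - by move=> r; have := EA (r ^+ 2); rewrite pt00 !subr0 => ->; rewrite mulrC.
have := vanishD v1 v2; rewrite add0r.
have -> : (fun r => f (pt (r ^+ 2) (k * r ^+ 3)) - f (pt (r ^+ 2) (0 * r ^+ 3)) + (f (pt (r ^+ 2) 0) - f 0)) =
  (fun r => f (pt (r ^+ 2) (k * r ^+ 3)) - f 0).
  by apply/funext => r; rewrite mul0r; ring.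
by [].
Qed.

End VanishCusp.

Section Necessity.
Variables (R : realType) (I : set R) (mu nu w E : R -> 'rV[R]_4) (D s e : R -> R).
Hypothesis fr : dual_frame I mu nu w E D s e.
Variables (t0 th0 : R).
Hypotheses (It0 : I t0) (sth : sin th0 = 0).
Let F := dualF mu nu.

(** A common form of both models: [eta] constant 1 is the cuspidal edge, [eta] the identity is the
    cuspidal cross cap. *)
Definition cusp_family (eta : R -> R) (z : 'rV[R]_2) : 'rV[R]_4 :=
  row4 (z 0 t_) (z 0 th_ ^+ 2) (eta (z 0 t_) * z 0 th_ ^+ 3) 0.

Lemma derive_left_inverse n (phi psi : 'rV[R]_n -> 'rV[R]_n) z v :
  differentiable phi z -> differentiable psi (phi z) -> (\forall y \near z, psi (phi y) = y) ->
  'D_('D_v phi z) psi (phi z) = v.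
Proof.
move=> d1 d2 H.
have -> : 'D_('D_v phi z) psi (phi z) = 'D_v (psi \o phi) z.
  rewrite (deriveE _ d2) (deriveE _ d1) (deriveE v (differentiable_comp d1 d2)).
  exact: (esym (congr1 (fun h => h v) (diff_comp d1 d2))).
have -> : 'D_v (psi \o phi) z = 'D_v id z by exact: near_eq_derive.
by rewrite derive_id.
Qed.

Lemma row4_line (u x y : R) : row4 u 0 y 0 + x *: delta_mx 0 o1 = row4 u x y 0 /\
  row4 u x 0 0 + y *: delta_mx 0 o2 = row4 u x y 0 /\ row4 0 x y 0 + u *: delta_mx 0 0 = row4 u x y 0.
Proof.
by do !split; apply/rowP; apply: ord4P; rewrite ?row4E !mxE /=; ring.
Qed.

Lemma lor_combination0 (x1 x2 x3 x4 al be : R) (p1 p2 p3 p4 y z : 'rV[R]_4) :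
  lor p1 y = 0 -> lor p1 z = 0 -> lor p2 y = 0 -> lor p2 z = 0 -> lor p3 y = 0 -> lor p3 z = 0 ->
  al * lor p4 y + be * lor p4 z = 0 ->
  lor (x1 *: p1 + x2 *: p2 + x3 *: p3 + x4 *: p4) (al *: y + be *: z) = 0.
Proof.
move=> p1y p1z p2y p2z p3y p3z H; rewrite lorDr !lorZr !lorDl !lorZl p1y p1z p2y p2z p3y p3z.
by rewrite !mulr0 !add0r !(mulrCA _ x4) -mulrDr H mulr0.
Qed.

(** [W u] is the E-component, at the parameter [tt u], of the third partial derivative of the
    inverse target diffeomorphism [Psi]. Comparing third-order terms gives the relation at once; the
    substance is [W 0 != 0], which follows from the invertibility of the differential of [Psi]. *)
Theorem cusp_family_necessity (eta : R -> R) : (forall u, u != 0 -> eta u != 0) ->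
  A_equiv F (pt t0 th0) (cusp_family eta) 0 ->
  exists (K W tt : R -> R) (tau : R),
   [/\ {for 0, continuous K} /\ K 0 != 0, {for 0, continuous W} /\ W 0 != 0,
       tt 0 = t0 /\ is_derive (0 : R) (1 : R) tt tau &
       \forall u \near (0 : R), eta u * W u = K u * e (tt u)].
Proof.
move=> eta0 [phi [Phi [G1 G2 near_eq]]].
have g0 : cusp_family eta 0 = 0.
  by rewrite /cusp_family !mxE !expr0n /= mulr0 row4_0.
rewrite g0 in G2.
have [U1 [V1 [psi1 [[oU1 oV1] [U10 phi0] [/smooth_onP sphi /smooth_onP spsi1] UV1 VU1]]]] := G1.
have [U2 [V2 [Psi [[oU2 oV2] [U20 Phi0] [/smooth_onP sPhi /smooth_onP sPsi] UV2 VU2]]]] := G2.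
have oS := open_strip fr; have sF := smooth_dualF fr.
pose O := strip I `&` F @^-1` U2.
have oO : open O by exact: open_preimage.
have O0 : O (phi 0) by rewrite phi0; split => //; rewrite /strip /= pt_t.
have [d d0 Hd] : exists2 d : R, 0 < d & forall z : 'rV[R]_2, box d z -> [/\ U1 z, O (phi z) & Phi (F (phi z)) = cusp_family eta z].
  apply: box_of_near.
  have n1 : \forall z \near (0 : 'rV[R]_2), U1 z by exact: near_open U10 _.
  have n2 : \forall z \near (0 : 'rV[R]_2), O (phi z).
    by apply: (smooth_continuous sphi U10); exact: near_open O0 _.
  by apply: (@filterS3 _ (nbhs (0 : 'rV[R]_2)) (nbhs_filter _) _ _ _ _ _ n1 n2 near_eq).
have EPsi (z : 'rV[R]_2) : box d z -> V2 (cusp_family eta z) /\ F (phi z) = Psi (cusp_family eta z).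
  by move=> /Hd [_ [_ Uz] Ez]; have [h1 h2] := UV2 _ Uz; rewrite Ez in h1 h2.
have zd : `|0 : R| < d by rewrite normr0.
have Psi0 : Psi 0 = F (pt t0 th0) by have [_] := UV2 _ U20; rewrite Phi0.
have V20 : V2 0 by have [+ _] := UV2 _ U20; rewrite Phi0.
pose tt (u : R) := phi (pt u 0) 0 t_.
pose bb (u : R) := phi (pt u 0) 0 th_.
pose xi (u : R) := 'D_(e_th R) phi (pt u 0).
have ttI (u : R) : `|u| < d -> I (tt u) by move=> hu; have [_ [h _] _] := Hd _ (box_pt hu zd).
pose e1 : 'rV[R]_4 := delta_mx 0 0; pose e2 : 'rV[R]_4 := delta_mx 0 o1; pose e3 : 'rV[R]_4 := delta_mx 0 o2.
pose P3 (u : R) := 'D_e3 Psi (row4 u 0 0 0).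
have famE u r : cusp_family eta (pt u r) = row4 u (r ^+ 2) (eta u * r ^+ 3) 0.
  by rewrite /cusp_family pt_t pt_th.
have V2u (u : R) : `|u| < d -> V2 (row4 u 0 0 0).
  by move=> hu; have [+ _] := EPsi _ (box_pt hu zd); rewrite famE !expr0n /= mulr0.
(* The inverse diffeomorphism on the plane containing the model curve r -> (u, r^2, eta(u) r^3,
   0). *)
pose f2 (u : R) (y : 'rV[R]_4) (p : 'rV[R]_2) : R := lor (Psi (row4 u (p 0 t_) (p 0 th_) 0)) y.
have sPsiy (y : 'rV[R]_4) : smooth V2 (fun v => lor (Psi v) y).
  by apply: smooth_lor => //; exact: smooth_cst_rV.
have f2P (u : R) (y : 'rV[R]_4) : `|u| < d -> exists d1 : R, [/\ 0 < d1, smooth (box d1) (f2 u y),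
    'D_(e_t R) (f2 u y) 0 = lor ('D_e2 Psi (row4 u 0 0 0)) y & 'D_(e_th R) (f2 u y) 0 = lor (P3 u) y].
  move=> hu; pose h (p : 'rV[R]_2) := row4 u (p 0 t_) (p 0 th_) 0.
  have oT : open (setT : set 'rV[R]_2) by exact: openT.
  have sh (W : set 'rV[R]_2) : open W -> smooth W h.
    by move=> oW; apply: smooth_row4 => //; [exact: smooth_cst|exact: smooth_coord|exact: smooth_coord|exact: smooth_cst].
  have oW : open (h @^-1` V2) by apply: open_preimageT => //; exact: sh.
  have W0 : (h @^-1` V2) 0 by rewrite /= /h !mxE; exact: V2u.
  have [d1 d10 H1] := box_of_open oW W0.
  have oB := @open_box R d1.
  exists d1; split => //.
  - exact: (@smooth_comp _ _ _ _ V2 h _ oB H1 (sh _ oB) (sPsiy y)).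
  - have D0 : differentiable Psi (row4 u 0 0 0) by apply: (smooth_diff sPsi); exact: V2u.
    rewrite -(derive_lor _ _ D0).
    have [L1 _] := row4_line u 0 0.
    have : is_derive (row4 u 0 0 0 + 0 *: e2) e2 (fun v => lor (Psi v) y) ('D_e2 (fun v => lor (Psi v) y) (row4 u 0 0 0)).
      by rewrite L1; apply: derivableP; apply: (smooth_derivable (sPsiy y)); exact: V2u.
    move/is_derive_line => H.
    have : is_derive (pt 0 0) (e_t R) (f2 u y) ('D_e2 (fun v => lor (Psi v) y) (row4 u 0 0 0)).
      apply/is_derive_tP.
      have -> : (fun x => f2 u y (pt x 0)) = (fun x => lor (Psi (row4 u 0 0 0 + x *: e2)) y); last by [].
      by apply/funext => x; rewrite /f2 pt_t pt_th; have [-> _] := row4_line u x 0.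
    by rewrite pt00 => -[].
  - have D0 : differentiable Psi (row4 u 0 0 0) by apply: (smooth_diff sPsi); exact: V2u.
    rewrite /P3 -(derive_lor _ _ D0).
    have [_ [L1 _]] := row4_line u 0 0.
    have : is_derive (row4 u 0 0 0 + 0 *: e3) e3 (fun v => lor (Psi v) y) ('D_e3 (fun v => lor (Psi v) y) (row4 u 0 0 0)).
      by rewrite L1; apply: derivableP; apply: (smooth_derivable (sPsiy y)); exact: V2u.
    move/is_derive_line => H.
    have : is_derive (pt 0 0) (e_th R) (f2 u y) ('D_e3 (fun v => lor (Psi v) y) (row4 u 0 0 0)).
      apply/is_derive_thP.
      have -> : (fun x => f2 u y (pt 0 x)) = (fun x => lor (Psi (row4 u 0 0 0 + x *: e3)) y); last by [].
      by apply/funext => x; rewrite /f2 pt_t pt_th; have [_ [-> _]] := row4_line u 0 x.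
    by rewrite pt00 => -[].
pose c (u r : R) := F (phi (pt u r)).
have cE (u : R) (y : 'rV[R]_4) (r : R) : `|u| < d -> `|r| < d -> lor (c u r) y = f2 u y (pt (r ^+ 2) (eta u * r ^+ 3)).
  by move=> hu hr; have [_ h] := EPsi _ (box_pt hu hr); rewrite /c h famE /f2 pt_t pt_th.
have odd (u : R) (y : 'rV[R]_4) : `|u| < d -> vanish (fun r => lor (c u r) y - lor (c u (- r)) y) 0 3 (2 * eta u * lor (P3 u) y).
  move=> hu; have [d1 [d10 s1 _ E3]] := f2P u y hu.
  have := vanish_cubic d10 s1 (eta u) (- eta u); rewrite E3 opprK -mulr2n -[eta u *+ 2]mulr_natl.
  move=> [M [cM M0 EM]].
  have H : vanish (fun r => f2 u y (pt (r ^+ 2) (eta u * r ^+ 3)) - f2 u y (pt (r ^+ 2) (- eta u * r ^+ 3))) 0 3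
    (2 * eta u * lor (P3 u) y) by exists M.
  apply: vanish_near; first by rewrite oppr0 subrr.
  move=> eps eps0.
  have /cvgrPdist_le /(_ _ eps0) n1 := cM.
  apply: filterS2 (near0_lt d0) n1 => r hr hM.
  rewrite !cE ?normrN //.
  have -> : (- r) ^+ 2 = r ^+ 2 by ring.
  have -> : eta u * (- r) ^+ 3 = - eta u * r ^+ 3 by ring.
  rewrite EM subr0 M0 in hM *.
  have -> : r ^+ 3 * M r - r ^+ 3 * (2 * eta u * lor (P3 u) y) = r ^+ 3 * (M r - 2 * eta u * lor (P3 u) y) by ring.
  by rewrite normrM normrX mulrC ler_wpM2r ?exprn_ge0 // distrC.
have dc (u : R) : `|u| < d -> is_derive (0 : R) (1 : R) (fun r => phi (pt u r)) (xi u).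
  move=> hu; have [h _ _] := Hd _ (box_pt hu zd).
  by apply/is_derive_thP/derivableP/(smooth_derivable sphi).
(* The model curve has zero velocity at r = 0, so [xi u] lies in the kernel of the differential of
   F; it is nonzero because [phi] is a diffeomorphism. *)
have ker (u : R) : `|u| < d -> [/\ sin (bb u) = 0, xi u 0 th_ = D (tt u) * xi u 0 t_ & xi u 0 t_ != 0].
  move=> hu; have Bu := box_pt hu zd; have [h1 [h2 _] _] := Hd _ Bu.
  have xi0 : xi u != 0.
    have Dl : 'D_(xi u) psi1 (phi (pt u 0)) = e_th R.
      apply: derive_left_inverse.
      - exact: smooth_diff sphi h1.
      - by have [h _] := UV1 _ h1; exact: smooth_diff spsi1 h.
      - by apply: near_open h1 _ => // z /UV1 [].
    apply: contra_eq_neq Dl => ->; rewrite derive0 eq_sym.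
    by apply/eqP => /(congr1 (fun q : 'rV[R]_2 => q 0 th_)); rewrite e_th_th mxE => /eqP; rewrite oner_eq0.
  have dcu : differentiable (fun r => phi (pt u r)) 0.
    by apply/derivable1_diffP; have [] := dc u hu.
  have H1 := is_derive_curve dcu (smooth_diff sF h2).
  have Dfam : is_derive (0 : R) (1 : R) (fun r => cusp_family eta (pt u r)) 0.
    apply: is_derive_row_intro; apply: ord4P; rewrite mxE.
    + have -> : (fun t => cusp_family eta (pt u t) 0 0) = cst u by apply/funext => r; rewrite famE row4E.
      exact: is_derive_cst.
    + have -> : (fun t => cusp_family eta (pt u t) 0 o1) = (fun t => t ^+ 2) by apply/funext => r; rewrite famE row4E.
      by apply: (@is_derive_eq _ _ _ _ _ _ _ _ (is_derive1X 2 (is_derive_id (0 : R) (1 : R)))); rewrite expr1 mulr0 mul0r.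
    + have -> : (fun t => cusp_family eta (pt u t) 0 o2) = (fun t => eta u * t ^+ 3) by apply/funext => r; rewrite famE row4E.
      apply: (@is_derive_eq _ _ _ _ _ _ _ _ (is_deriveZ (eta u) (is_derive1X 3 (is_derive_id (0 : R) (1 : R))))).
      by rewrite expr0n mulr0 mul0r /GRing.scale /= mulr0.
    + have -> : (fun t => cusp_family eta (pt u t) 0 o3) = cst 0 by apply/funext => r; rewrite famE row4E.
      exact: is_derive_cst.
  have dfam : differentiable (fun r => cusp_family eta (pt u r)) 0 by apply/derivable1_diffP; have [] := Dfam.
  have [Vu _] := EPsi _ Bu.
  have H2 := is_derive_curve dfam (smooth_diff sPsi Vu).
  have H3 : is_derive (0 : R) (1 : R) (fun r => F (phi (pt u r))) ('D_('D_1 (fun r => cusp_family eta (pt u r)) 0) Psi (cusp_family eta (pt u 0))).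
    apply: (near_eq_is_derive _ H2).
    by apply: filterS (near0_lt d0) => r hr; have [_ ->] := EPsi _ (box_pt hu hr).
  have [_ E1] := H1; have [_ E3] := H3; have [_ Ex] := dc u hu; have [_ Ef] := Dfam.
  move: E1; rewrite E3 Ef derive0 Ex => /esym E1.
  have [k1 k2] := kernel_dualF fr h2 E1.
  have xt0 : xi u 0 t_ != 0.
    apply: contraNneq xi0 => h; apply/eqP; apply: eq_pt; rewrite mxE //.
    by rewrite k2 h mulr0.
  split => //.
  by apply: (mulIf xt0); rewrite k1 mul0r.
have cosu (u : R) : `|u| < d -> cos (bb u) * cos (bb u) = 1.
  by move=> hu; have [h _ _] := ker _ hu; exact: cos_sq1 h.
have c0E (u : R) : `|u| < d -> c u 0 = cos (bb u) *: mu (tt u).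
  by move=> hu; have [h _ _] := ker _ hu; rewrite /c /F /dualF -/(bb u) h scale0r addr0.
have vE (u : R) : `|u| < d -> vanish (fun r => lor (c u r) (E (tt u))) 0 3
    (- (cos (bb u) * D (tt u) * s (tt u) * xi u 0 t_ ^+ 3 * e (tt u) / 3)).
  move=> hu; have [k1 k2 k3] := ker _ hu.
  have da := is_derive_row t_ (dc _ hu); have db := is_derive_row th_ (dc _ hu).
  rewrite k2 mulrC in db.
  have := vanish_dualF_E fr (ttI _ hu) k1 (erefl (tt u)) (erefl (bb u)) da db.
  have -> : (fun r => lor (dualF mu nu (pt (phi (pt u r) 0 t_) (phi (pt u r) 0 th_))) (E (tt u))) =
    (fun r => lor (c u r) (E (tt u))) by apply/funext => r; rewrite ptK.
  by [].
pose K (u : R) := - (cos (bb u) * D (tt u) * s (tt u) * xi u 0 t_ ^+ 3 / 3).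
have rel (u : R) : `|u| < d -> eta u * lor (P3 u) (E (tt u)) = K u * e (tt u).
  move=> hu; have [M [cM M0 EM]] := vE u hu.
  have H : vanish (fun r => lor (c u r) (E (tt u)) - lor (c u (- r)) (E (tt u))) 0 3 (M 0 + M (- 0)).
    exists (fun r => M r + M (- r)); split => //.
      by apply: cvgD => //; exact: continuous_opp0.
    by move=> r; rewrite !EM !subr0; ring.
  have := vanish_unique (odd u (E (tt u)) hu) H; rewrite oppr0 M0 => E0.
  apply: (@mulfI _ 2); first by rewrite pnatr_eq0.
  rewrite mulrA E0.
  by rewrite /K; field.
(* The values of [lor F F] at r and -r agree. In the factored difference only the mu component
   survives at order three, since [c u 0] is a multiple of mu; [eta u] can then be cancelled. *)
have mu0 (u : R) : `|u| < d -> u != 0 -> lor (P3 u) (mu (tt u)) = 0.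
  move=> hu u0; have It := ttI _ hu.
  have [mm nn ww EE] := df_sq fr It; have [[mn mw mE] nw nE wE] := df_ort fr It.
  have cont (y : 'rV[R]_4) : {for 0, continuous (fun r => lor (c u r) y)}.
    have [h1 [h2 _] _] := Hd _ (box_pt hu zd).
    have dcu : differentiable (fun r => phi (pt u r)) 0 by apply/derivable1_diffP; have [] := dc u hu.
    have := is_derive_curve dcu (smooth_diff (smooth_lor oS sF (smooth_cst_rV y oS)) h2).
    exact: is_derive_continuous.
  have sumv (y : 'rV[R]_4) : vanish (fun r => lor (c u r) y + lor (c u (- r)) y) 0 0 (2 * lor (c u 0) y).
    have H : {for 0, continuous (fun r => lor (c u r) y + lor (c u (- r)) y)}.
      by apply: cvgD; [exact: cont|exact: continuous_opp0 (cont y)].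
    by apply: vanish_eq (vanish0 H) _; rewrite oppr0; ring.
  have prod (y : 'rV[R]_4) := vanishM (odd u y hu) (sumv y).
  have pn := prod (nu (tt u)); have pw := prod (w (tt u)); have pE := prod (E (tt u)); have pm := prod (mu (tt u)).
  rewrite c0E // !lorZl mn mw mE mm !mulr0 in pn pw pE pm.
  have tot := vanishD (vanishD (vanishD pm pn) pw) (vanishM (vanish_cst 0 (-1)) pE).
  have z0 : vanish (fun=> 0 : R) 0 (3 + 0) 0.
    by exists (fun=> 0); split => //; [exact: cvg_cst|move=> ?; rewrite mulr0].
  have := vanish_uniq tot z0 _.
  rewrite !addr0 mulr0 !addr0 mulr1 => H.
  have : 2 * eta u * lor (P3 u) (mu (tt u)) * (2 * cos (bb u)) = 0.
    apply: H; apply: filterS (near0_lt d0) => r hr.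
    have l1 (r' : R) : `|r'| < d -> lor (c u r') (c u r') = 1.
      by move=> h; apply: (lor_dualF_self fr); have [_ [h2 _] _] := Hd _ (box_pt hu h).
    have hrN : `|- r| < d by rewrite normrN.
    have := l1 _ hr; have := l1 _ hrN.
    rewrite !(frame_lor_self (df_sq fr It) (df_ort fr It)) => q1 q2.
    by rewrite -[RHS](sub_eq_eq q2 q1); ring.
  have cb : cos (bb u) != 0.
    by apply: contra_eq_neq (cosu _ hu) => ->; rewrite mul0r eq_sym oner_eq0.
  move/eqP; rewrite !mulf_eq0 pnatr_eq0 /= (negbTE (eta0 _ u0)) (negbTE cb) /= orbF.
  by move/eqP.
have dphit : is_derive (0 : R) (1 : R) (fun u => phi (pt u 0)) ('D_(e_t R) phi (pt 0 0)).
  by apply/is_derive_tP/derivableP/(smooth_derivable sphi); rewrite pt00.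
have Dtt : is_derive (0 : R) (1 : R) tt ('D_(e_t R) phi (pt 0 0) 0 t_) := is_derive_row t_ dphit.
have Dbb : is_derive (0 : R) (1 : R) bb ('D_(e_t R) phi (pt 0 0) 0 th_) := is_derive_row th_ dphit.
have tt0 : tt 0 = t0 by rewrite /tt pt00 phi0 pt_t.
have bb0 : bb 0 = th0 by rewrite /bb pt00 phi0 pt_th.
have [mm nn ww EE] := df_sq fr It0; have [[mn mw mE] nw nE wE] := df_ort fr It0.
have ctt : {for 0, continuous tt} by exact: is_derive_continuous Dtt.
have cP3 (y : R -> 'rV[R]_4) dy : is_derive t0 (1 : R) y dy ->
    {for 0, continuous (fun u => lor (P3 u) (y (tt u)))}.
  move=> Dy; rewrite /lor.
  have cy j : {for 0, continuous (fun u => y (tt u) 0 j)}.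
    apply: (@continuous_compR _ tt (fun t => y t 0 j)) => //; rewrite tt0.
    exact: is_derive_continuous (is_derive_row j Dy).
  have cp j : {for 0, continuous (fun u => P3 u 0 j)}.
    have sP : smooth V2 (fun v => 'D_e3 Psi v 0 j).
      by move/smooth_rV: (smooth_derive e3 sPsi); exact.
    have := @is_derive_line _ 4 (fun v => 'D_e3 Psi v 0 j) 0 e1 0.
    have V0 : V2 (0 + 0 *: e1) by rewrite scale0r addr0.
    have H := derivableP (smooth_derivable (v := e1) sP V0).
    move=> /(_ _ H) /is_derive_continuous.
    have Ef : (fun s => 'D_e3 Psi (0 + s *: e1) 0 j) = (fun u => P3 u 0 j).
      by apply/funext => u; have [_ [_ h]] := row4_line u 0 0; rewrite /P3 -h row4_0.
    by move=> Hc; exact: (eq_ind _ (fun f : R -> R => {for 0, continuous f}) Hc _ Ef).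
  have cpy j : {for 0, continuous (fun u => P3 u 0 j * y (tt u) 0 j)} by exact: cvgM (cp j) (cy j).
  have -> : (fun u => - P3 u 0 0 * y (tt u) 0 0 + P3 u 0 o1 * y (tt u) 0 o1 + P3 u 0 o2 * y (tt u) 0 o2 + P3 u 0 o3 * y (tt u) 0 o3)
    = (fun u => - (P3 u 0 0 * y (tt u) 0 0) + P3 u 0 o1 * y (tt u) 0 o1 + P3 u 0 o2 * y (tt u) 0 o2 + P3 u 0 o3 * y (tt u) 0 o3).
    by apply/funext => u; rewrite mulNr.
  by apply: cvgD; [apply: cvgD; [apply: cvgD; [apply: cvgN|]|]|]; exact: cpy.
(* For the cross cap [eta] vanishes at 0, so the value there is reached by continuity in u. *)
have P3mu : lor (P3 0) (mu t0) = 0.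
  rewrite -tt0; apply: (@continuous_eq_at _ (fun u => lor (P3 u) (mu (tt u))) (fun=> 0)).
  - exact: cP3 (df_dmu fr It0).
  - exact: cst_continuous.
  near=> u; apply: mu0; first by near: u; exact: dnbhs0_lt.
  by near: u; exact: nbhs_dnbhs_neq.
have row0 : row4 0 0 0 0 = 0 :> 'rV[R]_4 := row4_0 R.
have [_ sth1 xi00] := ker 0 zd.
pose P1 := 'D_e1 Psi 0; pose P2 := 'D_e2 Psi 0; pose P4 := 'D_(delta_mx 0 o3) Psi 0.
have c00 : c 0 0 = cos th0 *: mu t0 by rewrite c0E // tt0 bb0.
have P2y (y : 'rV[R]_4) : vanish (fun r => lor (c 0 r) y - lor (c 0 0) y) 0 2 (lor P2 y).
  have [d1 [d10 s1 E2 _]] := f2P 0 y zd; rewrite row0 in E2.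
  have := vanish_quadratic d10 s1 (eta 0); rewrite E2 => -[M [cM M0 EM]].
  apply: vanish_near; first by rewrite subrr.
  move=> eps eps0; have /cvgrPdist_le /(_ _ eps0) n1 := cM.
  apply: filterS2 (near0_lt d0) n1 => r hr hM.
  rewrite !cE // !expr0n /= mulr0 pt00 EM subr0 M0 in hM *.
  have -> : r ^+ 2 * M r - r ^+ 2 * lor P2 y = r ^+ 2 * (M r - lor P2 y) by ring.
  by rewrite normrM normrX mulrC ler_wpM2r ?exprn_ge0 // distrC.
have P2E : lor P2 (E t0) = 0.
  have v3 := vanishW (vE 0 zd); rewrite tt0 in v3.
  apply: (vanish_uniq (P2y (E t0)) v3); apply: filterE => r.
  by rewrite c00 lorZl mE mulr0 subr0.
(* The same factorisation of [lor F F], now between r and 0, read at order two. *)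
have P2mu : lor P2 (mu t0) = 0.
  have cb : cos th0 != 0.
    by apply: contra_eq_neq (cos_sq1 sth) => ->; rewrite mul0r eq_sym oner_eq0.
  have contv (y : 'rV[R]_4) : vanish (fun r => lor (c 0 r) y + lor (c 0 0) y) 0 0 (lor (c 0 0) y + lor (c 0 0) y).
    have [M [cM M0 EM]] := P2y y.
    have H : {for 0, continuous (fun r => lor (c 0 r) y + lor (c 0 0) y)}.
      have -> : (fun r => lor (c 0 r) y + lor (c 0 0) y) = (fun r => (r ^+ 2 * M r) + (lor (c 0 0) y + lor (c 0 0) y)).
        by apply/funext => r; have := EM r; rewrite subr0 => <-; ring.
      apply: cvgD; last exact: cvg_cst.
      by apply: cvgM => //; exact: exprn_continuous.
    exact: vanish0 H.
  have prod (y : 'rV[R]_4) := vanishM (P2y y) (contv y).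
  have pn := prod (nu t0); have pw := prod (w t0); have pE := prod (E t0); have pm := prod (mu t0).
  rewrite c00 !lorZl mn mw mE mm !mulr0 in pn pw pE pm.
  have tot := vanishD (vanishD (vanishD pm pn) pw) (vanishM (vanish_cst 0 (-1)) pE).
  have z0 : vanish (fun=> 0 : R) 0 (2 + 0) 0.
    by exists (fun=> 0); split => //; [exact: cvg_cst|move=> ?; rewrite mulr0].
  have := vanish_uniq tot z0 _.
  rewrite !addr0 !mulr0 !addr0 mulr1 => H.
  have : lor P2 (mu t0) * (cos th0 + cos th0) = 0.
    apply: H; apply: filterS (near0_lt d0) => r hr.
    have l1 (r' : R) : `|r'| < d -> lor (c 0 r') (c 0 r') = 1.
      by move=> h; apply: (lor_dualF_self fr); have [_ [h2 _] _] := Hd _ (box_pt zd h).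
    have := l1 _ hr; have := l1 _ zd.
    rewrite !(frame_lor_self (df_sq fr It0) (df_ort fr It0)) c00 !lorZl mn mw mE mm => q1 q2.
    by rewrite -[RHS](sub_eq_eq q2 q1); ring.
  move/eqP; rewrite mulf_eq0 -mulr2n mulrn_eq0 (negbTE cb) /= orbF.
  by move/eqP.
(* [P1] is the velocity of F along the singular curve, and at a singular point the image of the
   differential of F is spanned by nu. *)
have P1nu : exists k, P1 = k *: nu t0.
  have Ip : I (pt t0 th0 0 t_) by rewrite pt_t.
  have [L1 _] := row4_line 0 0 0.
  pose z := 'D_(e_t R) phi (pt 0 0).
  have E1 (y : 'rV[R]_4) : lor P1 y = lor ('D_z F (pt t0 th0)) y.
    have D0 : differentiable Psi 0 by exact: (smooth_diff sPsi V20).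
    rewrite /P1 -(derive_lor _ _ D0).
    have V0 : V2 (0 + 0 *: e1) by rewrite scale0r addr0.
    have H := is_derive_line (derivableP (smooth_derivable (v := e1) (sPsiy y) V0)).
    rewrite scale0r addr0 in H.
    have dph : differentiable (fun u => phi (pt u 0)) 0 by apply/derivable1_diffP; have [] := dphit.
    have Sp : strip I (phi (pt 0 0)) by rewrite pt00; have [] := O0.
    have H2 := is_derive_lorl y (is_derive_curve dph (smooth_diff sF Sp)).
    have H3 : is_derive (0 : R) (1 : R) (fun u => lor (F (phi (pt u 0))) y) ('D_e1 (fun v => lor (Psi v) y) 0).
      apply: (@near_is_derive1 _ (fun u => lor (Psi (0 + u *: e1)) y)) => //.
      apply: filterS (near0_lt d0) => u hu; have [_ ->] := EPsi _ (box_pt hu zd).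
      by rewrite famE !expr0n /= mulr0; have [_ [_ <-]] := row4_line u 0 0; rewrite row0.
    have [_ E2] := H2; have [_ E3] := H3; have [_ Ed] := dphit.
    rewrite Ed in E2.
    have E4 := etrans (esym E3) E2.
    exact: (etrans E4 (congr1 (fun q => lor ('D_z F q) y) (etrans (congr1 phi (pt00 R)) phi0))).
  rewrite (derive_dualF fr) // !pt_t !pt_th sth in E1.
  exists (cos th0 * (z 0 th_ - D t0 * z 0 t_)).
  apply/eqP; rewrite -subr_eq0; apply/eqP.
  apply: (frame_lor0 (df_sq fr It0) (df_ort fr It0));
    rewrite lorDl lorNl E1 !(lorDl, lorZl) ?mm ?nn ?ww ?EE; ring.
have WE : lor (P3 0) (E t0) != 0.
  apply/eqP => P3E.
  have [k P1E] := P1nu.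
  have Q1 : lor P1 (mu t0) = 0 /\ lor P1 (E t0) = 0 by rewrite P1E !lorZl [lor (nu t0) (mu t0)]lorC mn nE mulr0.
  (* If [P3 0] were orthogonal to E, the first three partial derivatives would be orthogonal to the
     plane of mu and E. Orthogonality to [P4] is one linear condition on that plane, so a nonzero
     [y] in it would be orthogonal to the whole image of the differential, which is R^4. *)
  have [al [be [Hal Hne]]] : exists al be : R, al * lor P4 (mu t0) + be * lor P4 (E t0) = 0 /\ (al != 0 \/ be != 0).
    have [h|h] := eqVneq (lor P4 (mu t0)) 0.
      have [h'|h'] := eqVneq (lor P4 (E t0)) 0.
        by exists 1, 0; rewrite h h' !mulr0 addr0; split => //; left; exact: oner_neq0.
      by exists (lor P4 (E t0)), (- lor P4 (mu t0)); split; [ring|left].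
    by exists (lor P4 (E t0)), (- lor P4 (mu t0)); split; [ring|right; rewrite oppr_eq0].
  pose y := al *: mu t0 + be *: E t0.
  have Psiy (x : 'rV[R]_4) : lor ('D_x Psi 0) y = 0.
    have D0 : differentiable Psi 0 by exact: (smooth_diff sPsi V20).
    have -> : 'D_x Psi 0 = x 0 0 *: P1 + x 0 o1 *: P2 + x 0 o2 *: P3 0 + x 0 o3 *: P4.
      rewrite /P1 /P2 /P3 /P4 row0 !deriveE // -!linearZ -!linearD; congr ('d Psi 0 _).
      by apply/rowP; apply: ord4P; rewrite !mxE /=; ring.
    have [Q1m Q1E] := Q1.
    exact: (lor_combination0 _ _ _ _ Q1m Q1E P2mu P2E P3mu P3E Hal).
  have all0 (v : 'rV[R]_4) : lor v y = 0.
    have <- : 'D_('D_v Phi (F (pt t0 th0))) Psi (Phi (F (pt t0 th0))) = v.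
      apply: derive_left_inverse.
      - exact: smooth_diff sPhi U20.
      - by rewrite Phi0; exact: smooth_diff sPsi V20.
      - by apply: near_open U20 _ => // z /UV2 [].
    by rewrite Phi0; exact: Psiy.
  have a0 : al = 0 by have := all0 (mu t0); rewrite /y (lorDr (mu t0)) !lorZr mm mE mulr1 mulr0 addr0.
  have b0 : be = 0 by have := all0 (E t0); rewrite /y (lorDr (E t0)) !lorZr EE (lorC (E t0)) mE mulr0 add0r mulrN1 => /eqP; rewrite oppr_eq0 => /eqP.
  by case: Hne; rewrite ?a0 ?b0 eqxx.
have [Dp sp] := df_pos fr It0; have [cD cs _] := df_cont fr It0.
exists K, (fun u => lor (P3 u) (E (tt u))), tt, ('D_(e_t R) phi (pt 0 0) 0 t_); split.
- split.
    apply: cvgN; apply: cvgM; last exact: cvg_cst.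
    apply: cvgM; last first.
      apply: (@continuous_compR _ (fun u => xi u 0 t_) (fun q => q ^+ 3)); last exact: exprn_continuous.
      have sxi : smooth U1 (fun p => 'D_(e_th R) phi p 0 t_).
        by move/smooth_rV: (smooth_derive (e_th R) sphi); exact.
      by apply: (smooth_continuous_t sxi); rewrite pt00.
    apply: cvgM; last by apply: (@continuous_compR _ tt s) => //; rewrite tt0.
    apply: cvgM; last by apply: (@continuous_compR _ tt D) => //; rewrite tt0.
    apply: (@continuous_compR _ bb cos); first exact: is_derive_continuous Dbb.
    exact: continuous_cos.
  have cb : cos th0 != 0.
    by apply: contra_eq_neq (cos_sq1 sth) => ->; rewrite mul0r eq_sym oner_eq0.
  rewrite /K bb0 tt0 oppr_eq0.
  have i3 : (3 : R)^-1 != 0 by rewrite invr_eq0 pnatr_eq0.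
  exact: (mulf_neq0 (mulf_neq0 (mulf_neq0 (mulf_neq0 cb (lt0r_neq0 Dp)) (lt0r_neq0 sp)) (expf_neq0 3 xi00)) i3).
- split; last by rewrite tt0.
  exact: cP3 (df_dE fr It0).
- by [].
- by apply: filterS (near0_lt d0) => u hu; exact: rel.
Unshelve. all: by end_near. Qed.

Theorem dualF_cuspidal_edge_necessity : cuspidal_edge F (pt t0 th0) -> e t0 != 0.
Proof.
have -> : cuspidal_edge F (pt t0 th0) = A_equiv F (pt t0 th0) (cusp_family (fun=> 1)) 0.
  rewrite /cuspidal_edge; congr (A_equiv _ _ _ _); apply/funext => z.
  by rewrite /cusp_family mul1r.
move=> /cusp_family_necessity [|K [W [tt [tau [[_ K0] [_ W0] [tt0 _] H]]]]].
  by move=> u _; exact: oner_neq0.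
have := nbhs_singleton H; rewrite mul1r tt0 => E0.
by apply: contra_eq_neq E0 => ->; rewrite mulr0.
Qed.

(** At u = 0 the relation u W = K e gives [e t0 = 0]; at first order the left side has the nonzero
    coefficient [W 0], so the derivative of [e] cannot vanish. *)
Theorem dualF_cuspidal_crosscap_necessity : cuspidal_crosscap F (pt t0 th0) ->
  e t0 = 0 /\ forall e1, is_derive t0 (1 : R) e e1 -> e1 != 0.
Proof.
have -> : cuspidal_crosscap F (pt t0 th0) = A_equiv F (pt t0 th0) (cusp_family id) 0.
  by [].
move=> /cusp_family_necessity [//|K [W [tt [tau [[cK K0] [cW W0] [tt0 Dt] H]]]]].
have := nbhs_singleton H; rewrite mul0r tt0 => /esym/eqP.
rewrite mulf_eq0 (negbTE K0) /= => /eqP e0; split => // e1 De.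
have v1 : vanish (fun u : R => u * W u) 0 1 (W 0).
  by exists W; split => // r; rewrite subr0 expr1.
have v2 := vanishM (vanish0 cK) (vanish_comp (vanish_derive e0 De) tt0 Dt).
have E1 := vanish_uniq v1 v2 H.
by apply: contra_eq_neq E1 => ->; rewrite !mulr0.
Qed.

End Necessity.

(** * The evolute of a hyperbolic framed curve *)

Section Wedge.
Variable R : realType.
Implicit Types (x y z u : 'rV[R]_4).

Definition det3 (a b c d e f g h i : R) := a * (e * i - f * h) - b * (d * i - f * g) + c * (d * h - e * g).

Lemma det_mx3 (m : nat -> nat -> R) : \det (\matrix_(i < 3, j < 3) m i j) =
  det3 (m 0 0) (m 0 1) (m 0 2) (m 1 0) (m 1 1) (m 1 2) (m 2 0) (m 2 1) (m 2 2).
Proof.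
rewrite (expand_det_row _ 0) !big_ord_recl big_ord0 /cofactor.
rewrite !(expand_det_row _ 0) !big_ord_recl !big_ord0 /cofactor !det_mx11 !mxE /= /bump /= /det3 !add0n.
by rewrite expr0 expr1 sqrrN expr1n; ring.
Qed.

Lemma wedgeE x y z : wedge x y z =
  row4 (- det3 (x 0 o1) (x 0 o2) (x 0 o3) (y 0 o1) (y 0 o2) (y 0 o3) (z 0 o1) (z 0 o2) (z 0 o3))
       (- det3 (x 0 0) (x 0 o2) (x 0 o3) (y 0 0) (y 0 o2) (y 0 o3) (z 0 0) (z 0 o2) (z 0 o3))
       (det3 (x 0 0) (x 0 o1) (x 0 o3) (y 0 0) (y 0 o1) (y 0 o3) (z 0 0) (z 0 o1) (z 0 o3))
       (- det3 (x 0 0) (x 0 o1) (x 0 o2) (y 0 0) (y 0 o1) (y 0 o2) (z 0 0) (z 0 o1) (z 0 o2)).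
Proof.
pose m (k : nat) (i j : nat) : R := (nth 0 [:: x; y; z] i) 0 (inord (bump k j)).
have E (k : 'I_4) : row' 0 (col' k (rows4 0 x y z)) = \matrix_(i < 3, j < 3) m k i j.
  apply/matrixP => i j; rewrite !mxE /m.
  have -> : lift k j = inord (bump k j) by apply: val_inj; rewrite /= inordK // (ltn_ord (lift k j)).
  by case: i => [[|[|[|i]]] Hi].
have I0 : inord 0 = 0 :> 'I_4 by apply: val_inj; rewrite /= inordK.
have I1 : inord 1 = o1 :> 'I_4 by apply: val_inj; rewrite /= inordK.
have I2 : inord 2 = o2 :> 'I_4 by apply: val_inj; rewrite /= inordK.
have I3 : inord 3 = o3 :> 'I_4 by apply: val_inj; rewrite /= inordK.
apply/rowP; apply: ord4P; rewrite row4E mxE /cofactor E det_mx3 /m /bump /= ?add0n ?addn0 ?add1n ?I1 ?I2 ?I3 ?I0 /=;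
  rewrite ?expr0 ?expr1 ?sqrrN ?expr1n; ring.
Qed.

Lemma det_rows4 u x y z : \det (rows4 u x y z) = lor (wedge x y z) u.
Proof.
rewrite (expand_det_row _ 0) /lor.
have C j : cofactor (rows4 u x y z) 0 j = cofactor (rows4 0 x y z) 0 j.
  rewrite /cofactor; congr (_ * \det _); apply/matrixP => i k; rewrite !mxE.
  by case: i => [[|[|[|i]]] Hi].
have E j : u 0 j * cofactor (rows4 0 x y z) 0 j = (if j == 0 then -1 else 1) * (wedge x y z) 0 j * u 0 j.
  by rewrite [wedge _ _ _ _ _]mxE; case: eqP => _; ring.
have -> : \sum_j rows4 u x y z 0 j * cofactor (rows4 u x y z) 0 j =
  \sum_j ((if j == 0 then -1 else 1) * (wedge x y z) 0 j * u 0 j).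
  by apply: eq_bigr => j _; rewrite C mxE /= E.
rewrite !big_ord_recl big_ord0 addr0 /= !addrA !mul1r mulN1r.
by congr (_ + wedge _ _ _ _ _ * u _ _ + wedge _ _ _ _ _ * u _ _ + wedge _ _ _ _ _ * u _ _); exact: val_inj.
Qed.

Lemma lor_wedge x y z : [/\ lor (wedge x y z) x = 0, lor (wedge x y z) y = 0 & lor (wedge x y z) z = 0].
Proof. by rewrite /lor wedgeE !row4E /det3; split; ring. Qed.

Lemma lor_wedge_self x y z : lor (wedge x y z) (wedge x y z) =
  - det3 (lor x x) (lor x y) (lor x z) (lor y x) (lor y y) (lor y z) (lor z x) (lor z y) (lor z z).
Proof. by rewrite /lor wedgeE !row4E /det3; ring. Qed.

Lemma det_rows4_rotate (a b q d : R) x y z u :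
  \det (rows4 (a *: x + b *: y) (d *: (- b *: x + a *: y) + q *: z) (- b *: x + a *: y) u) =
  q * (a ^+ 2 + b ^+ 2) * \det (rows4 x z y u).
Proof. by rewrite !det_rows4 /lor !wedgeE !row4E /det3 !mxE; ring. Qed.

Lemma smooth_wedge n (U : set 'rV[R]_n) (x y z : 'rV[R]_n -> 'rV[R]_4) : open U ->
  smooth U x -> smooth U y -> smooth U z -> smooth U (fun p => wedge (x p) (y p) (z p)).
Proof.
move=> oU /smooth_rV - /(_ oU) sx /smooth_rV - /(_ oU) sy /smooth_rV - /(_ oU) sz.
have S i j k : smooth U (fun p => det3 (x p 0 i) (x p 0 j) (x p 0 k) (y p 0 i) (y p 0 j) (y p 0 k)
    (z p 0 i) (z p 0 j) (z p 0 k)).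
  have M (f g h : 'rV[R]_n -> R) (f' g' : 'rV[R]_n -> R) : smooth U f -> smooth U g -> smooth U h -> smooth U f' ->
    smooth U g' -> smooth U (fun p => h p * (f p * g p - f' p * g' p)).
    move=> sf sg sh sf' sg'; apply: smoothM => //; apply: smoothB => //; exact: smoothM.
  by apply: smoothD => //; [apply: smoothB => //|]; exact: M.
apply: (@smooth_ext _ _ _ _ _ _ oU (fun p _ => esym (wedgeE (x p) (y p) (z p)))).
by apply: smooth_row4 => //; try (apply: smoothN => //); exact: S.
Qed.

End Wedge.

(** * Calculus of smooth curves and their pairings *)

Section SmoothCurves.
Variables (R : realType) (I : set R).
Hypothesis oI : open I.
Let oS : open (strip I) := strip_open oI.

Definition scurve (W : normedModType R) (f : R -> W) := smooth (strip I) (fun p => f (p 0 t_)).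

Section Derive.
Variables (W : normedModType R) (f : R -> W).
Hypothesis sf : scurve f.

Let Df x y : I x -> is_derive x (1 : R) f ('D_(e_t R) (fun p : 'rV[R]_2 => f (p 0 t_)) (pt x y)).
Proof.
move=> Ix; have Ip : strip I (pt x y) by rewrite /strip /= pt_t.
have /is_derive_tP := derivableP (smooth_derivable (v := e_t R) sf Ip).
by rewrite (_ : (fun z => f (pt z y 0 t_)) = f) //; apply/funext => z; rewrite pt_t.
Qed.

Lemma scurve_derive t : I t -> is_derive t (1 : R) f (derive1 f t).
Proof. by move=> /(Df 0) [d _]; rewrite derive1E; exact: derivableP. Qed.

Lemma scurve_derive1 : scurve (derive1 f).
Proof.
apply: (smooth_ext oS _ (smooth_derive (e_t R) sf)) => p Ip.
by have [_] := Df (p 0 th_) Ip; rewrite ptK derive1E.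
Qed.

End Derive.

Lemma smooth_curve_scurve (c : R -> 'rV[R]_4) : smooth_curve I c -> scurve c.
Proof.
move=> sc; apply/smooth_rV => // j.
pose gd i t := iter i (@derive1 R 'rV[R]_4) c t 0 j.
apply: (@smooth_comp1 R 2 (strip I) oS I gd (fun p => p 0 t_) 0) => //; last exact: smooth_coord.
by move=> i y Iy; apply: (is_derive_row j); rewrite /= derive1E; apply: derivableP; exact: sc.
Qed.

Lemma scurve_continuous (f : R -> R) t : scurve f -> I t -> {for t, continuous f}.
Proof. by move=> sf It; exact: is_derive_continuous (scurve_derive sf It). Qed.

Implicit Types (f h k : R -> R) (c x y z : R -> 'rV[R]_4).

Lemma scurveD f k : scurve f -> scurve k -> scurve (fun t => f t + k t).
Proof. exact: smoothD. Qed.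
Lemma scurveN f : scurve f -> scurve (fun t => - f t).
Proof. exact: smoothN. Qed.
Lemma scurveB f k : scurve f -> scurve k -> scurve (fun t => f t - k t).
Proof. exact: smoothB. Qed.
Lemma scurveM f k : scurve f -> scurve k -> scurve (fun t => f t * k t).
Proof. exact: smoothM. Qed.
Lemma scurveX f m : scurve f -> scurve (fun t => f t ^+ m).
Proof. exact: smoothX. Qed.
Lemma scurveV f : (forall t, I t -> f t != 0) -> scurve f -> scurve (fun t => (f t)^-1).
Proof. by move=> f0; apply: smoothV => // p; exact: f0. Qed.
Lemma scurve_div f k : (forall t, I t -> k t != 0) -> scurve f -> scurve k -> scurve (fun t => f t / k t).
Proof. by move=> k0; apply: smooth_div => // p; exact: k0. Qed.
Lemma scurve_sqrt f : (forall t, I t -> 0 < f t) -> scurve f -> scurve (fun t => Num.sqrt (f t)).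
Proof. by move=> f0; apply: smooth_sqrt => // p; exact: f0. Qed.
Lemma scurve_lor x y : scurve x -> scurve y -> scurve (fun t => lor (x t) (y t)).
Proof. exact: smooth_lor. Qed.
Lemma scurve_wedge x y z : scurve x -> scurve y -> scurve z -> scurve (fun t => wedge (x t) (y t) (z t)).
Proof. exact: smooth_wedge. Qed.

Lemma scurve_pair k f h x y : scurve k -> scurve f -> scurve h -> scurve x -> scurve y ->
  scurve (fun t => k t *: (f t *: x t + h t *: y t)).
Proof.
move=> sk sf sh /smooth_rV - /(_ oS) sx /smooth_rV - /(_ oS) sy; apply/smooth_rV => // j.
apply: (@smooth_ext _ _ _ _ (fun p => k (p 0 t_) * (f (p 0 t_) * x (p 0 t_) 0 j + h (p 0 t_) * y (p 0 t_) 0 j))) => //.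
  by move=> p _; rewrite !mxE.
by apply: smoothM => //; apply: smoothD => //; exact: smoothM.
Qed.

(** When [u] is orthogonal to the value of the bracket, the derivative of the factor [k] drops out.
    All normalised frame vectors have this shape, so their normalising square roots are never
    differentiated explicitly. *)
Lemma derive1_pair_lor k f h x y t (u : 'rV[R]_4) lx ly dlx dly :
  scurve k -> scurve f -> scurve h -> scurve x -> scurve y -> I t ->
  lor (f t *: x t + h t *: y t) u = 0 -> lor (x t) u = lx -> lor (y t) u = ly ->
  lor (derive1 x t) u = dlx -> lor (derive1 y t) u = dly ->
  lor (derive1 (fun s => k s *: (f s *: x s + h s *: y s)) t) u =
  k t * (derive1 f t * lx + f t * dlx + (derive1 h t * ly + h t * dly)).
Proof.
move=> sk sf sh sx sy It H <- <- <- <-.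
have D1 := is_derive_lorl u (scurve_derive (scurve_pair sk sf sh sx sy) It).
have Dx := is_derive_lorl u (scurve_derive sx It); have Dy := is_derive_lorl u (scurve_derive sy It).
have D2 := is_deriveM (scurve_derive sk It) (is_deriveD (is_deriveM (scurve_derive sf It) Dx) (is_deriveM (scurve_derive sh It) Dy)).
have E : (fun s => lor (k s *: (f s *: x s + h s *: y s)) u) =
   k * (f * (fun s => lor (x s) u) + h * (fun s => lor (y s) u)).
  by apply/funext => s; rewrite lorZl lorDl !lorZl.
rewrite E in D1; have [_ <-] := D1; have [_ ->] := D2.
move: H; rewrite lorDl !lorZl => H.
rewrite !fctE /GRing.scale /= H mul0r addr0; ring.
Qed.

Lemma derive1_lor_cst x y (c : R) t : scurve x -> scurve y -> (forall s, I s -> lor (x s) (y s) = c) -> I t ->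
  lor (derive1 x t) (y t) = - lor (x t) (derive1 y t).
Proof.
move=> sx sy H It; have D := is_derive_lor (scurve_derive sx It) (scurve_derive sy It).
have D0 : is_derive t (1 : R) (fun s => lor (x s) (y s)) 0.
  apply: (@near_is_derive1 _ (cst c)).
  by have := open_nbhs_nbhs (conj oI It); apply: filterS => s /H.
have [_ E] := D; have [_ E0] := D0.
by apply/eqP; rewrite -subr_eq0 opprK -E E0.
Qed.

End SmoothCurves.

Section PlaneBases.
Variable R : realType.
Implicit Types (u x y : 'rV[R]_4).

Lemma lor_pair0 (k a b : R) u x y : lor u x = 0 -> lor u y = 0 -> lor u (k *: (a *: x + b *: y)) = 0.
Proof. by move=> h1 h2; rewrite lorZr lorDr !lorZr h1 h2 !mulr0 addr0 mulr0. Qed.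

Lemma scale_unscale (d : R) x : d != 0 -> x = d *: (d^-1 *: x).
Proof. by move=> d0; rewrite scalerA divff // scale1r. Qed.

Lemma sparse_combination (k l : R) x y z w :
  [/\ k *: x + 0 *: y + l *: z - 0 *: w = k *: x + l *: z,
      0 *: x + k *: y + 0 *: z - - l *: w = k *: y + l *: w &
      0 *: x + 0 *: y + k *: z - 0 *: w = k *: z].
Proof. by split; apply/rowP => j; rewrite !mxE; ring. Qed.

Lemma lor_pairl0 (a b : R) u x y : lor x u = 0 -> lor y u = 0 -> lor (a *: x + b *: y) u = 0.
Proof. by move=> h1 h2; rewrite lorDl !lorZl h1 h2 !mulr0 addr0. Qed.

Lemma lor_pair_eq (k a b p q : R) u x y : lor u x = p -> lor u y = q ->
  lor u (k *: (a *: x + b *: y)) = k * (a * p + b * q).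
Proof. by move=> <- <-; rewrite lorZr lorDr !lorZr. Qed.

Lemma frenet_combination (a b M A D : R) x y z w : A != 0 -> D != 0 ->
  - a *: x + - b *: y + 0 *: w - - M *: z = - D *: (D^-1 *: (- M *: z + A *: (A^-1 *: (a *: x + b *: y)))).
Proof. by move=> A0 D0; apply/rowP => j; rewrite !mxE; field; rewrite A0 D0. Qed.

Lemma lor_pair (k a b : R) u x y : lor u (k *: (a *: x + b *: y)) = k * (a * lor u x + b * lor u y).
Proof. by rewrite lorZr lorDr !lorZr. Qed.

Lemma rotation_frame (a b A : R) x y : A ^+ 2 = a ^+ 2 + b ^+ 2 -> A != 0 ->
  [/\ lor x x = 1, lor y y = 1 & lor x y = 0] ->
  [/\ lor (A^-1 *: (a *: x + b *: y)) (A^-1 *: (a *: x + b *: y)) = 1,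
      lor (A^-1 *: (- b *: x + a *: y)) (A^-1 *: (- b *: x + a *: y)) = 1 &
      lor (A^-1 *: (a *: x + b *: y)) (A^-1 *: (- b *: x + a *: y)) = 0].
Proof.
move=> E A0 [xx yy xy]; have yx : lor y x = 0 by rewrite lorC.
have S : (a ^+ 2 + b ^+ 2) / A ^+ 2 = 1 by rewrite -E divff // expf_neq0.
rewrite !lor_pair !(lorZl, lorDl) xx yy xy yx; split.
- by rewrite -[RHS]S; field.
- by rewrite -[RHS]S; field.
- by field.
Qed.

(** A Lorentz boost of the pair (x, y). It is applied twice: in the plane of the curve and [N1], and
    in the plane of [tau] and [N2]. *)
Lemma boost_frame (c A D : R) x y : D ^+ 2 = A ^+ 2 - c ^+ 2 -> D != 0 ->
  [/\ lor x x = -1, lor y y = 1 & lor x y = 0] ->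
  [/\ lor (D^-1 *: (c *: x + A *: y)) (D^-1 *: (c *: x + A *: y)) = 1,
      lor (D^-1 *: (A *: x + c *: y)) (D^-1 *: (A *: x + c *: y)) = -1 &
      lor (D^-1 *: (c *: x + A *: y)) (D^-1 *: (A *: x + c *: y)) = 0].
Proof.
move=> E D0 [xx yy xy]; have yx : lor y x = 0 by rewrite lorC.
have S : (A ^+ 2 - c ^+ 2) / D ^+ 2 = 1 by rewrite -E divff // expf_neq0.
rewrite !lor_pair !(lorZl, lorDl) xx yy xy yx; split.
- by rewrite -[RHS]S; field.
- by rewrite -[1 in RHS]S; field.
- by field.
Qed.

End PlaneBases.

(** * The frame attached to the evolute and its structure equations *)

Section FramedCurve.
Variables (R : realType) (I : set R) (g v1 v2 : R -> 'rV[R]_4).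
Hypotheses (oI : open I) (fc : hyp_framed_curve I g v1 v2)
  (ab : forall t, I t -> a_ g v1 v2 t ^+ 2 + b_ g v1 v2 t ^+ 2 != 0)
  (sg : forall t, I t -> 0 < sigmaF g v1 v2 t).

Local Notation m := (mu g v1 v2).
Local Notation a := (a_ g v1 v2).
Local Notation b := (b_ g v1 v2).
Local Notation A := (AA g v1 v2).
Local Notation M := (MM g v1 v2).
Local Notation N := (NN g v1 v2).
Local Notation K := (KK g v1 v2).
Local Notation P := (PP g v1 v2).
Local Notation sigma := (sigmaF g v1 v2).
Local Notation N1 := (n1 g v1 v2).
Local Notation N2 := (n2 g v1 v2).
Local Notation nuc := (nu g v1 v2).

Definition speed t := Num.sqrt (A t ^+ 2 - M t ^+ 2).
(** The timelike unit vector orthogonal to [nuc] in the plane of [g] and [N1]. Using [tau] and [N2]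
    as a basis shows the evolute as a second boost. *)
Definition tau t := (speed t)^-1 *: (A t *: g t + - M t *: N1 t).
(** The unit vector along the part of the derivative of [nuc] orthogonal to [mu]; its length is
    [bend]. The normalisation works because sigma = P^2 - K^2. *)
Definition conormal t := (Num.sqrt (sigma t))^-1 *: (K t *: tau t + P t *: N2 t).
Definition bend t := Num.sqrt (sigma t) / (A t ^+ 2 - M t ^+ 2).

Let sg_ : scurve I g. Proof. by case: fc => h *; exact: smooth_curve_scurve h. Qed.
Let sv1 : scurve I v1. Proof. by case: fc => _ h *; exact: smooth_curve_scurve h. Qed.
Let sv2 : scurve I v2. Proof. by case: fc => _ _ h *; exact: smooth_curve_scurve h. Qed.
Let sm : scurve I m. Proof. exact: scurve_wedge. Qed.
Let sdg := scurve_derive1 oI sg_.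
Let sdv1 := scurve_derive1 oI sv1.
Let sdv2 := scurve_derive1 oI sv2.
Let sM : scurve I M. Proof. exact: scurve_lor. Qed.
Let sa : scurve I a. Proof. exact: scurve_lor. Qed.
Let sb : scurve I b. Proof. exact: scurve_lor. Qed.
Let snn : scurve I (n_ v1 v2). Proof. exact: scurve_lor. Qed.
Let sab : scurve I (fun t => a t ^+ 2 + b t ^+ 2).
Proof. by apply: scurveD => //; apply: scurveX. Qed.
Let ab0 t : I t -> 0 < a t ^+ 2 + b t ^+ 2.
Proof. by move=> It; rewrite lt_neqAle eq_sym ab // addr_ge0 // sqr_ge0. Qed.
Let sA : scurve I A. Proof. exact: scurve_sqrt. Qed.
Let sf : scurve I (f_ g v1 v2).
Proof.
apply: scurveD => //; last exact: scurveM.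
by apply: scurveB => //; apply: scurveM => //; exact: scurve_derive1.
Qed.
Let sN : scurve I N. Proof. exact: scurve_div. Qed.
Let sK : scurve I K.
Proof. by apply: scurveB => //; apply: scurveM => //; exact: scurve_derive1. Qed.
Let sAM : scurve I (fun t => A t ^+ 2 - M t ^+ 2).
Proof. by apply: scurveB => //; exact: scurveX. Qed.

Let A_gt0 t : I t -> 0 < A t. Proof. by move=> It; rewrite sqrtr_gt0 ab0. Qed.
Let A_sq t : I t -> A t ^+ 2 = a t ^+ 2 + b t ^+ 2.
Proof. by move=> It; rewrite /AA sqr_sqrtr // ltW // ab0. Qed.
Let AM_gt0 t : I t -> 0 < A t ^+ 2 - M t ^+ 2.
Proof.
move=> It; have := sg It; rewrite /sigmaF; rewrite ltNge => h.
rewrite ltNge; apply: contra h => h; rewrite subr_le0.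
apply: (@le_trans _ _ 0); last exact: sqr_ge0.
by apply: mulr_ge0_le0 => //; apply: mulr_ge0; exact: sqr_ge0.
Qed.
Let sD : scurve I speed. Proof. exact: scurve_sqrt. Qed.
Let D_gt0 t : I t -> 0 < speed t. Proof. by move=> It; rewrite sqrtr_gt0 AM_gt0. Qed.
Let D_sq t : I t -> speed t ^+ 2 = A t ^+ 2 - M t ^+ 2.
Proof. by move=> It; rewrite /speed sqr_sqrtr // ltW // AM_gt0. Qed.
Let sP : scurve I P. Proof. by apply: scurveM => //; exact: scurveM. Qed.
Let sigmaE t : I t -> sigma t = P t ^+ 2 - K t ^+ 2.
Proof.
move=> It; rewrite /sigmaF; congr (_ - _).
by rewrite -(D_sq It) /PP -/(speed t); ring.
Qed.
Let ssigma : scurve I sigma.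
Proof.
apply: scurveB => //; last exact: scurveX.
by apply: scurveM => //; apply: scurveM => //; exact: scurveX.
Qed.
Let sr : scurve I (fun t => Num.sqrt (sigma t)). Proof. exact: scurve_sqrt. Qed.
Let r_gt0 t : I t -> 0 < Num.sqrt (sigma t). Proof. by move=> It; rewrite sqrtr_gt0 sg. Qed.
Let r_sq t : I t -> Num.sqrt (sigma t) ^+ 2 = P t ^+ 2 - K t ^+ 2.
Proof. by move=> It; rewrite sqr_sqrtr ?sigmaE // -sigmaE // ltW // sg. Qed.
Let siA : scurve I (fun t => (A t)^-1).
Proof. by apply: scurveV => // t It; rewrite gt_eqF // A_gt0. Qed.
Let siD : scurve I (fun t => (speed t)^-1).
Proof. by apply: scurveV => // t It; rewrite gt_eqF // D_gt0. Qed.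
Let sir : scurve I (fun t => (Num.sqrt (sigma t))^-1).
Proof. by apply: scurveV => // t It; rewrite gt_eqF // r_gt0. Qed.

Let sN1 : scurve I N1. Proof. exact: scurve_pair. Qed.
Let sN2 : scurve I N2. Proof. by apply: scurve_pair => //; exact: scurveN. Qed.
Lemma scurve_nu : scurve I nuc. Proof. by apply: scurve_pair => //; exact: scurveN. Qed.
Lemma scurve_tau : scurve I tau. Proof. by apply: scurve_pair => //; exact: scurveN. Qed.
Lemma scurve_conormal : scurve I conormal. Proof. by apply: scurve_pair => //; exact: scurve_tau. Qed.

Definition evolute t := (Num.sqrt (sigma t))^-1 *: (P t *: tau t + K t *: N2 t).
Lemma scurve_evolute : scurve I evolute. Proof. by apply: scurve_pair => //; exact: scurve_tau. Qed.

(** Expanding [tau] and using P / speed = A N returns the coefficients of [g] and [N1] in the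
    original formula. *)
Lemma evoluteE t : I t -> evol g v1 v2 t = evolute t.
Proof.
move=> It; rewrite /evol /evolute; congr (_ *: (_ + _)).
have D0 := lt0r_neq0 (D_gt0 It).
have PD : P t / speed t = A t * N t by rewrite /PP -/(speed t) mulfK.
rewrite /tau (scalerA (P t)) PD scalerDr (scalerA _ _ (g t)) (scalerA _ _ (N1 t)) -scaleNr.
by congr (_ *: _ + _ *: _); ring.
Qed.

Let sq0 t : I t -> [/\ lor (v1 t) (v1 t) = 1, lor (v2 t) (v2 t) = 1, lor (m t) (m t) = 1 & lor (g t) (g t) = -1].
Proof.
move=> It; case: fc => _ _ _ /(_ _ It) [gg h1 h2 h12 [g1 g2 _ _]]; split => //.
rewrite lor_wedge_self gg h1 h2 h12 g1 g2 [lor (v1 t) (g t)]lorC [lor (v2 t) (g t)]lorC [lor (v2 t) (v1 t)]lorC.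
by rewrite h12 g1 g2 /det3; ring.
Qed.
Let ort0 t : I t -> [/\ [/\ lor (v1 t) (v2 t) = 0, lor (v1 t) (m t) = 0 & lor (v1 t) (g t) = 0],
  lor (v2 t) (m t) = 0, lor (v2 t) (g t) = 0 & lor (m t) (g t) = 0].
Proof.
move=> It; case: fc => _ _ _ /(_ _ It) [gg h1 h2 h12 [g1 g2 _ _]].
have [w1 w2 w3] := lor_wedge (g t) (v1 t) (v2 t).
by do !split => //; rewrite lorC.
Qed.
Let N12 t : I t -> [/\ lor (N1 t) (N1 t) = 1, lor (N2 t) (N2 t) = 1 & lor (N1 t) (N2 t) = 0].
Proof.
move=> It; have [h1 h2 _ _] := sq0 It; have [[h12 _ _] _ _ _] := ort0 It.
by apply: rotation_frame; [exact: A_sq|exact: lt0r_neq0 (A_gt0 It)|split].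
Qed.
Let perpN u t : lor u (v1 t) = 0 -> lor u (v2 t) = 0 -> lor u (N1 t) = 0 /\ lor u (N2 t) = 0.
Proof. by move=> h1 h2; split; exact: lor_pair0. Qed.
Let gN t : I t -> lor (g t) (N1 t) = 0 /\ lor (g t) (N2 t) = 0.
Proof. by move=> It; have [[_ _ h1] _ h2 _] := ort0 It; apply: perpN; rewrite lorC. Qed.
Let mN t : I t -> lor (m t) (N1 t) = 0 /\ lor (m t) (N2 t) = 0.
Proof. by move=> It; have [[_ h1 _] h2 _ _] := ort0 It; apply: perpN; rewrite lorC. Qed.
Let nutau t : I t -> [/\ lor (nuc t) (nuc t) = 1, lor (tau t) (tau t) = -1 & lor (nuc t) (tau t) = 0].
Proof.
move=> It; have [_ _ _ gg] := sq0 It; have [nn _ _] := N12 It; have [gn _] := gN It.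
apply: boost_frame => //; last exact: lt0r_neq0 (D_gt0 It).
by rewrite sqrrN; exact: D_sq.
Qed.
Let perpT u t : lor u (g t) = 0 -> lor u (N1 t) = 0 -> lor u (nuc t) = 0 /\ lor u (tau t) = 0.
Proof. by move=> h1 h2; split; exact: lor_pair0. Qed.
Let N2T t : I t -> lor (N2 t) (nuc t) = 0 /\ lor (N2 t) (tau t) = 0.
Proof. by move=> It; have [_ h1] := gN It; have [_ _ h2] := N12 It; apply: perpT; rewrite lorC. Qed.
Let mT t : I t -> lor (m t) (nuc t) = 0 /\ lor (m t) (tau t) = 0.
Proof. by move=> It; have [_ _ _ h1] := ort0 It; have [h2 _] := mN It; exact: perpT. Qed.
Let wE t : I t -> [/\ lor (conormal t) (conormal t) = 1, lor (evolute t) (evolute t) = -1 &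
  lor (conormal t) (evolute t) = 0].
Proof.
move=> It; have [_ tt _] := nutau It; have [_ nn _] := N12 It; have [_ nt] := N2T It.
apply: boost_frame; [exact: r_sq|exact: lt0r_neq0 (r_gt0 It)|split => //].
by rewrite lorC.
Qed.
Let perpE u t : lor u (tau t) = 0 -> lor u (N2 t) = 0 -> lor u (conormal t) = 0 /\ lor u (evolute t) = 0.
Proof. by move=> h1 h2; split; exact: lor_pair0. Qed.

Lemma evolute_frame_sq t : I t -> [/\ lor (m t) (m t) = 1, lor (nuc t) (nuc t) = 1,
  lor (conormal t) (conormal t) = 1 & lor (evolute t) (evolute t) = -1].
Proof. by move=> It; have [_ _ ? _] := sq0 It; have [? _ _] := nutau It; have [? ? _] := wE It. Qed.

Lemma evolute_frame_ort t : I t -> [/\ [/\ lor (m t) (nuc t) = 0, lor (m t) (conormal t) = 0 &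
  lor (m t) (evolute t) = 0], lor (nuc t) (conormal t) = 0, lor (nuc t) (evolute t) = 0 &
  lor (conormal t) (evolute t) = 0].
Proof.
move=> It; have [h1 h2] := mT It; have [_ h3] := mN It; have [h4 _] := N2T It; have [_ _ h5] := nutau It.
have [h6 h7] := perpE h2 h3; rewrite lorC in h4; have [h8 h9] := perpE h5 h4; have [_ _ h10] := wE It.
by do !split.
Qed.

Let dg t : I t -> [/\ lor (derive1 g t) (g t) = 0, lor (derive1 g t) (v1 t) = 0 & lor (derive1 g t) (v2 t) = 0].
Proof.
move=> It; case: fc => _ _ _ /(_ _ It) [_ _ _ _ [_ _ h1 h2]]; split => //.
have := derive1_lor_cst oI sg_ sg_ (c := -1) _ It.
have H s : I s -> lor (g s) (g s) = -1 by move=> /sq0 [].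
by move=> /(_ H); rewrite [X in _ = - X]lorC; lra.
Qed.
Let self0 (x : R -> 'rV[R]_4) c t : scurve I x -> (forall s, I s -> lor (x s) (x s) = c) -> I t ->
  lor (derive1 x t) (x t) = 0.
Proof. by move=> sx H It; have := derive1_lor_cst oI sx sx H It; rewrite [X in _ = - X]lorC; lra. Qed.
Let dv1 t : I t -> [/\ lor (derive1 v1 t) (g t) = 0, lor (derive1 v1 t) (v1 t) = 0 &
   lor (derive1 v1 t) (v2 t) = n_ v1 v2 t].
Proof.
move=> It; have [_ h1 _] := dg It; split; last by [].
- rewrite (derive1_lor_cst oI sv1 sg_ (c := 0) _ It); first by rewrite lorC h1 oppr0.
  by move=> s /ort0 [[]].
- by apply: (self0 sv1 (c := 1)) => // s /sq0 [].
Qed.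
Let dv2 t : I t -> [/\ lor (derive1 v2 t) (g t) = 0, lor (derive1 v2 t) (v1 t) = - n_ v1 v2 t &
   lor (derive1 v2 t) (v2 t) = 0].
Proof.
move=> It; have [_ _ h1] := dg It; split.
- rewrite (derive1_lor_cst oI sv2 sg_ (c := 0) _ It); first by rewrite lorC h1 oppr0.
  by move=> s /ort0 [].
- rewrite (derive1_lor_cst oI sv2 sv1 (c := 0) _ It); first by rewrite lorC.
  by move=> s /ort0 [[h _ _] _ _ _]; rewrite lorC.
- by apply: (self0 sv2 (c := 1)) => // s /sq0 [].
Qed.
Let dm t : I t -> derive1 m t = - speed t *: nuc t.
Proof.
move=> It; have s0 := sq0 It; have o0 := ort0 It.
rewrite (frame_expand s0 o0 (derive1 m t)).
have -> : lor (derive1 m t) (v1 t) = - a t.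
  rewrite (derive1_lor_cst oI sm sv1 (c := 0) _ It); first by rewrite lorC.
  by move=> s /ort0 [[_ h _] _ _ _]; rewrite lorC.
have -> : lor (derive1 m t) (v2 t) = - b t.
  rewrite (derive1_lor_cst oI sm sv2 (c := 0) _ It); first by rewrite lorC.
  by move=> s /ort0 [_ h _ _]; rewrite lorC.
have -> : lor (derive1 m t) (m t) = 0 by apply: (self0 sm (c := 1)) => // s /sq0 [].
have -> : lor (derive1 m t) (g t) = - M t.
  rewrite (derive1_lor_cst oI sm sg_ (c := 0) _ It); first by rewrite lorC.
  by move=> s /ort0 [].
have D0 := lt0r_neq0 (D_gt0 It); have A0 := lt0r_neq0 (A_gt0 It).
exact: frenet_combination.
Qed.
Let dN1 t : I t -> lor (derive1 N1 t) (g t) = 0 /\ lor (derive1 N1 t) (N2 t) = N t.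
Proof.
move=> It; have [h1 h2 _ _] := sq0 It; have [[h12 _ h1g] _ h2g _] := ort0 It.
have [dv1g dv11 dv12] := dv1 It; have [dv2g dv21 dv22] := dv2 It.
have A0 := lt0r_neq0 (A_gt0 It).
have AN : a t *: v1 t + b t *: v2 t = A t *: N1 t by exact: scale_unscale.
split.
  have H := lor_pairl0 (a t) (b t) h1g h2g.
  apply: (etrans (derive1_pair_lor oI siA sa sb sv1 sv2 It H h1g h2g dv1g dv2g)).
  by move: (A t)^-1 (derive1 a t) (derive1 b t) (a t) (b t) => ? ? ? ? ?; ring.
have [_ _ N0] := N12 It.
have H : lor (a t *: v1 t + b t *: v2 t) (N2 t) = 0 by rewrite AN lorZl N0 mulr0.
have h21 : lor (v2 t) (v1 t) = 0 by rewrite lorC.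
have e1 := lor_pair_eq (A t)^-1 (- b t) (a t) h1 h12; have e2 := lor_pair_eq (A t)^-1 (- b t) (a t) h21 h2.
have e3 := lor_pair_eq (A t)^-1 (- b t) (a t) dv11 dv12; have e4 := lor_pair_eq (A t)^-1 (- b t) (a t) dv21 dv22.
apply: (etrans (derive1_pair_lor oI siA sa sb sv1 sv2 It H e1 e2 e3 e4)).
rewrite /NN -(A_sq It) /f_ -(A_sq It).
have -> : n_ v1 v2 t * A t ^+ 2 = n_ v1 v2 t * (a t ^+ 2 + b t ^+ 2) by rewrite A_sq.
by move: A0; move: (A t) (a t) (b t) (n_ v1 v2 t) (derive1 a t) (derive1 b t) => ? ? ? ? ? ? A0; field.
Qed.
Let dN2 t : I t -> lor (derive1 N2 t) (g t) = 0 /\ lor (derive1 N2 t) (N1 t) = - N t.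
Proof.
move=> It; have [gg g1 g2] := dg It; have [_ dg2] := perpN g1 g2; split.
  rewrite (derive1_lor_cst oI sN2 sg_ (c := 0) _ It); first by rewrite lorC dg2 oppr0.
  by move=> s /gN [_ h]; rewrite lorC.
rewrite (derive1_lor_cst oI sN2 sN1 (c := 0) _ It); first by rewrite lorC; have [_ ->] := dN1 It.
by move=> s /N12 [_ _ h]; rewrite lorC.
Qed.

(** These two pairings determine the components of the derivative of [nuc] in the plane of [tau] and
    [N2], namely (K tau + P N2) / speed^2. This is a multiple of [conormal], hence orthogonal to the
    evolute. *)
Let dnu t : I t -> lor (derive1 nuc t) (tau t) = - K t / speed t ^+ 2 /\
  lor (derive1 nuc t) (N2 t) = P t / speed t ^+ 2.
Proof.
move=> It; have D0 := lt0r_neq0 (D_gt0 It); have [gg g1 g2] := dg It; have [dg1 dg2] := perpN g1 g2.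
have [_ _ _ g_g] := sq0 It; have [gn1 gn2] := gN It; have [n11 n22 n12] := N12 It; have [d1g d12] := dN1 It.
have d11 : lor (derive1 N1 t) (N1 t) = 0 by apply: (self0 sN1 (c := 1)) => // s /N12 [].
have snM := scurveN oI sM.
have dM : derive1 (fun s => - M s) t = - derive1 M t.
  have [_ E1] := is_deriveN (scurve_derive sM It); have [_ E2] := scurve_derive snM It.
  exact: (etrans (esym E2) E1).
have vE : - M t *: g t + A t *: N1 t = speed t *: nuc t by exact: scale_unscale.
have [_ _ nt] := nutau It; have [N2nu _] := N2T It.
have n1g : lor (N1 t) (g t) = 0 by rewrite lorC.
split.
  have H : lor (- M t *: g t + A t *: N1 t) (tau t) = 0 by rewrite vE lorZl nt mulr0.
  have e1 := lor_pair_eq (speed t)^-1 (A t) (- M t) g_g gn1.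
  have e2 := lor_pair_eq (speed t)^-1 (A t) (- M t) n1g n11.
  have e3 := lor_pair_eq (speed t)^-1 (A t) (- M t) gg dg1.
  have e4 := lor_pair_eq (speed t)^-1 (A t) (- M t) d1g d11.
  apply: (etrans (derive1_pair_lor oI siD snM sA sg_ sN1 It H e1 e2 e3 e4)).
  rewrite dM /KK; move: D0; move: (A t) (M t) (speed t) (derive1 A t) (derive1 M t) => ? ? ? ? ? D0.
  by field.
have H : lor (- M t *: g t + A t *: N1 t) (N2 t) = 0 by rewrite vE lorZl lorC N2nu mulr0.
apply: (etrans (derive1_pair_lor oI siD snM sA sg_ sN1 It H gn2 n12 dg2 d12)).
rewrite /PP -/(speed t) dM; move: D0; move: (A t) (M t) (N t) (speed t) (derive1 A t) (derive1 M t) => ? ? ? ? ? ? D0.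
by field.
Qed.

Let dN2tau t : I t -> lor (derive1 N2 t) (tau t) = M t * N t / speed t.
Proof. by move=> It; have [h1 h2] := dN2 It; rewrite (lor_pair_eq _ _ _ h1 h2); ring. Qed.

Let dtauN2 t : I t -> lor (derive1 tau t) (N2 t) = - (M t * N t / speed t).
Proof.
move=> It; rewrite (derive1_lor_cst oI scurve_tau sN2 (c := 0) _ It); first by rewrite lorC dN2tau.
by move=> s /N2T [_ h]; rewrite lorC.
Qed.

Let dnu_conormal t : I t -> lor (derive1 nuc t) (conormal t) = bend t.
Proof.
move=> It; have [h1 h2] := dnu It; rewrite (lor_pair_eq _ _ _ h1 h2) /bend -(D_sq It).
have D0 := lt0r_neq0 (D_gt0 It); have r0 := lt0r_neq0 (r_gt0 It).
have -> : Num.sqrt (sigma t) / speed t ^+ 2 = Num.sqrt (sigma t) ^+ 2 / (Num.sqrt (sigma t) * speed t ^+ 2).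
  by field; rewrite D0 r0.
by rewrite r_sq //; field; rewrite D0 r0.
Qed.

Let dnu_evolute t : I t -> lor (derive1 nuc t) (evolute t) = 0.
Proof.
move=> It; have [h1 h2] := dnu It; rewrite (lor_pair_eq _ _ _ h1 h2).
have D0 := lt0r_neq0 (D_gt0 It); have r0 := lt0r_neq0 (r_gt0 It).
by field; rewrite D0 r0.
Qed.

Let epshE t : I t -> epsh g v1 v2 t = (P t * derive1 K t - derive1 P t * K t) / sigma t - M t * N t / speed t.
Proof.
move=> It; rewrite /epsh -/(speed t); congr (_ / _ - _).
by rewrite /sigmaF /KK; ring.
Qed.

(** The invariant is the rate of rotation of the evolute towards the conormal: the hyperbolic angle
    between (P, K) and [tau] contributes the quotient over sigma, and the rotation of [tau] against
    [N2] contributes - M N / speed. *)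
Let devolute_conormal t : I t -> lor (derive1 evolute t) (conormal t) = epsh g v1 v2 t.
Proof.
move=> It; have D0 := lt0r_neq0 (D_gt0 It); have r0 := lt0r_neq0 (r_gt0 It).
have [_ tt _] := nutau It; have [_ n22 _] := N12 It; have [_ n2t] := N2T It; have [_ _ wE0] := wE It.
have vE : P t *: tau t + K t *: N2 t = Num.sqrt (sigma t) *: evolute t by exact: scale_unscale.
have dtt : lor (derive1 tau t) (tau t) = 0 by apply: (self0 scurve_tau (c := -1)) => // s /nutau [].
have dnn : lor (derive1 N2 t) (N2 t) = 0 by apply: (self0 sN2 (c := 1)) => // s /N12 [].
have H : lor (P t *: tau t + K t *: N2 t) (conormal t) = 0 by rewrite vE lorZl lorC wE0 mulr0.
have tn2 : lor (tau t) (N2 t) = 0 by rewrite lorC.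
have e1 := lor_pair_eq (Num.sqrt (sigma t))^-1 (K t) (P t) tt tn2.
have e2 := lor_pair_eq (Num.sqrt (sigma t))^-1 (K t) (P t) n2t n22.
have e3 := lor_pair_eq (Num.sqrt (sigma t))^-1 (K t) (P t) dtt (dtauN2 It).
have e4 := lor_pair_eq (Num.sqrt (sigma t))^-1 (K t) (P t) (dN2tau It) dnn.
apply: (etrans (derive1_pair_lor oI sir sP sK scurve_tau sN2 It H e1 e2 e3 e4)).
rewrite epshE //.
have S : sigma t = Num.sqrt (sigma t) ^+ 2 by rewrite sqr_sqrtr // ltW // sg.
rewrite [in RHS]S; have := r_sq It; move: r0.
move: (Num.sqrt (sigma t)) (M t * N t / speed t) (P t) (K t) (derive1 P t) (derive1 K t) => r x p k p' k' r0 Er.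
(* The relation r^2 = p^2 - k^2 is used once, as a factor 1 on the last term; the rest is a rational
   identity in free variables. *)
have -> : (p * k' - p' * k) / r ^+ 2 - x = (p * k' - p' * k) / r ^+ 2 - (p ^+ 2 - k ^+ 2) / r ^+ 2 * x.
  by rewrite -Er divff ?mul1r // expf_neq0.
by field.
Qed.

Lemma scurve_epsh : scurve I (epsh g v1 v2).
Proof.
have dD t : I t -> speed t != 0 by move=> It; rewrite gt_eqF // D_gt0.
have E p : strip I p -> (P (p 0 t_) * derive1 K (p 0 t_) - derive1 P (p 0 t_) * K (p 0 t_)) / sigma (p 0 t_) -
  M (p 0 t_) * N (p 0 t_) / speed (p 0 t_) = epsh g v1 v2 (p 0 t_) by move=> Ip; rewrite epshE.
apply: (smooth_ext (strip_open oI) E).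
have s1 : scurve I (fun t => P t * derive1 K t - derive1 P t * K t).
  by apply: scurveB => //; apply: scurveM => //; exact: scurve_derive1.
have s2 := scurve_div oI (fun t It => lt0r_neq0 (sg It)) s1 ssigma.
exact: (scurveB oI s2 (scurve_div oI dD (scurveM oI sM sN) sD)).
Qed.

Lemma scurve_bend : scurve I bend.
Proof. by apply: scurve_div => // t It; rewrite gt_eqF // AM_gt0. Qed.

(** Differentiating the orthogonality relations makes the connection matrix antisymmetric up to the
    sign of the timelike vector. The computed entries then leave only [speed], [bend] and [epsh]. *)
Theorem evolute_dual_frame : dual_frame I m nuc conormal evolute speed bend (epsh g v1 v2).
Proof.
have D (x : R -> 'rV[R]_4) t l1 l2 l3 l4 (v : 'rV[R]_4) : scurve I x -> I t -> lor (derive1 x t) (m t) = l1 ->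
   lor (derive1 x t) (nuc t) = l2 -> lor (derive1 x t) (conormal t) = l3 -> lor (derive1 x t) (evolute t) = l4 ->
   l1 *: m t + l2 *: nuc t + l3 *: conormal t - l4 *: evolute t = v -> is_derive t (1 : R) x v.
  move=> sx It <- <- <- <- <-.
  have H := frame_expand (evolute_frame_sq It) (evolute_frame_ort It) (derive1 x t).
  exact: (eq_ind _ (is_derive t (1 : R) x) (scurve_derive sx It) _ H).
have sw := scurve_conormal; have se := scurve_evolute; have sn := scurve_nu.
have xm (x : R -> 'rV[R]_4) t l : scurve I x -> (forall s, I s -> lor (m s) (x s) = 0) -> I t ->
   lor (x t) (nuc t) = l -> lor (derive1 x t) (m t) = speed t * l.
  move=> sx H It <-; apply: (etrans (derive1_lor_cst oI sx sm (c := 0) _ It)).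
    by move=> s Is; rewrite lorC H.
  by rewrite dm // lorZr mulNr opprK.
have m_w s : I s -> lor (m s) (conormal s) = 0 by move=> /evolute_frame_ort [[_ h _] _ _ _].
have m_n s : I s -> lor (m s) (nuc s) = 0 by move=> /evolute_frame_ort [[h _ _] _ _ _].
have m_e s : I s -> lor (m s) (evolute s) = 0 by move=> /evolute_frame_ort [[_ _ h] _ _ _].
split => //.
- exact: evolute_frame_sq.
- exact: evolute_frame_ort.
- by move=> t It; exact: (eq_ind _ (is_derive t (1 : R) m) (scurve_derive sm It) _ (dm It)).
- move=> t It; have [_ nn _ _] := evolute_frame_sq It.
  have n_m : lor (derive1 nuc t) (m t) = speed t.
    exact: (etrans (xm _ _ _ sn m_n It nn) (mulr1 _)).
  have n_n : lor (derive1 nuc t) (nuc t) = 0 by apply: (self0 sn (c := 1)) => // s /evolute_frame_sq [].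
  have [H _ _] := sparse_combination (speed t) (bend t) (m t) (nuc t) (conormal t) (evolute t).
  exact: (D _ _ _ _ _ _ _ sn It n_m n_n (dnu_conormal It) (dnu_evolute It) H).
- move=> t It; have [_ nw _ _] := evolute_frame_ort It.
  have w_m : lor (derive1 conormal t) (m t) = 0.
    by apply: (etrans (xm _ _ 0 sw m_w It _) (mulr0 _)); rewrite lorC.
  have w_n : lor (derive1 conormal t) (nuc t) = - bend t.
    rewrite (derive1_lor_cst oI sw sn (c := 0) _ It); first by rewrite lorC dnu_conormal.
    by move=> s /evolute_frame_ort [_ h _ _]; rewrite lorC.
  have w_w : lor (derive1 conormal t) (conormal t) = 0 by apply: (self0 sw (c := 1)) => // s /evolute_frame_sq [].
  have w_e : lor (derive1 conormal t) (evolute t) = - epsh g v1 v2 t.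
    rewrite (derive1_lor_cst oI sw se (c := 0) _ It); first by rewrite lorC devolute_conormal.
    by move=> s /evolute_frame_ort [].
  have [_ H _] := sparse_combination (- bend t) (epsh g v1 v2 t) (m t) (nuc t) (conormal t) (evolute t).
  exact: (D _ _ _ _ _ _ _ sw It w_m w_n w_w w_e H).
- move=> t It; have [[_ _ mE] nw nE wE0] := evolute_frame_ort It.
  have e_m : lor (derive1 evolute t) (m t) = 0.
    by apply: (etrans (xm _ _ 0 se m_e It _) (mulr0 _)); rewrite lorC.
  have e_n : lor (derive1 evolute t) (nuc t) = 0.
    rewrite (derive1_lor_cst oI se sn (c := 0) _ It); first by rewrite lorC dnu_evolute // oppr0.
    by move=> s /evolute_frame_ort [_ _ h _]; rewrite lorC.
  have e_e : lor (derive1 evolute t) (evolute t) = 0 by apply: (self0 se (c := -1)) => // s /evolute_frame_sq [].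
  have [_ _ H] := sparse_combination (epsh g v1 v2 t) 0 (m t) (nuc t) (conormal t) (evolute t).
  exact: (D _ _ _ _ _ _ _ se It e_m e_n (devolute_conormal It) e_e H).
- by move=> t It; split; [exact: D_gt0|rewrite divr_gt0 ?r_gt0 // AM_gt0].
- by move=> t It; split; apply: scurve_continuous It; [exact: sD|exact: scurve_bend|exact: scurve_epsh].
Qed.

End FramedCurve.

(** * The identifier of singularities and its derivative *)

Section Singularities.
Variables (R : realType) (I : set R) (g v1 v2 : R -> 'rV[R]_4).
Hypotheses (oI : open I) (fc : hyp_framed_curve I g v1 v2)
  (ab : forall t, I t -> a_ g v1 v2 t ^+ 2 + b_ g v1 v2 t ^+ 2 != 0)
  (sg : forall t, I t -> 0 < sigmaF g v1 v2 t).

Let fr := evolute_dual_frame oI fc ab sg.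

Definition lam_factor t := bend g v1 v2 t *
  \det (rows4 (mu g v1 v2 t) (conormal g v1 v2 t) (nu g v1 v2 t) (evolute g v1 v2 t)).

(** The t-derivative of the surface is - D times its theta-derivative plus s sin(theta) w, so only
    the last term counts in the determinant; F and its theta-derivative are a rotation of mu and
    nu. *)
Lemma lamFE (p : 'rV[R]_2) : I (p 0 t_) -> lamF g v1 v2 p = sin (p 0 th_) * lam_factor (p 0 t_).
Proof.
move=> Ip; rewrite /lamF (evoluteE sg Ip).
have dF v := derive_dualF fr v Ip.
rewrite -[Fd g v1 v2]/(dualF (mu g v1 v2) (nu g v1 v2)) !dF e_t_t e_t_th e_th_t e_th_th /dualF /lam_factor.
move: (cos2Dsin2 (p 0 th_)).
move: (mu g v1 v2 (p 0 t_)) (nu g v1 v2 (p 0 t_)) (conormal g v1 v2 (p 0 t_)) (evolute g v1 v2 (p 0 t_)).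
move: (cos _) (sin _) (speed _ _ _ _) (bend _ _ _ _) => c s D r x y z u cs.
have -> : 1 *: (c *: (- D *: y) + s *: (D *: x + r *: z)) + 0 *: (- s *: x + c *: y) =
  - D *: (- s *: x + c *: y) + (s * r) *: z by apply/rowP => j; rewrite !mxE; ring.
have -> : 0 *: (c *: (- D *: y) + s *: (D *: x + r *: z)) + 1 *: (- s *: x + c *: y) = - s *: x + c *: y.
  by rewrite scale0r add0r scale1r.
by rewrite det_rows4_rotate cs mulr1 mulrA.
Qed.

(** The determinant is that of a pseudo-orthonormal frame, with nu and the conormal exchanged, and
    [bend] is positive. *)
Lemma lam_factor_neq0 t : I t -> lam_factor t != 0.
Proof.
move=> It; have [_ s0] := df_pos fr It; rewrite mulf_neq0 ?(lt0r_neq0 s0) //.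
have [h1 h2 h3 h4] := df_sq fr It.
 have [[k1 k2 k3] k4 k5 k6] := df_ort fr It.
rewrite lorC in k4.
have := frame_unit (And4 h1 h3 h2 h4) (And4 (And3 k2 k1 k3) k4 k6 k5).
by rewrite unitmxE unitfE.
Qed.

Lemma scurve_lam_factor : scurve I lam_factor.
Proof.
have sw := scurve_conormal oI fc ab sg; have se := scurve_evolute oI fc ab sg.
have sm : scurve I (mu g v1 v2) := df_mu fr; have sn : scurve I (nu g v1 v2) := df_nu fr.
have H := scurveM oI (scurve_bend oI fc ab sg) (scurve_lor oI (scurve_wedge oI sw sn se) sm).
by apply: (smooth_ext (strip_open oI) _ H) => p _; rewrite /lam_factor det_rows4.
Qed.

(** Where sin(theta) = 0 the derivative of [lam_factor] is multiplied by 0, so only the theta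
    component of [v] matters. Transversality to the singular curve is thus read off that
    component. *)
Lemma derive_lamF (p v : 'rV[R]_2) : I (p 0 t_) -> sin (p 0 th_) = 0 ->
  differentiable (lamF g v1 v2) p /\ 'D_v (lamF g v1 v2) p = cos (p 0 th_) * v 0 th_ * lam_factor (p 0 t_).
Proof.
move=> Ip sp; have oS := strip_open oI.
have sth : smooth (strip I) (fun q : 'rV[R]_2 => q 0 th_ : R) by exact: smooth_coord.
have ss := smooth_sin oS sth; have sl := scurve_lam_factor.
have near_eq : {near p, (fun q : 'rV[R]_2 => sin (q 0 th_) * lam_factor (q 0 t_)) =1 lamF g v1 v2}.
  by apply: (near_open oS Ip) => q Iq; rewrite lamFE.
have dp := smooth_diff (smoothM oS ss sl) Ip.
split; first exact: near_eq_differentiable near_eq dp.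
have -> : 'D_v (lamF g v1 v2) p = 'D_v (fun q : 'rV[R]_2 => sin (q 0 th_) * lam_factor (q 0 t_)) p.
  by apply: near_eq_derive; apply: filterS near_eq => q ->.
have Ds := derivableP (smooth_derivable (v := v) ss Ip); have Dl := derivableP (smooth_derivable (v := v) sl Ip).
have [_ ->] := is_deriveM Ds Dl.
rewrite sp (derive_comp1 v (smooth_diff sth Ip) (is_derive_sin (p 0 th_))).
have -> : 'D_v (fun q : 'rV[R]_2 => q 0 th_ : R) p = v 0 th_.
  by rewrite -derive_rV ?derive_id // ; exact: differentiable_id.
by rewrite scale0r add0r /GRing.scale /= mulrC.
Qed.

End Singularities.

Theorem mainTheorem7 (R : realType) (I : set R) (g v1 v2 : R -> 'rV[R]_4)
  (p0 : 'rV[R]_2) :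
  is_interval I -> open I ->
  hyp_framed_curve I g v1 v2 ->
  (forall t, I t -> a_ g v1 v2 t ^+ 2 + b_ g v1 v2 t ^+ 2 != 0) ->
  (forall t, I t -> 0 < sigmaF g v1 v2 t) ->
  I (p0 0 t_) -> 0 <= p0 0 th_ < 2 * pi ->
  singular_point (Fd g v1 v2) p0 ->
  [/\ first_kind (Fd g v1 v2) (lamF g v1 v2) p0,
      cuspidal_edge (Fd g v1 v2) p0 <-> epsh g v1 v2 (p0 0 t_) != 0 &
      cuspidal_crosscap (Fd g v1 v2) p0 <->
        (epsh g v1 v2 (p0 0 t_) = 0 /\ derive1 (epsh g v1 v2) (p0 0 t_) != 0)].
Proof.
move=> _ oI fc ab sg It _ sing.
have fr := evolute_dual_frame oI fc ab sg.
(* A single kernel vector at [p0] already locates the singular set; its nonzero theta component, due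
   to D > 0, gives the first kind. *)
have ker (eta : 'rV[R]_2) : eta != 0 -> 'D_eta (Fd g v1 v2) p0 = 0 -> sin (p0 0 th_) = 0 /\ eta 0 th_ != 0.
  move=> eta0 /(kernel_dualF fr It) [k1 k2]; have [D0 _] := df_pos fr It.
  have t0 : eta 0 t_ != 0.
    apply: contraNneq eta0 => h; apply/eqP; apply: eq_pt; rewrite mxE //.
    by rewrite k2 h mulr0.
  split; first by apply: (mulIf t0); rewrite k1 mul0r.
  by rewrite k2 mulf_neq0 // gt_eqF.
have s0 : sin (p0 0 th_) = 0 by have [eta [eta0 /(ker _ eta0) []]] := sing.
have c0 : cos (p0 0 th_) != 0.
  by apply: contra_eq_neq (cos_sq1 s0) => ->; rewrite mul0r eq_sym oner_eq0.
have lam0 (eta : 'rV[R]_2) : eta 0 th_ != 0 -> 'D_eta (lamF g v1 v2) p0 != 0.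
  move=> eta0; have [_ ->] := derive_lamF oI fc ab sg eta It s0.
  exact: (mulf_neq0 (mulf_neq0 c0 eta0) (lam_factor_neq0 oI fc ab sg It)).
have De : is_derive (p0 0 t_) (1 : R) (epsh g v1 v2) (derive1 (epsh g v1 v2) (p0 0 t_)).
  exact: (scurve_derive (scurve_epsh oI fc ab sg) It).
split.
- split => //; split.
    split; first by have [] := derive_lamF oI fc ab sg 0 It s0.
    by exists (e_th R); apply: lam0; rewrite e_th_th oner_neq0.
  by move=> eta eta0 /(ker _ eta0) [_ h]; exact: lam0.
- rewrite -{1}(ptK p0); split; first exact: (dualF_cuspidal_edge_necessity fr It s0).
  exact: (dualF_cuspidal_edge fr It s0).
- rewrite -{1}(ptK p0); split.
    by move=> /(dualF_cuspidal_crosscap_necessity fr It s0) [-> /(_ _ De)].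
  by move=> [e0 e1]; exact: (dualF_cuspidal_crosscap fr It s0 e0 De e1).
Qed.
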